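(* Let $f:\mathbb{R}^n\times\mathbb{R}^m\to\mathbb{R}^n$ be continuous with $\sup_{y\in\mathbb{R}^m}|f(x,y)|\le a+b|x|$ for all $x\in\mathbb{R}^n$, for some $a,b>0$. Let $g:\mathbb{R}^n\times\mathbb{R}^m\times\mathbb{R}\to\mathbb{R}^m$ be admissible (for every compact $K\subset\mathbb{R}^n\times\mathbb{R}^m$, $g$ is bounded and uniformly continuous on $K\times\mathbb{R}$) and uniformly Lipschitz in $y$ on compact sets (for all compact $K_0\subset\mathbb{R}^n$, $K\subset\mathbb{R}^m$ there is $L=L(K_0,K)$ with $|g(x,y_1,\tau)-g(x,y_2,\tau)|\le L|y_1-y_2|$ for all $y_1,y_2\in K$, $x\in K_0$, $\tau\in\mathbb{R}$). Let $\mathcal{H}$ be the hull of $g$. Assume that for each $h\in\mathcal{H}$, $x\in\mathbb{R}^n$, $y_0\in\mathbb{R}^m$ the solution $y(\tau,h,x,y_0)$ is defined for all $\tau\ge 0$, and that for each compact $K_0\subset\mathbb{R}^n$ the solutions of the parametric family $y'=g(x,y,\tau)$, $x\in K_0$, are uniformly ultimately bounded. Fix $x_0\in\mathbb{R}^n$, $y_0\in\mathbb{R}^m$ and for each $\varepsilon>0$ let $(x_\varepsilon(t),y_\varepsilon(t))$ be a solution of $$\dot x=f(x,y),\qquad \varepsilon\dot y=g(x,y,t/\varepsilon),\qquad x(0)=x_0,\ y(0)=y_0,$$ and write $Y_\varepsilon(\tau):=y_\varepsilon(\varepsilon\tau)$ for the fast component in the fast time $\tau=t/\varepsilon$. Then,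 given $t_0>0$, for $\varepsilon$ small enough $(x_\varepsilon(t),y_\varepsilon(t))$ can be extended to $t\in[0,t_0]$. Furthermore: (i) Every sequence of positive numbers $\varepsilon_j\to0$ has a subsequence, say $\varepsilon_k\downarrow 0$, such that $x_{\varepsilon_k}(t)$ converges uniformly for $t\in[0,t_0]$ to a solution $x_0(t)$, $t\in[0,t_0]$, of the differential inclusion $$\dot x\in\Big\{\int_{\mathbb{R}^m}f(x,y)\,d\mu(y)\ \Big|\ \mu\in M\big(\mathbb{A}^x_{\mathcal{O}(g)}\big)\Big\},\qquad x(0)=x_0 .$$ (ii) For such a sequence $\varepsilon_k$ and limit $x_0(\cdot)$, for a fixed small $r>0$ let $K_0:=\{x_0(t)+x\mid t\in[0,t_0],\ x\in\mathbb{R}^n,\ |x|\le r\}$ (a compact set) and let $\mathbb{A}\subset\mathcal{H}\times K_0\times\mathbb{R}^m$ be the global attractor of the layered skew-product semiflow $\pi$ on $\mathcal{H}\times K_0\times\mathbb{R}^m$, with sections $A_{(h,x)}$. Then, given $\delta>0$, there exist $T=T(\delta,y_0,\mathbb{A})>0$ and an integer $k_0=k_0(\delta,T)>0$ with $2T<t_0/\varepsilon_{k_0}$ such that for every $k\ge k_0$, $$\mathrm{dist}\big(Y_{\varepsilon_k}(\tau),A_{(g\cdot\tau,\,x_0(\varepsilon_k\tau))}[\delta]\big)\le\delta\quad\text{for all }\tau\in[T,t_0/\varepsilon_k].$$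
   Context: Hull. $(g\cdot s)(x,y,\tau)=g(x,y,\tau+s)$; $\mathcal{H}$ is the closure of $\{g\cdot s\mid s\in\mathbb{R}\}$ in the compact-open topology, a compact metric space with a fixed metric $d$, on which $(\tau,h)\mapsto h\cdot\tau$ (translation in the last variable) is a continuous flow. $\mathcal{O}(g)\subset\mathcal{H}$ is the omega-limit set of $g$, i.e. the set of limits of sequences $g\cdot\tau_k$ with $\tau_k\to\infty$. Solutions. For $h\in\mathcal{H}$, $x\in\mathbb{R}^n$: $y(\tau,h,x,\tau_0,y_0)$ is the solution of $y'=h(x,y,\tau)$ ($x$ a fixed parameter) with $y(\tau_0)=y_0$, and $y(\tau,h,x,y_0):=y(\tau,h,x,0,y_0)$. Uniform ultimate boundedness of $y'=g(x,y,\tau)$, $x\in K_0$: there is $c>0$ such that for every $\rho>0$ there is $T=T(\rho)$ with $|y(\tau+\tau_0,g,x,\tau_0,y_0)|\le c$ for all $x\in K_0$, $\tau_0\in\mathbb{R}$, $\tau\ge T$, $|y_0|\le \rho$. Semiflows. For compact $K_0\subset\mathbb{R}^n$, the layered semiflow is $\pi(\tau,h,x,y_0)=(h\cdot\tau,x,y(\tau,h,x,y_0))$, $\tau\ge0$, on $\mathcal{H}\times K_0\times\mathbb{R}^m$. For fixed $x\in\mathbb{R}^n$, $\pi^x(\tau,h,y_0)=(h\cdot\tau,y(\tau,h,x,y_0))$ on $\mathcal{H}\times\mathbb{R}^m$. Under the stated assumptions both have global attractors $\mathbb{A}\subset\mathcal{H}\times K_0\times\mathbb{R}^m$ and $\mathbb{A}^x\subset\mathcal{H}\times\mathbb{R}^m$: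 the global attractor of a skew-product semiflow on $P\times\mathbb{R}^m$ ($P$ compact) is the nonempty compact invariant set ($\pi_\tau(\mathbb{A})=\mathbb{A}$ for $\tau\ge0$) with $\lim_{\tau\to\infty}\mathrm{dist}(\pi_\tau(P\times D),\mathbb{A})=0$ for every bounded $D\subset\mathbb{R}^m$. Sections: $A_{(h,x)}=\{y\mid(h,x,y)\in\mathbb{A}\}$. Parametrically inflated pullback attractor: for $\delta>0$, $A_{(h,x)}[\delta]=\bigcup A_{(\tilde h,\tilde x)}$, the union over $(\tilde h,\tilde x)\in\mathcal{H}\times K_0$ with $\max\{d(h,\tilde h),|x-\tilde x|\}\le\delta$. $\mathrm{dist}(Y_1,Y_2)=\sup_{y_1\in Y_1}\inf_{y_2\in Y_2}d(y_1,y_2)$ is the Hausdorff semidistance (distance from a point to a set when $Y_1$ is a point). $\mathbb{A}^x_{\mathcal{O}(g)}:=\mathbb{A}^x\cap(\mathcal{O}(g)\times\mathbb{R}^m)$, and $M(\mathbb{A}^x_{\mathcal{O}(g)})$ is the set of marginals (projections) on $\mathbb{R}^m$ of the $\pi^x$-invariant normalized Borel measures supported on $\mathbb{A}^x_{\mathcal{O}(g)}$. A solution of a differential inclusion $\dot x\in F(x)$ on $[0,t_0]$ is an absolutely continuous function with $\dot x(t)\in F(x(t))$ for a.e. $t\in[0,t_0]$. *)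

(* Defs.v *)
From HB Require Import structures.
From mathcomp Require Import all_boot all_order all_algebra.
From mathcomp Require Import all_classical all_reals all_analysis.

Set Implicit Arguments.
Unset Strict Implicit.
Unset Printing Implicit Defensive.
Import Order.TTheory GRing.Theory Num.Theory.
Import numFieldNormedType.Exports.

Local Open Scope classical_set_scope.
Local Open Scope ring_scope.

(* Vector fields h(x, y, tau), uncurried. *)
Notation vfield R n m :=
  {compact-open, ('rV[R]_n * 'rV[R]_m * R)%type -> 'rV[R]_m}.

Notation borel T := (g_sigma_algebraType (@open T)).

Section Defs.
Context {R : realType}.

(* Euclidean norm; the library norm on 'rV[R]_n is the sup norm. *)
Definition eucl_norm n (v : 'rV[R]_n) : R := Num.sqrt (\sum_i v ord0 i ^+ 2).

Definition eucl_dist n (v w : 'rV[R]_n) : R := eucl_norm (v - w).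

(* v is the derivative at t of u restricted to I; one-sided at an endpoint
   of I that belongs to I. *)
Definition deriv_within n (I : set R) (u : R -> 'rV[R]_n) (t : R)
    (v : 'rV[R]_n) : Prop :=
  (s - t)^-1 *: (u s - u t) @[s --> within I t^'] --> v.

(* Valued in \bar R, so that the infimum over the empty set is +oo. *)
Definition semidist (W : Type) (dW : W -> W -> R) (A B : set W) : \bar R :=
  ereal_sup [set ereal_inf [set (dW a b)%:E | b in B] | a in A].

Section Fields.
Context {n m : nat}.
Notation X := 'rV[R]_n.
Notation Y := 'rV[R]_m.
Notation VF := (vfield R n m).

Definition admissible (g : VF) : Prop :=
  forall K : set (X * Y), compact K ->
    (exists M : R, forall x y tau, K (x, y) -> eucl_norm (g (x, y, tau)) <= M) /\
    (forall e : R, 0 < e -> exists2 eta : R, 0 < eta &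
      forall x1 y1 tau1 x2 y2 tau2, K (x1, y1) -> K (x2, y2) ->
        eucl_dist x1 x2 < eta -> eucl_dist y1 y2 < eta -> `|tau1 - tau2| < eta ->
        eucl_dist (g (x1, y1, tau1)) (g (x2, y2, tau2)) < e).

Definition uniformly_lipschitz (g : VF) : Prop :=
  forall (K0 : set X) (K : set Y), compact K0 -> compact K ->
    exists L : R, forall y1 y2 x tau, K y1 -> K y2 -> K0 x ->
      eucl_dist (g (x, y1, tau)) (g (x, y2, tau)) <= L * eucl_dist y1 y2.

Definition translate (h : VF) (s : R) : VF :=
  fun p => h (p.1.1, p.1.2, p.2 + s).

(* The carrier of VF is all functions: intersecting the closure with the
   continuous ones gives the closure in C(X x Y x R, Y). *)
Definition hull (g : VF) : set VF :=
  closure [set translate g s | s in [set: R]] `&`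
  [set h : VF | continuous (h : (X * Y * R)%type -> Y)].

(* d is a metric on H that induces the topology of H as a subspace of VF. *)
Definition metrizes (H : set VF) (d : VF -> VF -> R) : Prop :=
  [/\ forall h k, H h -> H k -> 0 <= d h k,
      forall h k, H h -> H k -> (d h k = 0 <-> h = k),
      forall h k, H h -> H k -> d h k = d k h,
      forall h k l, H h -> H k -> H l -> d h l <= d h k + d k l
    & forall (h : VF) (U : set VF), H h ->
        (within H (nbhs h) U <->
         exists2 e : R, 0 < e & forall k, H k -> d h k < e -> U k)].

Definition omega_limit (g : VF) : set VF :=
  hull g `&` [set h | exists2 tau : nat -> R, tau @ \oo --> +oo &
    {compact-open, (fun k => translate g (tau k)) @ \oo --> h}].

Definition fast_sol (h : VF) (x : X) (tau0 : R) (y0 : Y) (u : R -> Y) : Prop :=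
  u tau0 = y0 /\
  forall tau, tau0 <= tau ->
    deriv_within `[tau0, +oo[ u tau (h (x, u tau, tau)).

(* The solution y(tau, h, x, tau0, y0); only its values at tau >= tau0 are
   determined. *)
Definition ysol (h : VF) (x : X) (tau0 : R) (y0 : Y) : R -> Y :=
  get [set u | fast_sol h x tau0 y0 u].

Definition unif_ult_bounded (g : VF) (K0 : set X) : Prop :=
  exists2 c : R, 0 < c & forall rho : R, 0 < rho ->
    exists2 T : R, 0 <= T & forall x tau0 tau y0,
      K0 x -> T <= tau -> eucl_norm y0 <= rho ->
      eucl_norm (ysol g x tau0 y0 (tau + tau0)) <= c.

Definition layered_semiflow (tau : R) (p : VF * X * Y) : VF * X * Y :=
  (translate p.1.1 tau, p.1.2, ysol p.1.1 p.1.2 0 p.2 tau).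

Definition semiflow_at (x : X) (tau : R) (p : VF * Y) : VF * Y :=
  (translate p.1 tau, ysol p.1 x 0 p.2 tau).

(* Global attractor of a skew-product semiflow phi on P x R^m, where P is a
   compact set in W metrized by dW.  A nonempty D is required because the
   supremum defining semidist set0 A is -oo. *)
Definition is_global_attractor (W : topologicalType) (P : set W)
    (dW : W -> W -> R) (phi : R -> W * Y -> W * Y) (A : set (W * Y)) : Prop :=
  [/\ A `<=` P `*` setT, A !=set0, compact A,
      forall tau, 0 <= tau -> phi tau @` A = A
    & forall D : set Y, D !=set0 -> bounded_set D ->
        semidist (fun p q => Num.max (dW p.1 q.1) (eucl_dist p.2 q.2))
          (phi tau @` (P `*` D)) A @[tau --> +oo] --> 0%E].

Definition global_attractor (W : topologicalType) (P : set W)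
    (dW : W -> W -> R) (phi : R -> W * Y -> W * Y) : set (W * Y) :=
  get [set A | is_global_attractor P dW phi A].

Definition dist_par (d : VF -> VF -> R) (p q : VF * X) : R :=
  Num.max (d p.1 q.1) (eucl_dist p.2 q.2).

Definition layered_attractor (g : VF) (d : VF -> VF -> R) (K0 : set X) :
    set (VF * X * Y) :=
  global_attractor (hull g `*` K0) (dist_par d) layered_semiflow.

Definition attractor_at (g : VF) (d : VF -> VF -> R) (x : X) : set (VF * Y) :=
  global_attractor (hull g) d (semiflow_at x).

Definition att_section (A : set (VF * X * Y)) (h : VF) (x : X) : set Y :=
  [set y | A (h, x, y)].

Definition inflated (g : VF) (d : VF -> VF -> R) (K0 : set X)
    (A : set (VF * X * Y)) (delta : R) (h : VF) (x : X) : set Y :=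
  \bigcup_(p in [set p | (hull g `*` K0) p /\ dist_par d (h, x) p <= delta])
    att_section A p.1 p.2.

(* nu is a probability on the Borel sets of VF x R^m, concentrated on
   S (a subset of hull g x R^m) and invariant under semiflow_at x. *)
Definition invariant_measure (g : VF) (x : X) (S : set (VF * Y))
    (nu : probability (borel (VF * Y)%type) R) : Prop :=
  nu (~` S) = 0%E /\
  forall (tau : R) (B : set (borel (VF * Y)%type)), 0 <= tau -> measurable B ->
    nu ((hull g `*` setT) `&` semiflow_at x tau @^-1` B) = nu B.

Definition marginals (g : VF) (d : VF -> VF -> R) (x : X) :
    set (probability (borel Y) R) :=
  [set mu | exists2 nu : probability (borel (VF * Y)%type) R,
     invariant_measure g x
       (attractor_at g d x `&` (omega_limit g `*` setT)) nu &
     forall B : set (borel Y), measurable B -> mu B = nu (snd @^-1` B)].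

Definition averaged_field (f : X * Y -> X) (g : VF) (d : VF -> VF -> R)
    (x : X) : set X :=
  [set \row_i (\int[mu]_y f (x, y) ord0 i) | mu in marginals g d x].

Definition slow_fast_sol (f : X * Y -> X) (g : VF) (x0 : X) (y0 : Y) (e : R)
    (I : set R) (x : R -> X) (y : R -> Y) : Prop :=
  [/\ x 0 = x0, y 0 = y0 &
      forall t, I t ->
        deriv_within I x t (f (x t, y t)) /\
        exists2 v : Y, deriv_within I y t v & e *: v = g (x t, y t, t / e)].

End Fields.

Definition forward_interval (I : set R) : Prop :=
  [/\ is_interval I, I 0, I `<=` `[0, +oo[ & exists2 t, 0 < t & I t].

Definition abs_continuous n (a b : R) (u : R -> 'rV[R]_n) : Prop :=
  forall e : R, 0 < e -> exists2 eta : R, 0 < eta &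
    forall (k : nat) (s t : 'I_k -> R),
      (forall i, [/\ a <= s i, s i <= t i & t i <= b]) ->
      (forall i j, i != j -> t i <= s j \/ t j <= s i) ->
      \sum_i (t i - s i) < eta -> \sum_i eucl_dist (u (t i)) (u (s i)) < e.

Definition inclusion_sol n (F : 'rV[R]_n -> set 'rV[R]_n) (x0 : 'rV[R]_n)
    (t0 : R) (z : R -> 'rV[R]_n) : Prop :=
  [/\ z 0 = x0, abs_continuous 0 t0 z &
      {ae @lebesgue_measure R, forall t, `[0, t0]%classic t ->
         exists2 v, F (z t) v & deriv_within `[0, t0] z t v}].

Definition converges_to_inclusion n (F : 'rV[R]_n -> set 'rV[R]_n)
    (x0 : 'rV[R]_n) (t0 : R) (xe : R -> R -> 'rV[R]_n) (e : nat -> R)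
    (z : R -> 'rV[R]_n) : Prop :=
  [/\ forall k, 0 < e k, nonincreasing_seq e, e @ \oo --> 0,
      {uniform `[0, t0], (fun k => xe (e k)) @ \oo --> z}
    & inclusion_sol F x0 t0 z].

Definition tube n (z : R -> 'rV[R]_n) (t0 r : R) : set 'rV[R]_n :=
  [set z t + x | t in `[0, t0] & x in [set x | eucl_norm x <= r]].

End Defs.

(* Main.v *)
(** The field f is bounded on bounded sets of x uniformly in y, so the slow
    components are equi-Lipschitz and have limits z along ultrafilters, uniformly
    on [0, t0]. Let z have derivative v at t. On a window [t, t + s] with
    eps << s << 1 the fast component follows the frozen skew-product semiflow at
    x = z(t); the averages of its samples, on a fine mesh in fast time, define a
    Borel probability on hull x R^m which is invariant under the frozen semiflow,
    sits on its attractor, and lives over the omega-limit set because t / eps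
    tends to infinity. The increment of the slow component on the window is the
    sum of the corresponding values of f, hence v is the integral of f(z(t), .)
    against the marginal of that measure. Lipschitz curves are differentiable
    almost everywhere, which gives (i).

    For (ii), the slow variable is frozen on the last stretch of fast length T
    only: the fast component enters that stretch in a bounded set, and T is the
    time after which the layered attractor has attracted this set. The set K0 is
    the projection of the layered attractor, so T depends on K0 through A alone. *)

Require Import Defs.
From HB Require Import structures.
From mathcomp Require Import all_boot all_order all_algebra.
From mathcomp Require Import all_classical all_reals all_analysis.
From mathcomp Require Import measurable_realfun zify ring lra.

Set Implicit Arguments.
Unset Strict Implicit.
Unset Printing Implicit Defensive.
Import Order.TTheory GRing.Theory Num.Theory.
Import numFieldNormedType.Exports.

Local Open Scope classical_set_scope.
Local Open Scope ring_scope.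

(** * Calculus of one-sided derivatives *)

(** Gronwall estimates grow exponentially in fast time, so a frozen solution can be followed only
    for a fixed fast time while the windows grow without bound; invariance and attraction are
    therefore tested at a fixed time [s], and only the averaging uses the length of the window.
    Trajectories are never integrated: increments are controlled by mean value inequalities for
    derivatives relative to an interval, and time averages are finite sums over a mesh. An
    ultrafilter makes all bounded averages converge at once, but the resulting set function is only
    finitely additive, so a Borel probability has to be rebuilt from it by approximating open sets
    from inside. The space of all fields with the compact-open topology is not given a metric;
    compactness, attractors and measures are obtained on the hull with the metric [d] and then
    transported along the inclusion. Statements along the ultrafilter become a subsequence only at
    the end, by a diagonal choice. *)

Section RealLine.
Context {R : realType}.

(** The supremum [c] of the times up to which [Q] holds throughout is good by the first hypothesis,
    and if [c < b] the second one pushes past it. *)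
Lemma real_induction (a b : R) (Q : R -> Prop) :
  (forall t, a <= t <= b -> (forall s, a <= s < t -> Q s) -> Q t) ->
  (forall t, a <= t < b -> (forall s, a <= s <= t -> Q s) ->
     exists2 e : R, 0 < e & forall s, t < s < t + e -> s <= b -> Q s) ->
  forall t, a <= t <= b -> Q t.
Proof.
move=> Hc Ho t /andP[at_ tb].
pose S := [set s | a <= s <= b /\ forall r, a <= r <= s -> Q r].
(* At [t = a] the premise of the first hypothesis is vacuous, which gives the base case. *)
have Qa : Q a.
  apply: Hc; first by rewrite lexx (le_trans at_).
  by move=> s /andP[as_ sa]; move: (le_lt_trans as_ sa); rewrite ltxx.
have Sa : S a.
  split; first by rewrite lexx (le_trans at_).
  by move=> r /andP[ar ra]; have -> : r = a by apply/eqP; rewrite eq_le ra ar.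
have ubS : has_ubound S by exists b => s [/andP[]].
have hS : has_sup S by split => //; exists a.
pose c := sup S.
have ac : a <= c by apply: ub_le_sup.
have cb : c <= b by apply: ge_sup; [exists a | move=> s [/andP[]]].
have Qlt s : a <= s < c -> Q s.
  move=> /andP[as_ sc].
  have c0 : 0 < c - s by rewrite subr_gt0.
  have [r Sr] := sup_adherent c0 hS.
  rewrite -/c subKr => sr; case: Sr => _; apply.
  by rewrite as_ ltW.
have Qc : Q c by apply: Hc => //; rewrite ac cb.
have [cltb|bc] := ltP c b; last first.
  have [tc|ct] := ltP t c; first by apply: Qlt; rewrite at_.
  by have -> : t = c by apply/eqP; rewrite eq_le ct (le_trans tb).
have Qle s : a <= s <= c -> Q s.
  move=> /andP[as_]; rewrite le_eqVlt => /predU1P[->//|sc].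
  by apply: Qlt; rewrite as_.
have [e e0 He] := Ho c (introT andP (conj ac cltb)) Qle.
pose s := Num.min (c + e / 2) b.
have cs : c < s by rewrite lt_min cltb andbT; lra.
have se : s < c + e by rewrite gt_min; apply/orP; left; lra.
have sb : s <= b by rewrite ge_min lexx orbT.
have : S s.
  split; first by rewrite sb (le_trans ac (ltW cs)).
  move=> r /andP[ar rs]; have [rc|cr] := leP r c; first by apply: Qle; rewrite ar.
  by apply: He; [rewrite cr (le_lt_trans rs)|exact: le_trans sb].
by move=> /(ub_le_sup ubS); rewrite -/c leNgt cs.
Qed.

(** The bounding function [q] satisfies [q s >= q t + (s - t) (L q t + eta)], so [w <= q] propagates
    to the right by a first-order step and to limits by continuity. The growth condition is asked
    only while [w <= B]; since [q] stays below [B], a Lipschitz constant valid on a bounded region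
    is enough. *)
Lemma gronwall (a b L eta w0 B : R) (w : R -> R) :
  0 <= L -> 0 <= eta -> 0 <= w0 -> w a <= w0 ->
  (w0 + eta * (b - a)) * expR (L * (b - a)) <= B ->
  (forall t, a <= t <= b -> forall e, 0 < e -> exists2 d : R, 0 < d &
     forall s, a <= s <= b -> `|s - t| < d -> `|w s - w t| <= e) ->
  (forall t, a <= t < b -> w t <= B -> exists2 d : R, 0 < d &
     forall s, t < s < t + d -> s <= b ->
       w s <= w t + (s - t) * (L * w t + eta)) ->
  forall t, a <= t <= b -> w t <= (w0 + eta * (t - a)) * expR (L * (t - a)).
Proof.
move=> L0 eta0 w00 wa qB wc wd.
pose q t := (w0 + eta * (t - a)) * expR (L * (t - a)).
have qmono s t : a <= s <= t -> q s <= q t.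
  move=> /andP[as_ st]; rewrite /q ler_pM ?expR_ge0//.
  - by rewrite addr_ge0// mulr_ge0// subr_ge0.
  - by rewrite lerD2l ler_wpM2l// lerD2r.
  - by rewrite ler_expR ler_wpM2l// lerD2r.
apply: real_induction => [t /andP[at_ tb] IH|t /andP[at_ tb] IH].
- have [tlea|alt] := leP t a.
    have -> : t = a by apply/eqP; rewrite eq_le tlea at_.
    by rewrite !subrr !mulr0 addr0 expR0 mulr1.
  apply/ler_addgt0Pr => e e0.
  have [|d d0 Hd] := wc t _ e e0; first by rewrite at_ tb.
  pose s := Num.max a (t - d / 2).
  have sa : a <= s by rewrite le_max lexx.
  have st : s < t by rewrite gt_max alt /=; lra.
  have sd : `|s - t| < d.
    have : t - d / 2 <= s by rewrite le_max lexx orbT.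
    rewrite ltr0_norm ?subr_lt0//; lra.
  have := Hd s _ sd; rewrite sa (le_trans (ltW st) tb) => /(_ isT) wst.
  have ws := IH s; rewrite sa st in ws; have {}ws := ws isT.
  have qst : q s <= q t by apply: qmono; rewrite sa ltW.
  have := ler_norm (w t - w s); rewrite distrC => h.
  rewrite -/(q t); rewrite -/(q s) in ws; lra.
- have wt : w t <= q t by apply: IH; rewrite at_ lexx.
  have qtB : q t <= B.
    by apply: le_trans qB; rewrite -/(q b); apply: qmono; rewrite at_ ltW.
  have [||d d0 Hd] := wd t; [by rewrite at_ tb|exact: le_trans qtB|].
  exists d => // s /andP[ts sd] sb; rewrite -/(q s).
  have {}Hd : w s <= w t + (s - t) * (L * w t + eta) by apply: Hd; rewrite ?ts.
  apply: (le_trans Hd).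
  have st0 : 0 <= s - t by rewrite subr_ge0 ltW.
  apply: (@le_trans _ _ (q t + (s - t) * (L * q t + eta))).
    by rewrite lerD// ler_wpM2l// lerD2r ler_wpM2l.
  pose E := expR (L * (t - a)).
  have E1 : 1 <= E.
    by rewrite -expR0 ler_expR mulr_ge0// subr_ge0.
  have -> : q s = (w0 + eta * (t - a) + eta * (s - t)) * E * expR (L * (s - t)).
    by rewrite /q /E -mulrA -expRD -mulrDr; congr (_ * expR _); ring.
  have e1 : 1 + L * (s - t) <= expR (L * (s - t)) by exact: expR_ge1Dx.
  have ta0 : 0 <= t - a by rewrite subr_ge0.
  have Z0 : 0 <= w0 + eta * (t - a) by rewrite addr_ge0// mulr_ge0.
  (* Replacing the exponential increment by [1 + L h] leaves a polynomial inequality whose excess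
     [h eta (E - 1) + h eta E L h] is nonnegative because [E >= 1]. *)
  apply: (@le_trans _ _ ((w0 + eta * (t - a) + eta * (s - t)) * E * (1 + L * (s - t)))).
    rewrite /q -/E.
    set Z := w0 + _ in Z0 *; set h := s - t in st0 *.
    have -> : (Z + eta * h) * E * (1 + L * h) =
      Z * E + h * (L * (Z * E) + eta) + (h * eta * (E - 1) + h * eta * E * L * h) by ring.
    rewrite lerDl addr_ge0// ?mulr_ge0// ?subr_ge0//; exact: expR_ge0.
  by rewrite ler_wpM2l// mulr_ge0 ?expR_ge0// addr_ge0// mulr_ge0.
Qed.

End RealLine.

Lemma subrACA (V : zmodType) (x y z w : V) : (x - y) - (z - w) = (x - z) - (y - w).
Proof. by rewrite opprD addrACA -opprD. Qed.

Lemma addrBBK (V : zmodType) (x y z : V) : y + z + (x - y - z) = x.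
Proof. by rewrite -[x - y - z]addrA -opprD [LHS]addrC subrK. Qed.

Section Dw.
Context {R : realType} {V : normedModType R}.

(* Derivative of [u] at [t] relative to [I], free of division and of the
   punctured neighbourhood of [deriv_within]. *)
Definition dw (I : set R) (u : R -> V) (t : R) (v : V) : Prop :=
  forall e, 0 < e -> exists2 d : R, 0 < d &
    forall s, I s -> `|s - t| < d -> `|u s - u t - (s - t) *: v| <= e * `|s - t|.

Lemma dwS (I J : set R) u t v : J `<=` I -> dw I u t v -> dw J u t v.
Proof.
move=> JI H e e0; have [d d0 Hd] := H e e0.
by exists d => // s Js; apply: Hd; apply: JI.
Qed.

Lemma dw_lip I u t v : dw I u t v ->
  exists2 d : R, 0 < d & forall s, I s -> `|s - t| < d ->
    `|u s - u t| <= (`|v| + 1) * `|s - t|.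
Proof.
move=> /(_ 1 ltr01)[d d0 H]; exists d => // s Is sd.
have {H} := H s Is sd; rewrite mul1r => H.
have -> : u s - u t = (u s - u t - (s - t) *: v) + (s - t) *: v by rewrite subrK.
apply: (le_trans (ler_normD _ _)); rewrite normrZ mulrDl mul1r addrC [`|v| * _]mulrC.
by rewrite lerD2l.
Qed.

Lemma dw_cont I u t v : dw I u t v -> forall e, 0 < e ->
  exists2 d : R, 0 < d & forall s, I s -> `|s - t| < d -> `|u s - u t| <= e.
Proof.
move=> /dw_lip [d d0 H] e e0.
have v0 : 0 < `|v| + 1 by rewrite ltr_wpDl.
exists (Num.min d (e / (`|v| + 1))); first by rewrite lt_min d0 divr_gt0.
move=> s Is; rewrite lt_min => /andP[sd se].
apply: (le_trans (H _ Is sd)); rewrite mulrC -ler_pdivlMr//; exact: ltW.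
Qed.

Lemma dwB I u1 u2 t v1 v2 : dw I u1 t v1 -> dw I u2 t v2 ->
  dw I (fun s => u1 s - u2 s) t (v1 - v2).
Proof.
move=> H1 H2 e e0; have e20 : 0 < e / 2 by rewrite divr_gt0.
have [d1 d10 {}H1] := H1 _ e20; have [d2 d20 {}H2] := H2 _ e20.
exists (Num.min d1 d2); first by rewrite lt_min d10.
move=> s Is; rewrite lt_min => /andP[sd1 sd2].
have -> : u1 s - u2 s - (u1 t - u2 t) - (s - t) *: (v1 - v2) =
  (u1 s - u1 t - (s - t) *: v1) - (u2 s - u2 t - (s - t) *: v2).
  by rewrite scalerBr (subrACA (u1 s)) (subrACA _ _ (_ *: _)).
apply: (le_trans (ler_normB _ _)).
by have := H1 _ Is sd1; have := H2 _ Is sd2; lra.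
Qed.

Lemma dw_line I (p v : V) (a t : R) : dw I (fun s => p + (s - a) *: v) t v.
Proof.
move=> e e0; exists 1 => // s _ _.
rewrite opprD addrACA subrr add0r -scalerBl -scalerBl.
have -> : s - a - (t - a) - (s - t) = 0 by ring.
by rewrite scale0r normr0 mulr_ge0// ltW.
Qed.

(** The derivative is allowed only [eta / 2]; the other half absorbs the first-order remainder of
    [D]. *)
Lemma dw_gronwall (a b L eta w0 B : R) (D D' : R -> V) :
  0 <= L -> 0 < eta -> 0 <= w0 -> `|D a| <= w0 ->
  (w0 + eta * (b - a)) * expR (L * (b - a)) <= B ->
  (forall t, a <= t <= b -> dw `[a, b] D t (D' t)) ->
  (forall t, a <= t <= b -> `|D t| <= B -> `|D' t| <= L * `|D t| + eta / 2) ->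
  forall t, a <= t <= b -> `|D t| <= (w0 + eta * (t - a)) * expR (L * (t - a)).
Proof.
move=> L0 eta0 w00 Da HB dD D'B; apply: (gronwall (B := B)) => //; first exact: ltW.
- move=> t tab e e0; have [d d0 H] := dw_cont (dD t tab) e0.
  exists d => // s sab sd; apply: le_trans (ler_dist_dist _ _) _.
  by apply: H => //=; rewrite in_itv.
- move=> t /andP[at_ tb] wB.
  have tab : a <= t <= b by rewrite at_ ltW.
  have eta20 : 0 < eta / 2 by rewrite divr_gt0.
  have [d d0 H] := dD t tab _ eta20.
  exists d => // s /andP[ts sd] sb.
  have sab : a <= s <= b by rewrite sb andbT (le_trans at_) ?ltW.
  have st0 : 0 < s - t by rewrite subr_gt0.
  have {H} := H s; rewrite /= in_itv /= sab gtr0_norm// => /(_ isT).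
  have -> : s - t < d by lra.
  move=> /(_ isT) H.
  have -> : D s = D t + (s - t) *: D' t + (D s - D t - (s - t) *: D' t).
    by rewrite addrBBK.
  apply: (le_trans (ler_normD _ _)).
  have h1 := ler_normD (D t) ((s - t) *: D' t).
  rewrite normrZ gtr0_norm// in h1.
  have h2 : (s - t) * `|D' t| <= (s - t) * (L * `|D t| + eta / 2).
    by rewrite ler_pM2l //; apply: D'B => //; exact: le_trans wB _.
  have h3 : (s - t) * (L * `|D t| + eta) =
    (s - t) * (L * `|D t| + eta / 2) + eta / 2 * (s - t) by field.
  rewrite h3; lra.
Qed.

(** Gronwall with [L = 0] for the distance from [u] to the line of slope [v] through [u a]. The
    slack [k'] pays for the remainder of the derivative and is then sent to 0. This inequality takes
    the place of the integral of [u']. *)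
Lemma dw_mean_value (a b e : R) (u u' : R -> V) (v : V) :
  a <= b -> 0 <= e ->
  (forall t, a <= t <= b -> dw `[a, b] u t (u' t)) ->
  (forall t, a <= t <= b -> `|u' t - v| <= e) ->
  `|u b - u a - (b - a) *: v| <= e * (b - a).
Proof.
move=> ab e0 du u'e.
apply/ler_addgt0Pr => k k0.
have ba0 : 0 <= b - a by rewrite subr_ge0.
have k1 : 0 < k / (b - a + 1) by rewrite divr_gt0// ltr_wpDl.
have kk : k / (b - a + 1) * (b - a) <= k.
  rewrite mulrAC ler_pdivrMr ?ltr_wpDl// ler_wpM2l ?ltW//; lra.
suff H : forall k', 0 < k' -> `|u b - u a - (b - a) *: v| <= (e + k') * (b - a).
  by apply: le_trans (H _ k1) _; rewrite mulrDl lerD2l.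
move=> k' k'0.
pose w t := `|u t - (u a + (t - a) *: v)|.
have dD t : a <= t <= b -> dw `[a, b] (fun t => u t - (u a + (t - a) *: v)) t (u' t - v).
  by move=> tab; apply: dwB; [exact: du|exact: dw_line].
have -> : u b - u a - (b - a) *: v = u b - (u a + (b - a) *: v) by rewrite opprD addrA.
rewrite -/(w b).
have -> : (e + k') * (b - a) = (0 + (e + k') * (b - a)) * expR (0 * (b - a)).
  by rewrite mul0r expR0 mulr1 add0r.
have ek' : 0 <= e + k' by rewrite addr_ge0// ltW.
apply: (gronwall (B := (0 + (e + k') * (b - a)) * expR (0 * (b - a)))) => //; last by rewrite lexx ab.
- by rewrite /w subrr scale0r addr0 subrr normr0.
- move=> t tab e1 e10; have [d d0 H] := dw_cont (dD t tab) e10.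
  exists d => // s sab sd; apply: le_trans (ler_dist_dist _ _) _.
  by apply: H => //=; rewrite in_itv.
- move=> t /andP[at_ tb] _.
  have tab : a <= t <= b by rewrite at_ ltW.
  have [d d0 H] := dD t tab _ k'0.
  exists d => // s /andP[ts sd] sb.
  have sab : a <= s <= b by rewrite sb andbT (le_trans at_) ?ltW.
  have st0 : 0 < s - t by rewrite subr_gt0.
  have {H} := H s; rewrite /= in_itv /= sab gtr0_norm// => /(_ isT).
  have -> : s - t < d by lra.
  move=> /(_ isT); rewrite /w; set ds := u s - _; set dt := u t - _ => H.
  have -> : ds = dt + (s - t) *: (u' t - v) + (ds - dt - (s - t) *: (u' t - v)).
    by rewrite addrBBK.
  apply: (le_trans (ler_normD _ _)).
  have h1 := ler_normD dt ((s - t) *: (u' t - v)).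
  rewrite normrZ gtr0_norm// in h1.
  have h2 : (s - t) * `|u' t - v| <= (s - t) * e.
    by rewrite ler_pM2l//; exact: u'e.
  rewrite mul0r add0r mulrDr; lra.
Qed.

Lemma dw_lipschitz (a b M : R) (u u' : R -> V) :
  a <= b -> 0 <= M ->
  (forall t, a <= t <= b -> dw `[a, b] u t (u' t)) ->
  (forall t, a <= t <= b -> `|u' t| <= M) ->
  `|u b - u a| <= M * (b - a).
Proof.
move=> ab M0 du u'M; have := @dw_mean_value a b M u u' 0 ab M0 du.
by rewrite scaler0 subr0; apply => t tab; rewrite subr0; exact: u'M.
Qed.

End Dw.

Lemma dw_itv_shift {R : realType} {V : normedModType R} (I : set R) (u : R -> V)
    (k c t : R) v :
  0 < k -> dw I u (c + k * t) v ->
  dw [set s | I (c + k * s)] (fun s => u (c + k * s)) t (k *: v).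
Proof.
move=> k0 H e e0.
have ek0 : 0 < e / k by rewrite divr_gt0.
have [d d0 {}H] := H _ ek0.
exists (d / k); first by rewrite divr_gt0.
move=> s /= Is sd; rewrite scalerA.
have E : c + k * s - (c + k * t) = k * (s - t) by ring.
have := H _ Is; rewrite E normrM gtr0_norm// -ltr_pdivlMl// mulrC => /(_ sd).
by rewrite mulrA divfK ?gt_eqF// [k * (s - t)]mulrC.
Qed.

Section DerivWithin.
Context {R : realType} {n : nat}.

Lemma deriv_withinP (I : set R) (u : R -> 'rV[R]_n) t v :
  deriv_within I u t v <-> dw I u t v.
Proof.
rewrite /deriv_within; split.
- move=> /cvgrPdist_le H e e0.
  have := H e e0; rewrite near_withinE => /= -[d d0 Hd].
  exists d => // s Is sd.
  have [->|st] := eqVneq s t; first by rewrite !subrr scale0r subr0 !normr0 mulr0.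
  have := Hd s; rewrite /= distrC => /(_ sd (st)) /(_ Is).
  rewrite distrC => h.
  have st0 : s - t != 0 by rewrite subr_eq0.
  have -> : u s - u t - (s - t) *: v = (s - t) *: ((s - t)^-1 *: (u s - u t) - v).
    by rewrite scalerBr scalerA mulfV// scale1r.
  by rewrite normrZ mulrC ler_wpM2r.
- move=> H; apply/cvgrPdist_le => e e0; rewrite near_withinE.
  have [d d0 Hd] := H e e0.
  exists d => // s /=; rewrite distrC => sd st Is.
  have st0 : s - t != 0 by rewrite subr_eq0.
  have := Hd s Is sd.
  have -> : u s - u t - (s - t) *: v = (s - t) *: ((s - t)^-1 *: (u s - u t) - v).
    by rewrite scalerBr scalerA mulfV// scale1r.
  by rewrite normrZ mulrC ler_pM2r ?normr_gt0// distrC.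
Qed.

End DerivWithin.

(** Only [x] has to lie in [K]: continuity at the points of [K] controls all nearby [x'], so
    perturbed arguments may leave the compact set. *)
Lemma unif_on_compact {R : realType} {T U : pseudoMetricType R} (K : set T)
    (f : T -> U) :
  compact K -> (forall x, K x -> {for x, continuous f}) ->
  forall e : R, 0 < e -> exists2 d : R, 0 < d &
    forall x x', K x -> ball x d x' -> ball (f x) e (f x').
Proof.
move=> /compact_near_coveringP Kc fc e e0.
have := Kc R (0^'+) (fun d x => forall x', ball x d x' -> ball (f x) e (f x')).
have e20 : 0 < e / 2 by rewrite divr_gt0.
move=> /(_ _)[].
  move=> x Kx.
  have : nbhs (f x) (ball (f x) (e / 2)) by apply: nbhsx_ballx.
  move=> /(fc x Kx) /nbhs_ballP[r /= r0 Hr].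
  have r20 : 0 < r / 2 by rewrite divr_gt0.
  exists (ball x (r / 2), [set d : R | 0 < d < r / 2]).
    split; first exact: nbhsx_ballx.
    by near=> d => /=; apply/andP; split; near: d; [exact: nbhs_right_gt|exact: nbhs_right_lt].
  move=> [y d] [/= xy /andP[d0 dr]] x' yx'.
  have fxy : ball (f x) (e / 2) (f y).
    by apply: Hr; apply: le_ball xy; lra.
  have fxx' : ball (f x) (e / 2) (f x').
    apply: Hr; rewrite [r]splitr; apply: ball_triangle xy _.
    by apply: le_ball yx'; exact: ltW.
  by rewrite [e]splitr; apply: ball_triangle fxx'; exact: ball_sym.
move=> r /= r0 H; exists (r / 2); first by rewrite divr_gt0.
move=> x x' Kx; apply: H => //=; last by rewrite divr_gt0.
by rewrite sub0r normrN gtr0_norm ?divr_gt0//; lra.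
Unshelve. all: end_near. Qed.

Lemma ultra_fmap {T U : Type} (f : T -> U) (F : set_system T) :
  UltraFilter F -> UltraFilter (f @ F).
Proof.
move=> FU; split; first exact: fmap_proper_filter.
move=> H HF FH; apply/seteqP; split => // A HA.
have [//|FA] := in_ultra_setVsetC (f @^-1` A) FU.
have HA' : H (~` A) by exact: FH.
by have /filter_ex[x []] : H (A `&` ~` A) by exact: filterI.
Qed.

(** * Existence and continuation of solutions *)

Section FiniteDim.
Context {R : realType}.

Lemma compact_closed_ball0 k (r : R) : compact [set v : 'rV[R]_k | `|v| <= r].
Proof.
apply: bounded_closed_compact.
  exists r; split; first exact: num_real.
  by move=> x rx v /= vr; rewrite (le_trans vr)// ltW.
apply: (@closed_comp _ _ (fun v : 'rV[R]_k => `|v|) [set x | x <= r]).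
  by move=> x _; exact: norm_continuous.
exact: closed_le.
Qed.

End FiniteDim.

Section Peano.
Context {R : realType} {V : normedModType R}.
Hypothesis Vc : forall r : R, compact [set v : V | `|v| <= r].
Variables (F : R -> V -> V) (M : R).
Hypothesis Fc : continuous (fun q : R * V => F q.1 q.2).
Hypothesis FM : forall t v, `|F t v| <= M.

Let M0 : 0 <= M.
Proof. exact: le_trans (normr_ge0 _) (FM 0 0). Qed.

Section Euler.
Variables (a h : R) (p0 : V).
Hypothesis h0 : 0 < h.

Fixpoint euler_pt (k : nat) : V :=
  if k is k'.+1 then euler_pt k' + h *: F (a + k'%:R * h) (euler_pt k') else p0.

(** The Euler points as a step function, without interpolation: its jumps are at most [h M] and
    disappear in the limit. *)
Definition euler (t : R) : V := euler_pt (Num.truncn ((t - a) / h)).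

Lemma euler_pt_est i l (v : V) (e : R) :
  (forall k, (k < l)%N -> `|F (a + (i + k)%:R * h) (euler_pt (i + k)) - v| <= e) ->
  `|euler_pt (i + l) - euler_pt i - (l%:R * h) *: v| <= l%:R * h * e.
Proof.
elim: l => [|l IH] H; first by rewrite addn0 !mul0r scale0r subr0 subrr normr0.
rewrite addnS /= -natr1 !mulrDl mul1r scalerDl.
set Fl := F _ _.
have -> : euler_pt (i + l) + h *: Fl - euler_pt i - ((l%:R * h) *: v + h *: v) =
   (euler_pt (i + l) - euler_pt i - (l%:R * h) *: v) + h *: (Fl - v).
  by rewrite scalerBr [_ + h *: Fl - _]addrAC opprD addrACA.
apply: le_trans (ler_normD _ _) _; rewrite lerD//.
  by apply: IH => k kl; apply: H; exact: ltnW.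
by rewrite normrZ gtr0_norm//; apply: ler_wpM2l; [exact: ltW|exact: H].
Qed.

(** Between the mesh points below [s] and below [t] the increments simply add up; the elapsed time
    is off by at most [h], whence the terms [h e] and [h |v|]. The range of [c] begins at [s - h]
    because the cell of [s] may begin that early. *)
Lemma euler_est (s t e : R) (v : V) : a <= s -> s <= t -> 0 <= e ->
  (forall c, a <= c -> s - h <= c <= t -> `|F c (euler c) - v| <= e) ->
  `|euler t - euler s - (t - s) *: v| <= (t - s + h) * e + h * `|v|.
Proof.
move=> as_ st e0 H.
pose i := Num.truncn ((s - a) / h); pose j := Num.truncn ((t - a) / h).
have /andP[is_ si] : i%:R <= (s - a) / h < i.+1%:R.
  by apply: truncn_itv; apply: divr_ge0; [rewrite subr_ge0|exact: ltW].
have /andP[jt tj] : j%:R <= (t - a) / h < j.+1%:R.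
  by apply: truncn_itv; apply: divr_ge0; [rewrite subr_ge0; exact: le_trans st|exact: ltW].
rewrite ler_pdivlMr// in is_; rewrite ltr_pdivrMr// in si.
rewrite ler_pdivlMr// in jt; rewrite ltr_pdivrMr// in tj.
rewrite -natr1 mulrDl mul1r in si; rewrite -natr1 mulrDl mul1r in tj.
have ij : (i <= j)%N.
  by apply: le_truncn; rewrite ler_pM2r ?invr_gt0// lerD2r.
have := @euler_pt_est i (j - i) v e.
rewrite subnKC// natrB// => Hest.
have {}Hest : `|euler t - euler s - ((j%:R - i%:R) * h) *: v| <= (j%:R - i%:R) * h * e.
  apply: Hest => k kl.
  have kj : (i + k < j)%N by rewrite -ltn_subRL.
  have ci : i%:R * h <= (i + k)%:R * h by rewrite ler_pM2r// ler_nat leq_addr.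
  have cj : (i + k)%:R * h <= j%:R * h by rewrite ler_pM2r// ler_nat ltnW.
  set c := a + (i + k)%:R * h.
  have Ec : euler c = euler_pt (i + k).
    rewrite /euler /c [a + _]addrC addrK mulfK ?gt_eqF//.
    by rewrite natrK.
  have i0 : 0 <= i%:R * h by rewrite mulr_ge0// ltW.
  rewrite -Ec; apply: H; rewrite /c; first by lra.
  by apply/andP; split; lra.
have -> : euler t - euler s - (t - s) *: v =
  (euler t - euler s - ((j%:R - i%:R) * h) *: v) + ((j%:R - i%:R) * h - (t - s)) *: v.
  by rewrite [X in _ = _ + X]scalerBl subrKA.
apply: le_trans (ler_normD _ _) _; rewrite lerD//.
  by apply: le_trans Hest _; rewrite ler_wpM2r//; lra.
by rewrite normrZ ler_wpM2r// ler_norml; apply/andP; split; lra.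
Qed.

Lemma euler_lip (s t : R) : a <= s -> s <= t -> `|euler t - euler s| <= M * (t - s + h).
Proof.
move=> as_ st; have := @euler_est s t M 0 as_ st M0.
rewrite scaler0 subr0 normr0 mulr0 addr0 mulrC; apply => c _ _.
by rewrite subr0.
Qed.

Lemma euler_start : euler a = p0.
Proof. by rewrite /euler subrr mul0r truncn0. Qed.

End Euler.

(** The Euler functions are bounded, so they converge pointwise along one ultrafilter for all times
    simultaneously. The increment estimate at a fixed pair of times is uniform in the mesh and
    passes to the limit, where it is the derivative itself; no uniform convergence is involved. *)
Lemma peano (a b : R) (p0 : V) : a <= b ->
  exists u : R -> V, u a = p0 /\
    forall t, a <= t <= b -> dw `[a, b] u t (F t (u t)).
Proof.
move=> ab.
have [U [UU Uoo]] := ultraFilterLemma (eventually_filter : ProperFilter \oo).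
pose h (j : nat) : R := j.+1%:R^-1.
have h0 j : 0 < h j by rewrite invr_gt0.
have hcvg : h @ U --> (0 : R).
  by apply: cvg_trans (@cvg_harmonic R); exact: cvg_app.
pose w j := euler a (h j) p0.
pose r := `|p0| + M * (b - a + 1).
have wr j t : a <= t <= b -> `|w j t| <= r.
  move=> /andP[at_ tb]; have := euler_lip p0 (h0 j) (lexx a) at_.
  rewrite euler_start => H.
  rewrite -(subrK p0 (w j t)) addrC (le_trans (ler_normD _ _))// lerD2l.
  apply: le_trans H _; rewrite ler_wpM2l// lerD//; first by rewrite lerD2r.
  by rewrite /h invf_le1// ler1n.
have lim t : exists v : V, a <= t <= b -> (w ^~ t) @ U --> v.
  have [tab|ntab] := boolP (a <= t <= b); last by exists 0.
  have := @Vc r; rewrite compact_ultra => /(_ _ (ultra_fmap (w ^~ t) UU))[|v [_ Hv]].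
    suff : U [set j | `|w j t| <= r] by [].
    by apply: filterE => j; exact: wr.
  by exists v.
have [u Hu] := choice lim.
exists u; split.
  have uaE : (w ^~ a) @ U --> u a by apply: Hu; rewrite lexx.
  have pE : (w ^~ a) @ U --> p0.
    rewrite (_ : w ^~ a = fun=> p0); first exact: cvg_cst.
    by apply/funext => j; rewrite /w euler_start.
  exact: (cvg_unique (@norm_hausdorff _ _) uaE pE).
have Kc : compact (`[a, b] `*` [set v : V | `|v| <= r]).
  by apply: compact_setX; [exact: segment_compact|exact: Vc].
move=> t0 t0ab e e0; have e20 : 0 < e / 2 by rewrite divr_gt0.
have [d d0 Hd] := unif_on_compact Kc (fun q _ => @Fc q) e20.
(* Up to [3 d'] of time separates the points compared, hence up to [3 M d'] of displacement; both
   stay below [d]. *)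
pose d' := d / (4 * (M + 1)).
have M10 : 0 < M + 1 by rewrite ltr_wpDl.
have d'0 : 0 < d' by rewrite divr_gt0// mulr_gt0.
have dE : d = 4 * (M * d' + d') by rewrite /d'; field; rewrite gt_eqF.
have Md' : 0 <= M * d' by rewrite mulr_ge0// ltW.
exists d' => // s; rewrite /= in_itv /= => sab sd.
have est j : h j < d' ->
    `|w j s - w j t0 - (s - t0) *: F t0 (w j t0)| <= (`|s - t0| + h j) * (e / 2) + h j * M.
  move=> hd.
  have near c : a <= c -> Num.min s t0 - h j <= c <= Num.max s t0 ->
      `|F c (w j c) - F t0 (w j t0)| <= e / 2.
    move=> ac /andP[c1 c2]; rewrite distrC.
    have cd : `|c - t0| <= `|s - t0| + h j.
      have := h0 j; move: c1 c2; case: (leP s t0) => st; move=> c1 c2 hj.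
        rewrite [`|s - t0|]ler0_norm ?subr_le0// ler_norml.
        by apply/andP; split; lra.
      rewrite [`|s - t0|]gtr0_norm ?subr_gt0// ler_norml.
      by apply/andP; split; lra.
    have wc : `|w j c - w j t0| <= M * (`|c - t0| + h j).
      have /andP[at0 _] := t0ab.
      have [ct|tc] := leP c t0.
        rewrite distrC ler0_norm ?subr_le0// opprB; exact: euler_lip.
      rewrite gtr0_norm ?subr_gt0//; apply: euler_lip => //; exact: ltW.
    have : ball (F t0 (w j t0)) (e / 2) (F c (w j c)).
      apply: (Hd (t0, w j t0) (c, w j c)).
        by split => /=; [rewrite in_itv|exact: wr].
      have hj := h0 j.
      have cd2 : `|c - t0| + h j <= 3 * d' by lra.
      split => /=; rewrite -ball_normE /= distrC; first by lra.
      apply: le_lt_trans wc _; apply: (@le_lt_trans _ _ (M * (3 * d'))).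
        by rewrite ler_wpM2l.
      by lra.
    by rewrite -ball_normE /= => /ltW.
  have /andP[at0 t0b] := t0ab; have /andP[as_ sb] := sab.
  have e2 : 0 <= e / 2 by exact: ltW.
  have hM : h j * `|F t0 (w j t0)| <= h j * M by rewrite ler_pM2l.
  have [st|ts] := leP s t0.
    have := @euler_est a (h j) p0 (h0 j) s t0 (e / 2) (F t0 (w j t0)) as_ st e2.
    move=> /(_ _)/wrap[].
      move=> c ac cc; apply: near => //; by rewrite (min_idPl st) (max_idPr st).
    rewrite -/(w j) => H.
    have -> : w j s - w j t0 - (s - t0) *: F t0 (w j t0) =
      - (w j t0 - w j s - (t0 - s) *: F t0 (w j t0)).
      by rewrite opprB -(opprB t0 s) scaleNr opprK -[in LHS](opprB (w j t0)) addrC.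
    rewrite normrN ler0_norm ?subr_le0// opprB; lra.
  have := @euler_est a (h j) p0 (h0 j) t0 s (e / 2) (F t0 (w j t0)) at0 (ltW ts) e2.
  move=> /(_ _)/wrap[].
    move=> c ac cc; apply: near => //; by rewrite (min_idPr (ltW ts)) (max_idPl (ltW ts)).
  rewrite -/(w j) gtr0_norm ?subr_gt0// => H; lra.
have us := Hu s sab; have ut := Hu t0 t0ab.
have Fu : (fun j => F t0 (w j t0)) @ U --> F t0 (u t0).
  have h1 : (fun j => (t0, w j t0)) @ U --> (t0, u t0).
    by apply: (@cvg_pair _ _ _ _ (nbhs t0) (nbhs (u t0))) => //; exact: cvg_cst.
  exact: (cvg_comp _ _ h1 (@Fc (t0, u t0))).
have L1 : (fun j => `|w j s - w j t0 - (s - t0) *: F t0 (w j t0)|) @ U -->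
    `|u s - u t0 - (s - t0) *: F t0 (u t0)|.
  apply: cvg_norm; apply: cvgB; first exact: cvgB.
  by apply: cvgZ => //; exact: cvg_cst.
have L2 : (fun j => (`|s - t0| + h j) * (e / 2) + h j * M) @ U -->
    (`|s - t0| + 0) * (e / 2) + 0 * M.
  apply: cvgD; apply: cvgMl => //.
  by apply: cvgD => //; exact: cvg_cst.
have : `|u s - u t0 - (s - t0) *: F t0 (u t0)| <= (`|s - t0| + 0) * (e / 2) + 0 * M.
  apply: (ler_cvg_to L1 L2).
  have Hh : \forall j \near U, h j < d'.
    move/cvgrPdist_lt : hcvg => /(_ _ d'0); apply: filterS => j.
    by rewrite sub0r normrN gtr0_norm.
  by apply: filterS Hh => j; exact: est.
have := normr_ge0 (s - t0) => n0.
rewrite addr0 mul0r addr0 => /le_trans; apply.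
by rewrite mulrC ler_wpM2r//; lra.
Qed.

End Peano.

Section Extension.
Context {R : realType} {V : normedModType R}.
Hypothesis Vc : forall r : R, compact [set v : V | `|v| <= r].
Variables (F : R -> V -> V) (M : R).
Hypothesis Fc : continuous (fun q : R * V => F q.1 q.2).
Hypothesis FM : forall t v, `|F t v| <= M.

Let M0 : 0 <= M.
Proof. exact: le_trans (normr_ge0 _) (FM 0 0). Qed.

Lemma dw_local (I J : set R) (u w : R -> V) (t : R) (v : V) (d : R) : 0 < d ->
  I t -> (forall s, J s -> `|s - t| < d -> I s /\ w s = u s) -> w t = u t ->
  dw I u t v -> dw J w t v.
Proof.
move=> d0 It H wt du e e0; have [d' d'0 {}du] := du e e0.
exists (Num.min d d'); first by rewrite lt_min d0.
move=> s Js; rewrite lt_min => /andP[sd sd'].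
by have [Is ->] := H s Js sd; rewrite wt; exact: du.
Qed.

Lemma dw_glue (a c b : R) (u1 u2 : R -> V) (t : R) (v : R -> V) :
  a <= c -> c <= b -> u1 c = u2 c ->
  (forall s, a <= s <= c -> dw `[a, c] u1 s (v s)) ->
  (forall s, c <= s <= b -> dw `[c, b] u2 s (v s)) ->
  a <= t <= b -> dw `[a, b] (fun s => if s <= c then u1 s else u2 s) t (v t).
Proof.
move=> ac cb ucE d1 d2 /andP[at_ tb].
have [tc|ct|tc] := ltgtP t c.
- have ct0 : 0 < c - t by rewrite subr_gt0.
  apply: (dw_local ct0 _ _ _ (d1 t _)); rewrite /= ?in_itv/= ?at_ ?(ltW tc)//.
  move=> s; rewrite !in_itv/= => /andP[-> sb] sd.
  have sc : s <= c by have := ler_norm (s - t); lra.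
  by rewrite sc.
- have ct0 : 0 < t - c by rewrite subr_gt0.
  apply: (dw_local ct0 _ _ _ (d2 t _)); rewrite /= ?in_itv/= ?tb ?(ltW ct)//.
  + move=> s; rewrite !in_itv/= => /andP[as_ ->] sd.
    have sc : c < s by have := ler_norm (t - s); rewrite distrC; lra.
    by rewrite (ltW sc) leNgt sc.
  + by rewrite leNgt ct.
- subst t => e e0.
  have [|e1 e10 H1] := d1 c _ e e0; first by rewrite ac lexx.
  have [|e2 e20 H2] := d2 c _ e e0; first by rewrite cb lexx.
  exists (Num.min e1 e2); first by rewrite lt_min e10.
  move=> s; rewrite /= in_itv/= lt_min lexx => /andP[as_ sb] /andP[s1 s2].
  have [sc|cs] := leP s c; first by apply: H1 => //=; rewrite in_itv/= as_.
  by rewrite ucE; apply: H2 => //=; rewrite in_itv/= sb ltW.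
Qed.

(** A bounded field makes [u] Lipschitz with constant [M], so it has a limit [l] at [b]. Near [b]
    the field is close to [F b l], and the mean value inequality on [[s, r]] with [r] close to [b]
    gives the left derivative at [b]. *)
Lemma left_extend (a b : R) (u : R -> V) : a < b ->
  (forall t, a <= t < b -> dw `[a, b[ u t (F t (u t))) ->
  exists u' : R -> V, (forall t, t < b -> u' t = u t) /\
    forall t, a <= t <= b -> dw `[a, b] u' t (F t (u' t)).
Proof.
move=> ab du.
have sub s r : a <= s -> r < b -> `[s, r] `<=` `[a, b[.
  move=> as_ rb z /=; rewrite !in_itv/= => /andP[sz zr].
  by rewrite (le_trans as_)// (le_lt_trans zr).
have ulip s r : a <= s -> s <= r -> r < b -> `|u r - u s| <= M * (r - s).
  move=> as_ sr rb; apply: (@dw_lipschitz _ _ s r M u (fun t => F t (u t))) => // t /andP[st tr].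
  apply: dwS (sub s r as_ rb) _; apply: du.
  by rewrite (le_trans as_)//= (le_lt_trans tr).
have [G [GU GF]] := ultraFilterLemma (at_left_proper_filter b).
have Gab (c : R) : c < b -> G [set t | c < t < b].
  by move=> cb; apply: GF; near=> t; apply/andP; split; near: t;
    [exact: nbhs_left_gt|exact: nbhs_left_lt].
pose r0 := `|u a| + M * (b - a).
have ur t : a <= t < b -> `|u t| <= r0.
  move=> /andP[at_ tb]; rewrite -(subrK (u a) (u t)) addrC.
  rewrite (le_trans (ler_normD _ _))// lerD2l (le_trans (ulip a t _ _ _))//.
  by rewrite ler_wpM2l// lerD2r ltW.
have [l Gl] : exists l : V, u @ G --> l.
  have := @Vc r0; rewrite compact_ultra => /(_ _ (ultra_fmap u GU))[|l [_ Hl]].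
    suff : G [set t | `|u t| <= r0] by [].
    by apply: filterS (Gab a ab) => t /andP[t1 t2]; apply: ur; rewrite t2 ltW.
  by exists l.
have ul t : a <= t < b -> `|l - u t| <= M * (b - t).
  move=> /andP[at_ tb].
  have h1 : (fun s => `|u s - u t|) @ G --> `|l - u t|.
    by apply: cvg_norm; apply: cvgB => //; exact: cvg_cst.
  apply: (closed_cvg (fun x : R => x <= M * (b - t)) (@closed_le R _) _ _ h1).
  apply: filterS (Gab t tb) => s /andP[ts sb] /=.
  apply: le_trans (ulip t s at_ (ltW ts) sb) _.
  by rewrite ler_wpM2l// lerD2r ltW.
exists (fun t => if t < b then u t else l); split => [t ->//|t /andP[at_ tb]].
have [tb'|bt] := ltP t b.
  have bt0 : 0 < b - t by rewrite subr_gt0.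
  apply: (dw_local bt0 _ _ _ (du t _)); rewrite /= ?in_itv/= ?at_ ?tb'//.
  move=> s; rewrite !in_itv/= => /andP[-> _] sd.
  have -> // : s < b by have := ler_norm (s - t); lra.
have {bt tb}-> : t = b by apply/eqP; rewrite eq_le tb bt.
move=> e e0.
have Nb : \forall q \near (b, l), `|F b l - F q.1 q.2| <= e.
  by have /cvgrPdist_le := @Fc (b, l); exact.
move: Nb => /nbhs_ballP[d /= d0 Nb].
have M10 : 0 < M + 1 by rewrite ltr_wpDl.
exists (d / (M + 1)); first by rewrite divr_gt0.
move=> s; rewrite /= in_itv/= ltxx => /andP[as_ sb].
move: sb; rewrite le_eqVlt => /predU1P[->|sb].
  by move=> _; rewrite ltxx !subrr scale0r subrr !normr0 mulr0.
rewrite sb ler0_norm ?subr_le0 ?(ltW sb)// opprB ltr_pdivlMr// => sd.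
have bs0 : 0 < b - s by rewrite subr_gt0.
have near c : s <= c < b -> `|F c (u c) - F b l| <= e.
  move=> /andP[sc cb]; rewrite distrC.
  have Mc : M * (b - c) <= M * (b - s) by rewrite ler_wpM2l//; lra.
  have bcs : (b - s) * M + (b - s) < d by move: sd; rewrite mulrDr mulr1.
  have Ms0 : 0 <= (b - s) * M by rewrite mulr_ge0// ltW.
  apply: (Nb (c, u c)); split => /=; rewrite -ball_normE /=.
    by rewrite gtr0_norm ?subr_gt0//; lra.
  by apply: le_lt_trans (ul c _) _; [rewrite cb (le_trans as_)|lra].
set v := F b l in near *.
have -> : u s - l - (s - b) *: v = - (l - u s - (b - s) *: v).
  by rewrite opprB -(opprB s b) scaleNr -[in LHS](opprB l) addrC.
rewrite normrN; apply/ler_addgt0Pr => k k0.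
have Mv : 0 < M + `|v| + 1 by rewrite ltr_wpDl// addr_ge0.
(* So close to [b] that the stretch from [r] to [b], where [u] and the line of slope [v] move by at
   most [(b - r) (M + |v|)], costs no more than [k]. *)
pose r := Num.max s (b - k / (M + `|v| + 1)).
have kM : 0 < k / (M + `|v| + 1) by rewrite divr_gt0.
have rb : r < b by rewrite gt_max sb/=; lra.
have sr : s <= r by rewrite le_max lexx.
have brk : (b - r) * (M + `|v|) <= k.
  have br0 : 0 < b - r by rewrite subr_gt0.
  have : b - r <= k / (M + `|v| + 1).
    have : b - k / (M + `|v| + 1) <= r by rewrite le_max lexx orbT.
    lra.
  rewrite ler_pdivlMr// mulrDr mulr1; lra.
have mv : `|u r - u s - (r - s) *: v| <= e * (r - s).
  apply: (@dw_mean_value _ _ s r e u (fun t => F t (u t)) v) => //; first exact: ltW.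
    move=> z /andP[sz zr]; apply: dwS (sub s r as_ rb) _; apply: du.
    by rewrite (le_trans as_)//= (le_lt_trans zr).
  by move=> z /andP[sz zr]; apply: near; rewrite sz (le_lt_trans zr).
have -> : l - u s - (b - s) *: v = (l - u r) + (u r - u s - (r - s) *: v) + (r - b) *: v.
  have -> : (b - s) *: v = (r - s) *: v - (r - b) *: v.
    by rewrite -scalerBl; congr (_ *: _); ring.
  by rewrite opprB [X in _ = X + _]addrA subrKA [in LHS](addrC ((r - b) *: v)) addrA.
apply: le_trans (ler_normD _ _) _.
have h1 := ler_normD (l - u r) (u r - u s - (r - s) *: v).
have h2 : `|l - u r| <= M * (b - r) by apply: ul; rewrite rb (le_trans as_).
have h3 : `|(r - b) *: v| = (b - r) * `|v|.
  by rewrite normrZ ltr0_norm ?subr_lt0// opprB.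
have h4 : e * (r - s) <= e * (b - s) by rewrite ler_pM2l// lerD2r ltW.
rewrite h3; lra.
Unshelve. all: end_near. Qed.

(** If [J] stops before [t0], its supremum is adjoined by [left_extend] when missing, and a Peano
    solution from there is glued on. *)
Lemma ode_extend (J : set R) (u : R -> V) (t0 : R) :
  is_interval J -> J 0 -> J `<=` `[0, +oo[ -> 0 <= t0 ->
  (forall t, J t -> t <= t0 -> dw J u t (F t (u t))) ->
  exists u' : R -> V, (forall t, J t -> t <= t0 -> u' t = u t) /\
    forall t, 0 <= t <= t0 -> dw `[0, t0] u' t (F t (u' t)).
Proof.
move=> Ji J0 Jpos t00 du.
have Jge t : J t -> 0 <= t by move=> /Jpos /=; rewrite in_itv/= andbT.
have [Jt0|nJt0] := pselect (J t0).
  have sub t : 0 <= t <= t0 -> J t by move=> /andP[h1 h2]; apply: (Ji 0 t0) => //; rewrite h1 h2.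
  exists u; split => // t tt0.
  have [? tle] := andP tt0; apply: dwS (du t (sub t tt0) tle) => s /=.
  by rewrite in_itv/=; exact: sub.
have Jlt t : J t -> t < t0.
  move=> Jt; rewrite ltNge; apply/negP => t0t; apply: nJt0.
  by apply: (Ji 0 t) => //; rewrite t00 t0t.
have hS : has_sup J by split; [exists 0|exists t0 => t /Jlt/ltW].
pose s := sup J.
have s0 : 0 <= s by apply: ub_le_sup => //; exact: hS.2.
have st0 : s <= t0 by apply: ge_sup; [exists 0|move=> t /Jlt/ltW].
have Jsub t : 0 <= t < s -> J t.
  move=> /andP[h1 h2]; have h3 : 0 < s - t by rewrite subr_gt0.
  have [r Jr] := sup_adherent h3 hS; rewrite -/s subKr => tr.
  by apply: (Ji 0 r) => //; rewrite h1 ltW.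
have Jle t : J t -> t <= s by move=> Jt; apply: ub_le_sup => //; exact: hS.2.
have [u1 [u1E du1]] : exists u1 : R -> V, (forall t, J t -> u1 t = u t) /\
    forall t, 0 <= t <= s -> dw `[0, s] u1 t (F t (u1 t)).
  have [Js|nJs] := pselect (J s).
    have sub t : 0 <= t <= s -> J t.
      by move=> /andP[h1 h2]; apply: (Ji 0 s) => //; rewrite h1 h2.
    exists u; split => // t ts; have Jt := sub t ts.
    apply: dwS (du t Jt (ltW (Jlt t Jt))) => r /=.
    by rewrite in_itv/=; exact: sub.
  have s0' : 0 < s.
    by rewrite lt_neqAle s0 andbT; apply/eqP => s0E; apply: nJs; rewrite -s0E.
  have [|u1 [u1E du1]] := @left_extend 0 s u s0'.
    move=> t ts; have Jt := Jsub t ts.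
    apply: dwS (du t Jt (ltW (Jlt t Jt))) => r /=.
    by rewrite in_itv/=; exact: Jsub.
  exists u1; split => // t Jt; apply: u1E; rewrite lt_neqAle Jle// andbT.
  by apply/eqP => ts; apply: nJs; rewrite -ts.
have [u2 [u2s du2]] := peano Vc Fc FM (u1 s) st0.
exists (fun t => if t <= s then u1 t else u2 t); split.
  by move=> t Jt _; rewrite Jle// u1E.
move=> t tt0.
have dg := @dw_glue 0 s t0 u1 u2 t (fun t => F t (if t <= s then u1 t else u2 t)) s0 st0 (esym u2s).
apply: dg => // r /andP[h1 h2]; first by rewrite h2; apply: du1; rewrite h1.
have [rs|_] := leP r s; last by apply: du2; rewrite h1.
have -> : r = s by apply/eqP; rewrite eq_le rs h1.
by rewrite -u2s; apply: du2; rewrite lexx.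
Qed.

End Extension.

Section Retraction.
Context {R : realType} {k : nat}.

(** For [r > 0], the radial retraction onto the closed ball of radius [r]. Composing a field with it
    gives a bounded field with the same values on the ball. *)
Definition retract (r : R) (v : 'rV[R]_k) : 'rV[R]_k := (r / Num.max r `|v|) *: v.

Lemma retract_id r v : 0 < r -> `|v| <= r -> retract r v = v.
Proof. by move=> r0 vr; rewrite /retract (max_idPl vr) mulfV ?gt_eqF// scale1r. Qed.

Lemma retract_norm r v : 0 < r -> `|retract r v| <= r /\ `|retract r v| <= `|v|.
Proof.
move=> r0; have m0 : 0 < Num.max r `|v| by rewrite lt_max r0.
rewrite /retract normrZ ger0_norm; last by rewrite divr_ge0// ltW.
split.
  by rewrite mulrAC ler_pdivrMr// ler_pM2l// le_max lexx orbT.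
by rewrite ler_piMl// ler_pdivrMr// mul1r le_max lexx.
Qed.

Lemma retract_continuous r : 0 < r -> continuous (retract r).
Proof.
move=> r0 v.
have h1 : (fun w : 'rV[R]_k => Num.max r `|w|) @ v --> Num.max r `|v|.
  exact: (@continuous_max _ _ (fun=> r) (fun w : 'rV[R]_k => `|w|) v (@cst_continuous _ _ r v) (@norm_continuous _ _ v)).
have n0 : Num.max r `|v| != 0 by rewrite gt_eqF// lt_max r0.
have h2 : (fun w : 'rV[R]_k => r / Num.max r `|w|) @ v --> r / Num.max r `|v|.
  apply: (@cvgM _ _ (nbhs v) _ (fun=> r) (fun w => (Num.max r `|w|)^-1)).
    exact: cvg_cst.
  exact: (cvgV n0 h1).
exact: (cvgZ h2 cvg_id).
Qed.

End Retraction.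

Section DwMore.
Context {R : realType} {V : normedModType R}.

Lemma dw_shift (I : set R) (u : R -> V) (c t : R) v :
  dw I u (c + t) v -> dw [set s | I (c + s)] (fun s => u (c + s)) t v.
Proof.
move=> H e e0; have [d d0 {}H] := H e e0; exists d => // s /= Is sd.
have E : c + s - (c + t) = s - t by rewrite opprD addrACA subrr add0r.
by have := H _ Is; rewrite E; apply.
Qed.

Lemma dw_bounded (a b : R) (u u' : R -> V) :
  (forall t, a <= t <= b -> dw `[a, b] u t (u' t)) ->
  exists M : R, forall t, a <= t <= b -> `|u t| <= M.
Proof.
move=> du; have [ba|ab] := ltP b a.
  by exists 0 => t /andP[at_ tb]; move: (le_trans at_ tb); rewrite leNgt ba.
have loc t : a <= t <= b -> exists2 d : R, 0 < d &
    forall s, a <= s <= b -> `|s - t| < d -> `|u s| <= `|u t| + 1.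
  move=> tab; have [d d0 H] := dw_cont (du t tab) ltr01.
  exists d => // s sab sd; rewrite -(subrK (u t) (u s)) addrC.
  by rewrite (le_trans (ler_normD _ _))// lerD2l; apply: H => //=; rewrite in_itv.
suff : exists M : R, forall s, a <= s <= b -> `|u s| <= M by [].
apply: (@real_induction R a b (fun t => exists M : R, forall s, a <= s <= t -> `|u s| <= M) _ _ b);
  last by rewrite lexx ab.
- move=> t tab IH; have [d d0 H] := loc t tab.
  have /andP[at_ tb] := tab.
  have [tda|atd] := ltP (t - d / 2) a.
    exists (`|u t| + 1) => s /andP[as_ st]; apply: H; first by rewrite as_ (le_trans st).
    by rewrite ler0_norm ?subr_le0//; lra.
  have [|M HM] := IH (t - d / 2); first by rewrite atd/=; lra.
  exists (Num.max M (`|u t| + 1)) => s /andP[as_ st]; rewrite le_max.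
  have [sd|ds] := leP s (t - d / 2); first by rewrite HM// as_.
  rewrite H ?orbT// ?as_ ?(le_trans st)//.
  by rewrite ler0_norm ?subr_le0//; lra.
- move=> t /andP[at_ tb] IH.
  have tab : a <= t <= b by rewrite at_ ltW.
  have [d d0 H] := loc t tab.
  have [|M HM] := IH t; first by rewrite at_ lexx.
  exists d => // s /andP[ts sd] sb.
  exists (Num.max M (`|u t| + 1)) => r /andP[ar rs]; rewrite le_max.
  have [rt|tr] := leP r t; first by rewrite HM// ar.
  rewrite H ?orbT// ?ar ?(le_trans rs)//.
  by rewrite gtr0_norm ?subr_gt0//; lra.
Qed.

End DwMore.

(** * Fast systems over a compact base *)

(* Ultimate boundedness is only asked along the orbit of [base0], which is where
   the hypothesis on [g] gives it; density carries it to the whole base. *)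
Record fast_system {R : realType} {n m : nat} := FastSystem {
  base : pseudoPMetricType R;
  flow : R -> base -> base;
  vf : base -> 'rV[R]_n -> 'rV[R]_m -> 'rV[R]_m;
  sol : base -> 'rV[R]_n -> 'rV[R]_m -> R -> 'rV[R]_m;
  base0 : base;
  base_compact : compact [set: base];
  base_hausdorff : hausdorff_space base;
  flow0 : forall p, flow 0 p = p;
  flowD : forall s t p, flow (s + t) p = flow s (flow t p);
  flow_cont : continuous (fun q : R * base => flow q.1 q.2);
  vf_cont : continuous (fun q : base * 'rV[R]_n * 'rV[R]_m => vf q.1.1 q.1.2 q.2);
  vf_lip : forall r : R, exists2 L : R, 0 <= L & forall p x y1 y2,
    `|x| <= r -> `|y1| <= r -> `|y2| <= r ->
    `|vf p x y1 - vf p x y2| <= L * `|y1 - y2|;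
  sol0 : forall p x y, sol p x y 0 = y;
  solP : forall p x y t, 0 <= t -> dw `[0, +oo[ (sol p x y) t (vf (flow t p) x (sol p x y t));
  base_dense : forall p (e : R), 0 < e -> exists s, ball p e (flow s base0);
  sol_ub0 : forall r : R, exists2 c : R, 0 < c & forall rho : R, exists2 T : R, 0 <= T &
    forall s x y t, `|x| <= r -> `|y| <= rho -> T <= t -> `|sol (flow s base0) x y t| <= c
}.
Arguments fast_system : clear implicits.
Arguments base {R n m} _.

Section FastSystem.
Context {R : realType} {n m : nat} (S : fast_system R n m).
Notation X := 'rV[R]_n.
Notation Y := 'rV[R]_m.
Notation P := (base S).
Implicit Types (p : P) (x : X) (y : Y).

Lemma flow_unif (T e : R) : 0 < e -> exists2 d : R, 0 < d &
  forall t p p', `|t| <= T -> ball p d p' -> ball (flow t p) e (flow t p').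
Proof.
move=> e0.
have Kc : compact (`[- T, T] `*` [set: P]).
  by apply: compact_setX; [exact: segment_compact|exact: base_compact].
have [d d0 H] := unif_on_compact Kc (fun z _ => @flow_cont _ _ _ S z) e0.
exists d => // t p p' tT pp'.
apply: (H (t, p) (t, p')); last by split => //; exact: ballxx.
by split => //=; rewrite in_itv /= -ler_norml.
Qed.

Lemma flow_small (e : R) : 0 < e -> exists2 d : R, 0 < d &
  forall t p, `|t| < d -> ball p e (flow t p).
Proof.
move=> e0.
have Kc : compact ([set (0 : R)] `*` [set: P]).
  by apply: compact_setX; [exact: compact_set1|exact: base_compact].
have [d d0 H] := unif_on_compact Kc (fun z _ => @flow_cont _ _ _ S z) e0.
exists d => // t p td.
have {}H := H (0, p) (t, p); rewrite /= flow0 in H; apply: H => //.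
by split => /=; [rewrite -ball_normE /= sub0r normrN|exact: ballxx].
Qed.

Lemma vf_unif (r e : R) : 0 < e -> exists2 d : R, 0 < d &
  forall p p' x x' y, `|x| <= r -> `|y| <= r -> ball p d p' -> `|x - x'| < d ->
  `|vf p x y - vf p' x' y| < e.
Proof.
move=> e0.
have Kc : compact ([set: P] `*` [set x : X | `|x| <= r] `*` [set y : Y | `|y| <= r]).
  by do 2 (apply: compact_setX; last exact: compact_closed_ball0); exact: base_compact.
have [d d0 H] := unif_on_compact Kc (fun z _ => @vf_cont _ _ _ S z) e0.
exists d => // p p' x x' y xr yr pp' xx'.
have := H (p, x, y) (p', x', y); rewrite -ball_normE /=; apply => //.
split => /=; last exact: ballxx.
by split => //=; rewrite -ball_normE.
Qed.

(** Continuous dependence, uniform over the compact base. Only the reference solution [u] is assumed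
    bounded: Gronwall is run while [|v - u| <= B <= 1], where [v] is in the ball of radius [r + 1]
    that supplies the Lipschitz constant. The slow argument [Xf] of [v] may vary with time. *)
Lemma perturb (r T eta : R) : 0 <= T -> 0 < eta -> exists2 e1 : R, 0 < e1 &
  forall p p' xb (u v : R -> Y) (Xf : R -> X) (s : R),
  0 <= s <= T -> `|xb| <= r ->
  (forall t, 0 <= t <= s -> dw `[0, s] u t (vf (flow t p) xb (u t))) ->
  (forall t, 0 <= t <= s -> `|u t| <= r) ->
  (forall t, 0 <= t <= s -> dw `[0, s] v t (vf (flow t p') (Xf t) (v t))) ->
  ball p e1 p' ->
  (forall t, 0 <= t <= s -> `|xb - Xf t| <= e1) ->
  `|v 0 - u 0| <= e1 ->
  forall t, 0 <= t <= s -> `|v t - u t| <= eta.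
Proof.
move=> T0 eta0.
pose B := Num.min eta 1; have B0 : 0 < B by rewrite lt_min eta0 ltr01.
have [L L0 HL] := vf_lip S (r + 1).
pose E := expR (L * T); have E0 : 0 < E by exact: expR_gt0.
(* Solves [(w0 + w0 T) E = B]: initial error and forcing are both [w0], the latter ensured by a
   field error below [w0 / 2]. *)
pose w0 := B / ((1 + T) * E).
have T10 : 0 < 1 + T by rewrite ltr_wpDr.
have w00 : 0 < w0 by rewrite divr_gt0// mulr_gt0.
have w0ge := ltW w00; have w020 : 0 < w0 / 2 by rewrite divr_gt0.
have [d d0 Hd] := vf_unif (r + 1) w020.
have [d' d'0 Hd'] := flow_unif T d0.
exists (Num.min (Num.min d' (d / 2)) w0); first by rewrite !lt_min d'0 divr_gt0.
move=> p p' xb u v Xf s /andP[s0 sT] xbr du ur dv.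
set e1 := Num.min _ _ => pp' xX vu0 t ts.
have e1d' : e1 <= d' by rewrite !ge_min lexx.
have e1d : e1 < d by rewrite !gt_min; apply/orP; left; apply/orP; right; lra.
have e1w : e1 <= w0 by rewrite ge_min lexx orbT.
have HB : (w0 + w0 * (s - 0)) * expR (L * (s - 0)) <= B.
  rewrite subr0; apply: (@le_trans _ _ (w0 * (1 + T) * E)).
    rewrite ler_pM ?expR_ge0//.
    - by apply: addr_ge0 => //; exact: mulr_ge0.
    - by rewrite mulrDr mulr1 lerD2l ler_wpM2l// ltW.
    - by rewrite ler_expR ler_wpM2l.
  by rewrite /w0 -mulrA divfK// gt_eqF// mulr_gt0.
have := @dw_gronwall R Y 0 s L w0 w0 B (fun t => v t - u t)
  (fun t => vf (flow t p') (Xf t) (v t) - vf (flow t p) xb (u t)) L0 w00 (ltW w00).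
rewrite (le_trans vu0)// => /(_ isT HB) H.
apply: (@le_trans _ _ B); last by rewrite ge_min lexx.
apply: (@le_trans _ _ ((w0 + w0 * (t - 0)) * expR (L * (t - 0)))).
  apply: H => // {ts}t ts; first by apply: dwB; [exact: dv|exact: du].
  move=> vuB.
  have vu1 : `|v t - u t| <= 1 by rewrite (le_trans vuB)// ge_min lexx orbT.
  have utr := ur t ts.
  have vr1 : `|v t| <= r + 1.
    by rewrite -(subrK (u t) (v t)) addrC (le_trans (ler_normD _ _))// lerD.
  rewrite -(subrKA (vf (flow t p) xb (v t))) addrC (le_trans (ler_normD _ _))// lerD//.
    by apply: HL => //; rewrite ler_wpDr.
  rewrite distrC ltW//; apply: Hd => //; first by rewrite ler_wpDr.
    apply: Hd'; last exact: le_ball pp'.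
    by have /andP[t0 ts'] := ts; rewrite ger0_norm// (le_trans ts').
  exact: le_lt_trans (xX t ts) e1d.
apply: le_trans HB; have /andP[t0 ts'] := ts.
rewrite !subr0 ler_pM ?expR_ge0//.
- by apply: addr_ge0 => //; exact: mulr_ge0.
- by rewrite lerD2l ler_wpM2l// ltW.
- by rewrite ler_expR ler_wpM2l.
Qed.

Lemma sol_dw p x y (s t : R) : 0 <= t <= s ->
  dw `[0, s] (sol p x y) t (vf (flow t p) x (sol p x y t)).
Proof.
move=> /andP[t0 _]; apply: dwS (solP p x y t0) => r /=.
by rewrite !in_itv /= => /andP[-> _].
Qed.

Lemma sol_bounded1 p x y (s : R) :
  exists M : R, forall t, 0 <= t <= s -> `|sol p x y t| <= M.
Proof. exact: dw_bounded (fun t => @sol_dw p x y s t). Qed.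

(** This is [perturb] with nothing perturbed: the distance to [sol] is below every [e]. *)
Lemma sol_unique p x (v : R -> Y) (s : R) : 0 <= s ->
  (forall t, 0 <= t <= s -> dw `[0, s] v t (vf (flow t p) x (v t))) ->
  forall t, 0 <= t <= s -> v t = sol p x (v 0) t.
Proof.
move=> s0 dv t ts; apply/eqP; rewrite -subr_eq0 -normr_le0; apply/ler_addgt0Pr => e e0.
have [M HM] := sol_bounded1 p x (v 0) s.
have [e1 e10 H] := perturb (Num.max M `|x|) s0 e0.
rewrite add0r; apply: (H p p x (sol p x (v 0)) v (fun=> x) s) => //.
- by rewrite s0 lexx.
- by rewrite le_max lexx orbT.
- by move=> r rs; exact: sol_dw.
- by move=> r rs; rewrite le_max HM.
- exact: ballxx.
- by move=> r _; rewrite subrr normr0 ltW.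
- by rewrite sol0 subrr normr0 ltW.
Qed.

Lemma sol_cocycle p x y (s t : R) : 0 <= s -> 0 <= t ->
  sol p x y (s + t) = sol (flow s p) x (sol p x y s) t.
Proof.
move=> s0 t0.
have := @sol_unique (flow s p) x (fun r => sol p x y (s + r)) t t0.
rewrite addr0; apply; last by rewrite t0 lexx.
move=> r /andP[r0 rt]; rewrite -flowD addrC.
have sr0 : 0 <= s + r by exact: addr_ge0.
apply: dwS (dw_shift (solP p x y sr0)) => z /=.
by rewrite !in_itv /= andbT => /andP[z0 _]; exact: addr_ge0.
Qed.

Lemma sol_near (T eta : R) p x y : 0 <= T -> 0 < eta -> exists2 d : R, 0 < d &
  forall p' x' y', ball p d p' -> `|x - x'| <= d -> `|y' - y| <= d ->
  forall t, 0 <= t <= T -> `|sol p' x' y' t - sol p x y t| <= eta.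
Proof.
move=> T0 eta0; have [M HM] := sol_bounded1 p x y T.
have [e1 e10 H] := perturb (Num.max M `|x|) T0 eta0.
exists e1 => // p' x' y' pp' xx' yy' t tT.
apply: (H p p' x (sol p x y) (sol p' x' y') (fun=> x') T) => //.
- by rewrite T0 lexx.
- by rewrite le_max lexx orbT.
- by move=> r rs; exact: sol_dw.
- by move=> r rs; rewrite le_max HM.
- by move=> r rs; exact: sol_dw.
- by rewrite !sol0.
Qed.

Lemma sol_bounded (r T : R) : 0 <= T -> exists M : R, forall p x y t,
  `|x| <= r -> `|y| <= r -> 0 <= t <= T -> `|sol p x y t| <= M.
Proof.
move=> T0.
have Kc : compact ([set: P] `*` [set x : X | `|x| <= r] `*` [set y : Y | `|y| <= r]).
  by do 2 (apply: compact_setX; last exact: compact_closed_ball0); exact: base_compact.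
have := (compact_near_coveringP _).1 Kc R (pinfty_nbhs R)
  (fun M q => forall t, 0 <= t <= T -> `|sol q.1.1 q.1.2 q.2 t| <= M) _.
case.
  move=> [[p x] y] _; have [M HM] := sol_bounded1 p x y T.
  have [d d0 Hd] := sol_near p x y T0 ltr01.
  exists (ball (p, x, y) d, [set M' | M + 1 < M']).
    split; first exact: nbhsx_ballx.
    by exists (M + 1); split => //; exact: num_real.
  move=> [[[p' x'] y'] M'] [/= [[/= pp' xx'] yy'] MM'] t tT.
  rewrite -(subrK (sol p x y t) (sol _ _ _ _)) addrC.
  rewrite (le_trans (ler_normD _ _))// (le_trans _ (ltW MM'))// lerD ?HM//.
  move: xx' yy'; rewrite -!ball_normE /= => xx' yy'.
  by apply: Hd => //; rewrite ltW// distrC.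
move=> M [_ HM]; exists (M + 1) => p x y t xr yr tT.
by apply: (HM (M + 1) _ (p, x, y)) => //; rewrite ltrDl.
Qed.

Lemma sol_continuous (t : R) : 0 <= t ->
  continuous (fun q : P * X * Y => sol q.1.1 q.1.2 q.2 t).
Proof.
move=> t0 [[p x] y]; apply/cvgrPdist_le => e e0.
have [d d0 H] := sol_near p x y t0 e0.
apply: filterS (nbhsx_ballx (p, x, y) d d0) => -[[p' x'] y'] [[/= pp' xx'] yy'].
move: xx' yy'; rewrite -!ball_normE /= => xx' yy'.
by rewrite distrC; apply: H => //; [exact: ltW|rewrite distrC ltW|rewrite t0 lexx].
Qed.

(** The orbit of [base0] is dense and [sol] is continuous in the base point at each fixed time. The
    required closeness may depend on [t], since the bound is transferred one time at a time, so [c]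
    and [T] are unchanged. *)
Lemma sol_ub (r : R) : exists2 c : R, 0 < c & forall rho : R, exists2 T : R, 0 <= T &
  forall p x y t, `|x| <= r -> `|y| <= rho -> T <= t -> `|sol p x y t| <= c.
Proof.
have [c c0 H] := sol_ub0 S r; exists c => // rho; have [T T0 {}H] := H rho.
exists T => // p x y t xr yr Tt; apply/ler_addgt0Pr => e e0.
have t0 : 0 <= t by exact: le_trans Tt.
have [d d0 Hd] := sol_near p x y t0 e0.
have [s ps] := base_dense p d0.
rewrite -(subKr (sol (flow s (base0 S)) x y t) (sol p x y t)).
rewrite (le_trans (ler_normB _ _))// lerD//; first exact: H.
apply: Hd => //; [by rewrite subrr normr0 ltW|by rewrite subrr normr0 ltW|].
by rewrite t0 lexx.
Qed.

(* The solution of the coupled fast equation is compared with frozen solutions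
   on consecutive windows of the absorption time. *)
Lemma coupled_bounded (r rho0 : R) : exists (M e1 : R), 0 < e1 /\
  forall p (s : R) (Xf : R -> X) (v : R -> Y), `|v 0| <= rho0 ->
  (forall t, 0 <= t <= s -> dw `[0, s] v t (vf (flow t p) (Xf t) (v t))) ->
  (forall t, 0 <= t <= s -> `|Xf t| <= r) ->
  (forall t t', 0 <= t <= s -> 0 <= t' <= s -> `|Xf t - Xf t'| <= e1 * `|t - t'|) ->
  forall t, 0 <= t <= s -> `|v t| <= M.
Proof.
have [c c0 HT] := sol_ub r.
(* Invariant at the window ends: a frozen solution from the [rho1] ball is in the [c] ball after
   time [T], and the comparison error is at most 1. *)
pose rho1 := Num.max rho0 (c + 1); have [T T0 {}HT] := HT rho1.
pose T1 := T + 1; have T10 : 0 < T1 by rewrite ltr_wpDl.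
have [M HM] := sol_bounded (Num.max r rho1) (ltW T10).
have [e1 e10 He1] := perturb (Num.max r M) (ltW T10) ltr01.
(* With Lipschitz constant [e1 / T1] the slow argument moves by at most [e1] during a window of
   length [T1]. *)
exists (M + 1), (e1 / T1); split; first by rewrite divr_gt0.
move=> p s Xf v v0 dv Xr Xlip.
have win k t : k%:R * T1 <= s -> `|v (k%:R * T1)| <= rho1 ->
    0 <= t <= T1 -> k%:R * T1 + t <= s ->
    `|v (k%:R * T1 + t) - sol (flow (k%:R * T1) p) (Xf (k%:R * T1)) (v (k%:R * T1)) t| <= 1.
  set a := k%:R * T1 => as_ va /andP[t0 tT1] ats.
  have a0 : 0 <= a by rewrite mulr_ge0// ltW.
  have aX : `|Xf a| <= r by apply: Xr; rewrite a0.
  apply: (He1 (flow a p) (flow a p) (Xf a) (sol (flow a p) (Xf a) (v a))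
    (fun r => v (a + r)) (fun r => Xf (a + r)) t) => //; last by rewrite t0 lexx.
  - by rewrite t0.
  - by rewrite le_max aX.
  - by move=> z; exact: sol_dw.
  - move=> z /andP[z0 zt]; rewrite le_max HM ?orbT//.
    + by rewrite le_max aX.
    + by rewrite le_max va orbT.
    + by rewrite z0 (le_trans zt).
  - move=> z /andP[z0 zt]; rewrite -flowD.
    have azs : 0 <= a + z <= s by rewrite addr_ge0//= (le_trans _ ats)// lerD2l.
    rewrite [z + a]addrC; apply: dwS (dw_shift (dv _ azs)) => w /=.
    rewrite !in_itv /= => /andP[w0 wt]; rewrite addr_ge0//=.
    by rewrite (le_trans _ ats)// lerD2l.
  - exact: ballxx.
  - move=> z /andP[z0 zt].
    have azs : 0 <= a + z <= s by rewrite addr_ge0//= (le_trans _ ats)// lerD2l.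
    apply: le_trans (Xlip a (a + z) _ azs) _; first by rewrite a0.
    rewrite opprD addrA subrr add0r normrN ger0_norm// mulrAC ler_pdivrMr//.
    by apply: ler_wpM2l; [exact: ltW|exact: le_trans zt _].
  - by rewrite addr0 sol0 subrr normr0 ltW.
have ind k : k%:R * T1 <= s -> `|v (k%:R * T1)| <= rho1.
  elim: k => [|k IH]; first by rewrite mul0r le_max v0.
  rewrite -natr1 mulrDl mul1r => ks.
  have ks' : k%:R * T1 <= s by rewrite (le_trans _ ks)// lerDl ltW.
  have {}IH := IH ks'.
  have := win k T1 ks' IH; rewrite lexx (ltW T10) => /(_ isT ks) H.
  rewrite -(subrK (sol (flow (k%:R * T1) p) (Xf (k%:R * T1)) (v (k%:R * T1)) T1) (v _)) addrC.
  rewrite (le_trans (ler_normD _ _))// le_max; apply/orP; right; rewrite lerD//.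
  apply: HT => //; last by rewrite /T1 lerDl.
  by apply: Xr; rewrite mulr_ge0// ltW.
move=> t /andP[t0 ts].
pose k := Num.truncn (t / T1).
have /andP[kt tk] : k%:R <= t / T1 < k.+1%:R by apply: truncn_itv; rewrite divr_ge0// ltW.
have ktT : k%:R * T1 <= t by rewrite -ler_pdivlMr.
have tkT : t < k.+1%:R * T1 by rewrite -ltr_pdivrMr.
have ks : k%:R * T1 <= s by exact: le_trans ts.
have wkt : 0 <= t - k%:R * T1 <= T1.
  by rewrite subr_ge0 ktT lerBlDr; move: tkT; rewrite -natr1 mulrDl mul1r addrC => /ltW.
have := win k _ ks (ind k ks) wkt; rewrite addrC subrK => /(_ ts) H.
rewrite -(subrK (sol (flow (k%:R * T1) p) (Xf (k%:R * T1)) (v (k%:R * T1)) (t - k%:R * T1)) (v t)) addrC.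
rewrite (le_trans (ler_normD _ _))// lerD//; apply: HM => //.
- by rewrite le_max Xr// mulr_ge0//= ltW.
- by rewrite le_max ind// orbT.
Qed.

End FastSystem.

Lemma filterI_ex {T : Type} (F : set_system T) {FF : ProperFilter F} (A B : set T) :
  F A -> F B -> exists x, A x /\ B x.
Proof.
move=> FA FB; have /filter_ex[x [Ax Bx]] : F (A `&` B) by exact: filterI.
by exists x.
Qed.

(** * Global attractors *)

Section AttractorExistence.
Context {R : realType} {k : nat} {W : topologicalType}.
Notation Y := 'rV[R]_k.
Notation Z := (W * Y)%type.
Variables (B : set W) (phi : R -> Z -> Z).
Hypothesis WH : hausdorff_space W.
Hypothesis Bc : compact B.
Hypothesis Bcl : closed B.
Hypothesis B0 : B !=set0.
Hypothesis phiD : forall (s t : R) z, 0 <= s -> 0 <= t -> B z.1 ->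
  phi (s + t) z = phi t (phi s z).
Hypothesis phiB : forall (t : R) z, 0 <= t -> B z.1 -> B (phi t z).1.
Hypothesis phic : forall t : R, 0 <= t -> continuous (phi t).
Variable rho : R.
Hypothesis absorb : forall r : R, exists2 T : R, 0 <= T & forall (t : R) z,
  T <= t -> B z.1 -> `|z.2| <= r -> `|(phi t z).2| <= rho.

Let Q : set Z := B `*` [set y | `|y| <= rho].

Let Qc : compact Q.
Proof. by apply: compact_setX => //; exact: compact_closed_ball0. Qed.

Let Qcl : closed Q.
Proof.
rewrite (_ : Q = fst @^-1` B `&` snd @^-1` [set y | `|y| <= rho]) //.
apply: closedI; apply: closed_comp => //.
- by move=> z _; exact: cvg_fst.
- by move=> z _; exact: cvg_snd.
- apply: compact_closed; first exact: norm_hausdorff.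
  exact: compact_closed_ball0.
Qed.

(** Filters of pairs (time, starting point) with times going to infinity. They stand for the
    sequences of times and points of the usual argument, since [W] is only a topological space. *)
Let late (r : R) (F : set_system (R * Z)) : Prop :=
  forall T : R, F [set tz | [/\ T <= tz.1, B tz.2.1 & `|tz.2.2| <= r]].

Let ev (tz : R * Z) : Z := phi tz.1 tz.2.

(** The omega-limit set of the absorbing set [Q]. *)
Let A : set Z := [set a | forall (T : R) (V : set Z), nbhs a V ->
  exists t z, [/\ T <= t, Q z & V (phi t z)]].

Let late_cvg F : UltraFilter F -> late rho F -> exists2 a, A a & ev @ F --> a.
Proof.
move=> FU lF; have [T T0 HT] := absorb rho.
have EU := ultra_fmap ev FU.
have := Qc; rewrite compact_ultra => /(_ _ EU)[|a [_ Fa]].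
  suff : F [set tz | Q (ev tz)] by [].
  apply: filterS (lF T) => -[t z] /= [Tt Bz zr]; split; last exact: HT.
  by apply: phiB => //; exact: le_trans Tt.
exists a => // T' V aV.
have FV : F [set tz | V (ev tz)] := Fa _ aV.
have [[t z] [/= Vt [Tt Bz zr]]] := filterI_ex FV (lF T').
by exists t, z.
Qed.

(** Restarting each trajectory at the absorption time of the ball of radius [r] reduces this to
    radius [rho]. *)
Let late_cvgr r F : UltraFilter F -> late r F -> exists2 a, A a & ev @ F --> a.
Proof.
move=> FU lF; have [T T0 HT] := absorb r.
pose sh (tz : R * Z) : R * Z := (tz.1 - T, phi T tz.2).
have [|a Aa Fa] := late_cvg (ultra_fmap sh FU).
  move=> T'; suff : F [set tz | [/\ T' <= (sh tz).1, B (sh tz).2.1 & `|(sh tz).2.2| <= rho]] by [].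
  apply: filterS (lF (T' + T)) => -[t z] /= [Tt Bz zr]; split.
  - by rewrite lerBrDr.
  - exact: phiB.
  - exact: HT.
exists a => // V aV; have FV : F [set tz | V (ev (sh tz))] := Fa _ aV.
suff : F [set tz | V (ev tz)] by [].
apply: filterS2 FV (lF T) => -[t z] /= + [Tt Bz _].
by rewrite /ev /= -phiD ?subr_ge0// subrKC.
Qed.

Let late_of a : A a -> exists F, [/\ UltraFilter F, late rho F & ev @ F --> a].
Proof.
move=> Aa.
pose b (TV : R * set Z) := [set tz : R * Z | [/\ TV.1 <= tz.1, Q tz.2 & TV.2 (ev tz)]].
have FF : ProperFilter (filter_from [set TV | nbhs a TV.2] b).
  apply: filter_from_proper.
    apply: filter_from_filter; first by exists (0, setT); exact: filterT.
    move=> [T1 V1] [T2 V2] /= aV1 aV2; exists (Num.max T1 T2, V1 `&` V2) => /=.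
      exact: filterI.
    by move=> [t z] [/=]; rewrite ge_max => /andP[h1 h2] Qz [v1 v2].
  by move=> [T V] /= aV; have [t [z [h1 h2 h3]]] := Aa T V aV; exists (t, z).
have [F [FU FG]] := ultraFilterLemma FF.
exists F; split => //.
- move=> T; apply: FG; exists (T, setT); first exact: filterT.
  by move=> [t z] [/= Tt [Bz zr] _].
- move=> V aV; suff : F [set tz | V (ev tz)] by [].
  by apply: FG; exists (0, V) => // -[t z] [].
Qed.

Let A_Q : A `<=` Q.
Proof.
move=> a /late_of[F [FU lF Fa]].
apply: (closed_cvg Q Qcl _ _ Fa).
have [T T0 HT] := absorb rho.
apply: filterS (lF T) => -[t z] /= [Tt Bz zr]; split; last exact: HT.
by apply: phiB => //; exact: le_trans Tt.
Qed.

Let A_closed : closed A.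
Proof.
move=> a clA T V; rewrite nbhsE => -[N1 [oN1 N1a] N1V].
have [b [Ab N1b]] := clA N1 (open_nbhs_nbhs (conj oN1 N1a)).
have [t [z [h1 h2 h3]]] := Ab T N1 (open_nbhs_nbhs (conj oN1 N1b)).
by exists t, z; split => //; exact: N1V.
Qed.

Let ev_shift (s : R) F a : 0 <= s -> ProperFilter F -> late rho F -> ev @ F --> a ->
  (fun tz => ev (tz.1 + s, tz.2)) @ F --> phi s a.
Proof.
move=> s0 FF lF Fa.
have h : (phi s \o ev) @ F --> phi s a.
  by apply: (cvg_comp _ _ Fa); exact: phic.
move=> V aV; have FV : F [set tz | V (phi s (ev tz))] := h _ aV.
suff : F [set tz | V (ev (tz.1 + s, tz.2))] by [].
apply: filterS2 FV (lF 0) => -[t z] /= + [t0 Bz _].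
by rewrite /ev /= phiD.
Qed.

(** Nonemptiness, invariance and attraction each come from a suitable late ultrafilter, along which
    [ev] converges to a point of [A]. Attraction is expressed by open neighbourhoods, as no metric
    on [W] is available. *)
Lemma attractor_exists : exists A : set Z,
  [/\ A `<=` B `*` setT, A !=set0, compact A,
      forall t : R, 0 <= t -> phi t @` A = A &
      forall (r : R) (U : set Z), open U -> A `<=` U ->
        exists T : R, forall (t : R) z, T <= t -> B z.1 -> `|z.2| <= r -> U (phi t z)].
Proof.
exists A; split.
- by move=> a /A_Q[].
- have [w Bw] := B0.
  have PF : ProperFilter ((fun t : R => (t, (w, 0 : Y))) @ pinfty_nbhs R).
    exact: fmap_proper_filter.
  have [F [FU FG]] := ultraFilterLemma PF.
  have [|a Aa _] := @late_cvgr 0 F FU; last by exists a.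
  move=> T; apply: FG.
  suff : \forall t \near +oo, [/\ T <= t, B w & `|0 : Y| <= (0 : R)] by [].
  by apply: filterS (nbhs_pinfty_ge (num_real T)) => t Tt; split => //; rewrite normr0.
- exact: subclosed_compact A_closed Qc A_Q.
- move=> s s0; apply/seteqP; split => [_ [a Aa <-]|a Aa].
  + have [F [FU lF Fa]] := late_of Aa.
    have FP : ProperFilter F by exact: ultra_proper.
    have Fs := ev_shift s0 FP lF Fa.
    move=> T V aV.
    have FV : F [set tz | V (ev (tz.1 + s, tz.2))] := Fs _ aV.
    have [[t z] [/= Vt [Tt Bz zr]]] := filterI_ex FV (lF (T - s)).
    by exists (t + s), z; split => //; rewrite -lerBlDr.
  (* Negative invariance without a backward flow: stop the trajectories leading to [a] a time [s]
     earlier; a limit [b] of these points is carried to [a] by [phi s]. *)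
  + have [F [FU lF Fa]] := late_of Aa.
    pose sh (tz : R * Z) : R * Z := (tz.1 - s, tz.2).
    have lsh : late rho (sh @ F).
      move=> T; suff : F [set tz | [/\ T <= (sh tz).1, B (sh tz).2.1 & `|(sh tz).2.2| <= rho]] by [].
      by apply: filterS (lF (T + s)) => -[t z] /= [Tt Bz zr]; split => //; rewrite lerBrDr.
    have UF := ultra_fmap sh FU.
    have [b Ab Fb] := late_cvg UF lsh.
    exists b => //.
    have FP : ProperFilter (sh @ F) by exact: ultra_proper.
    have Fs := ev_shift s0 FP lsh Fb.
    have Fs' : ev @ F --> phi s b.
      move=> V bV; have FV : F [set tz | V (ev ((sh tz).1 + s, (sh tz).2))] := Fs _ bV.
      suff : F [set tz | V (ev tz)] by [].
      by apply: filterS FV => -[t z] /=; rewrite subrK.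
    have e1 : (phi s b).1 = a.1.
      by apply: (cvg_unique WH (cvg_comp _ _ Fs' cvg_fst) (cvg_comp _ _ Fa cvg_fst)).
    have e2 : (phi s b).2 = a.2.
      by apply: (cvg_unique (@norm_hausdorff _ _) (cvg_comp _ _ Fs' cvg_snd) (cvg_comp _ _ Fa cvg_snd)).
    by case: a e1 e2 {Aa Fa} => a1 a2 /= <- <-; case: (phi s b).
(* If attraction fails, the late points outside [U] generate a filter; a finer ultrafilter makes
   [ev] converge to a point of [A], hence into the open set [U]. *)
- move=> r U oU AU; apply: contrapT => /forallNP nU.
  pose b (T : R) := [set tz : R * Z | [/\ T <= tz.1, B tz.2.1, `|tz.2.2| <= r & ~ U (ev tz)]].
  have FF : ProperFilter (filter_from setT b).
    apply: filter_from_proper.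
      apply: filter_from_filter; first by exists 0.
      move=> T1 T2 _ _; exists (Num.max T1 T2) => //.
      by move=> [t z] [/=]; rewrite ge_max => /andP[h1 h2] Bz zr nUz.
    move=> T _; apply: contrapT => nb; apply: (nU T) => t z Tt Bz zr.
    by apply: contrapT => nUz; apply: nb; exists (t, z).
  have [F [FU FG]] := ultraFilterLemma FF.
  have [|a Aa Fa] := @late_cvgr r F FU.
    by move=> T; apply: FG; exists T => // -[t z] [].
  have FV : F [set tz | U (ev tz)] := Fa _ (open_nbhs_nbhs (conj oU (AU _ Aa))).
  have Fb : F (b 0) by apply: FG; exists 0.
  by have [tz [Utz []]] := filterI_ex FV Fb.
Qed.

End AttractorExistence.

(** * Bounds on the hull *)

Section EuclNorm.
Context {R : realType} {k : nat}.
Implicit Types v : 'rV[R]_k.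

Lemma rV_norm_coord v i : `|v ord0 i| <= `|v|.
Proof.
rewrite [leRHS]/Num.norm /= mx_normrE.
by apply: (le_bigmax _ (fun ij : 'I_1 * 'I_k => `|v ij.1 ij.2|) (ord0, i)).
Qed.

Lemma rV_norm_le v (r : R) : 0 <= r -> (forall i, `|v ord0 i| <= r) -> `|v| <= r.
Proof.
move=> r0 H; rewrite [leLHS]/Num.norm /= mx_normrE.
by apply/bigmax_leP; split => // -[i j] _ /=; rewrite (ord1 i).
Qed.

Lemma norm_le_eucl v : `|v| <= eucl_norm v.
Proof.
apply: rV_norm_le => [|i]; first exact: sqrtr_ge0.
rewrite -sqrtr_sqr ler_sqrt; last by apply: sumr_ge0 => j _; rewrite sqr_ge0.
by rewrite (bigD1 i)//= lerDl; apply: sumr_ge0 => j _; rewrite sqr_ge0.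
Qed.

(** The crude constant [k.+1] is positive in dimension 0 as well, so it can be divided by without
    case distinction. *)
Lemma eucl_le_norm v : eucl_norm v <= k.+1%:R * `|v|.
Proof.
have h0 : 0 <= k.+1%:R * `|v| by rewrite mulr_ge0.
rewrite -[leRHS]ger0_norm// -sqrtr_sqr ler_sqrt ?sqr_ge0//.
apply: (@le_trans _ _ (\sum_(i < k) `|v| ^+ 2)).
  by apply: ler_sum => i _; rewrite -real_normK ?num_real// lerXn2r ?nnegrE// rV_norm_coord.
rewrite sumr_const card_ord exprMn -[_ *+ k]mulr_natl ler_wpM2r ?sqr_ge0//.
by rewrite -natrX ler_nat; nia.
Qed.

Lemma eucl_distxx v : eucl_dist v v = 0.
Proof.
by apply/eqP; rewrite eq_le (le_trans (eucl_le_norm _)) ?subrr ?normr0 ?mulr0// sqrtr_ge0.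
Qed.

End EuclNorm.

Section CompactOpen.
Context {R : realType} {n m : nat}.
Notation X := 'rV[R]_n.
Notation Y := 'rV[R]_m.
Notation VF := (vfield R n m).

(** Only the limit is required to be continuous: the carrier of [VF] contains discontinuous
    functions, and [F] may charge them. *)
Lemma co_cvgP (h : VF) (F : set_system VF) : Filter F -> continuous h ->
  F --> h <-> forall K : set (X * Y * R), compact K -> forall e : R, 0 < e ->
    \forall k \near F, forall q, K q -> `|k q - h q| <= e.
Proof.
move=> FF hc; split.
- move=> /(@compact_open_fam_compactP _ _ h F hc FF)/fam_cvgP H K Kc e e0.
  have /H : @compact (X * Y * R)%type K by [].
  move=> /(_ [set k | forall q, K q -> `|k q - h q| <= e]); apply.
  apply/uniform_nbhs; exists [set vw | ball vw.1 e vw.2]; split.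
    by rewrite -entourage_ballE; exists e.
  move=> k /= Hk q Kq; have := Hk q Kq.
  by rewrite -ball_normE /= distrC => /ltW.
- move=> H; apply/(@compact_open_fam_compactP _ _ h F hc FF)/fam_cvgP => K Kc P /uniform_nbhs[E [entE EP]].
  move: entE; rewrite -entourage_ballE => -[e /= e0 eE].
  have e20 : 0 < e / 2 by rewrite divr_gt0.
  apply: filterS (H K Kc _ e20) => k Hk; apply: EP => q Kq; apply: eE.
  by rewrite /= -ball_normE /= distrC (le_lt_trans (Hk q Kq))// ltr_pdivrMr//; lra.
Qed.

Lemma closed_ball_compact (r : R) : compact [set q : X * Y | `|q| <= r].
Proof.
rewrite (_ : [set q | _] = [set x : X | `|x| <= r] `*` [set y : Y | `|y| <= r]).
  by apply: compact_setX; exact: compact_closed_ball0.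
apply/seteqP; split => -[x y] /=; rewrite prod_normE /= ge_max.
  by move=> /andP[].
by move=> [-> ->].
Qed.

Lemma near_co (h : VF) K (e : R) : continuous h -> compact K -> 0 < e ->
  \forall k \near h, forall q, K q -> `|k q - h q| <= e.
Proof. by move=> hc Kc e0; apply: ((co_cvgP (nbhs_filter h) hc).1 _ K Kc e e0). Qed.

End CompactOpen.

Section HullBounds.
Context {R : realType} {n m : nat}.
Notation X := 'rV[R]_n.
Notation Y := 'rV[R]_m.
Notation VF := (vfield R n m).
Variable g : VF.
Hypothesis g_adm : admissible g.
Hypothesis g_lip : uniformly_lipschitz g.

Lemma adm_bound (r : R) : exists M : R, forall x y t, `|x| <= r -> `|y| <= r ->
  `|g (x, y, t)| <= M.
Proof.
have [[M HM] _] := g_adm (@closed_ball_compact R n m r).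
exists M => x y t xr yr; apply: le_trans (norm_le_eucl _) _; apply: HM.
by rewrite /= prod_normE /= ge_max xr.
Qed.

Lemma adm_modulus (r e : R) : 0 < e -> exists2 d : R, 0 < d &
  forall x1 y1 t1 x2 y2 t2, `|x1| <= r -> `|y1| <= r -> `|x2| <= r -> `|y2| <= r ->
  `|x1 - x2| < d -> `|y1 - y2| < d -> `|t1 - t2| < d ->
  `|g (x1, y1, t1) - g (x2, y2, t2)| <= e.
Proof.
move=> e0; have [_ H] := g_adm (@closed_ball_compact R n m r).
have [d d0 {}H] := H e e0.
(* A single denominator above both factors [n.+1] and [m.+1] that compare the Euclidean norms with
   the sup norm. *)
pose d' := d / (n + m).+2%:R.
have d'0 : 0 < d' by rewrite divr_gt0.
exists d' => // x1 y1 t1 x2 y2 t2 x1r y1r x2r y2r x12 y12 t12.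
have N0 k : (k <= (n + m).+1)%N -> k.+1%:R * d' <= d.
  move=> knm; rewrite /d' mulrCA ler_piMr ?(ltW d0)//.
  by rewrite ler_pdivrMr// mul1r ler_nat ltnS.
apply: le_trans (norm_le_eucl _) _; apply: ltW; apply: H.
- by rewrite /= prod_normE /= ge_max x1r.
- by rewrite /= prod_normE /= ge_max x2r.
- apply: le_lt_trans (eucl_le_norm _) _; apply: lt_le_trans (N0 n (leqW (leq_addr m n))).
  by rewrite ltr_pM2l.
- apply: le_lt_trans (eucl_le_norm _) _; apply: lt_le_trans (N0 m (leqW (leq_addl n m))).
  by rewrite ltr_pM2l.
- apply: lt_le_trans t12 _; rewrite ler_pdivrMr// ler_peMr ?(ltW d0)//.
  by rewrite ler1n.
Qed.

Lemma adm_lip (r : R) : exists2 L : R, 0 <= L & forall x y1 y2 t,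
  `|x| <= r -> `|y1| <= r -> `|y2| <= r ->
  `|g (x, y1, t) - g (x, y2, t)| <= L * `|y1 - y2|.
Proof.
have [L HL] := g_lip (@compact_closed_ball0 R n r) (@compact_closed_ball0 R m r).
exists (Num.max L 0 * m.+1%:R); first by rewrite mulr_ge0// le_max lexx orbT.
move=> x y1 y2 t xr y1r y2r.
apply: le_trans (norm_le_eucl _) _; apply: le_trans (HL y1 y2 x t y1r y2r xr) _.
apply: (@le_trans _ _ (Num.max L 0 * eucl_dist y1 y2)).
  by rewrite ler_wpM2r ?sqrtr_ge0// le_max lexx.
by rewrite -mulrA ler_wpM2l ?le_max ?lexx ?orbT//; exact: eucl_le_norm.
Qed.

Lemma translate_cont (h : VF) s : continuous h -> continuous (translate h s).
Proof.
move=> hc.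
have -> : translate h s = h \o (fun q : X * Y * R => (q.1, q.2 + s)).
  by apply/funext => -[[x y] t].
move=> q; apply: continuous_comp; last exact: hc.
apply: (@cvg_pair _ _ _ _ (nbhs q.1) (nbhs (q.2 + s))); first exact: cvg_fst.
by apply: cvgD; [exact: cvg_snd|exact: cvg_cst].
Qed.

Lemma adm_continuous : continuous (g : (X * Y * R)%type -> Y).
Proof.
move=> [[x y] t]; apply/cvgrPdist_le => e e0.
have [d d0 H] := adm_modulus (`|x| + `|y| + 1) e0.
have d10 : 0 < Num.min d 1 by rewrite lt_min d0 ltr01.
apply: filterS (nbhsx_ballx (x, y, t) _ d10).
move=> [[x' y'] t'] [[/= xx' yy'] tt'].
move: xx' yy' tt'; rewrite -!ball_normE /= !lt_min.
move=> /andP[xd x1] /andP[yd y1] /andP[td _].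
have hx' : `|x'| <= `|x| + 1.
  by rewrite -{1}(subKr x x') (le_trans (ler_normB _ _))// lerD2l ltW.
have hy' : `|y'| <= `|y| + 1.
  by rewrite -{1}(subKr y y') (le_trans (ler_normB _ _))// lerD2l ltW.
have := normr_ge0 x; have := normr_ge0 y => ny nx.
by apply: H => //; lra.
Qed.

Lemma hull_g : hull g g.
Proof.
split; last exact: adm_continuous.
apply: subset_closure; exists 0 => //.
by apply/funext => -[[x y] t]; rewrite /translate /= addr0.
Qed.

Lemma hull_approx (h : VF) (K : set (X * Y * R)) (e : R) : hull g h -> compact K -> 0 < e ->
  exists s : R, forall q, K q -> `|translate g s q - h q| <= e.
Proof.
move=> [hcl hc] Kc e0; have [k [[s _ <-] Hk]] := hcl _ (near_co hc Kc e0).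
by exists s.
Qed.

(** The bound, the modulus and the Lipschitz estimate each involve [h] at no more than two points,
    and all of them are insensitive to translation in time. Approximating [h] at these points by a
    translate of [g] therefore carries them to the hull. *)
Lemma hull_approx_seq (h : VF) (q1 q2 : X * Y * R) (e : R) : hull g h -> 0 < e ->
  exists s : R, `|translate g s q1 - h q1| <= e /\ `|translate g s q2 - h q2| <= e.
Proof.
move=> Hh e0; have Kc : compact [set q1; q2].
  by apply: compactU; exact: compact_set1.
have [s Hs] := hull_approx Hh Kc e0; exists s.
by split; apply: Hs; [left|right].
Qed.

Lemma hull_bound (r : R) : exists M : R, forall h x y t, hull g h ->
  `|x| <= r -> `|y| <= r -> `|h (x, y, t)| <= M.
Proof.
have [M HM] := adm_bound r; exists (M + 1) => h x y t Hh xr yr.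
have [s [H1 _]] := hull_approx_seq (x, y, t) (x, y, t) Hh ltr01.
rewrite -(subKr (translate g s (x, y, t)) (h _)).
by rewrite (le_trans (ler_normB _ _))// lerD//; exact: HM.
Qed.

Lemma hull_modulus (r e : R) : 0 < e -> exists2 d : R, 0 < d &
  forall h x1 y1 t1 x2 y2 t2, hull g h ->
  `|x1| <= r -> `|y1| <= r -> `|x2| <= r -> `|y2| <= r ->
  `|x1 - x2| < d -> `|y1 - y2| < d -> `|t1 - t2| < d ->
  `|h (x1, y1, t1) - h (x2, y2, t2)| <= e.
Proof.
move=> e0; have e30 : 0 < e / 3 by rewrite divr_gt0.
have [d d0 H] := adm_modulus r e30; exists d => // h x1 y1 t1 x2 y2 t2 Hh ? ? ? ? ? ? t12.
have [s [H1 H2]] := hull_approx_seq (x1, y1, t1) (x2, y2, t2) Hh e30.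
have {}H : `|translate g s (x1, y1, t1) - translate g s (x2, y2, t2)| <= e / 3.
  by apply: H => //=; rewrite opprD addrACA subrr addr0.
set a := h _; set b := h _; set a' := translate g s _ in H1 H; set b' := translate g s _ in H2 H.
have -> : a - b = (a - a') + (a' - b') + (b' - b).
  by rewrite !subrKA.
apply: le_trans (ler_normD _ _) _; apply: (@le_trans _ _ (`|a - a'| + `|a' - b'| + `|b' - b|)).
  by rewrite lerD2r ler_normD.
by rewrite [`|a - a'|]distrC; lra.
Qed.

Lemma hull_lip (r : R) : exists2 L : R, 0 <= L & forall h x y1 y2 t, hull g h ->
  `|x| <= r -> `|y1| <= r -> `|y2| <= r ->
  `|h (x, y1, t) - h (x, y2, t)| <= L * `|y1 - y2|.
Proof.
have [L L0 H] := adm_lip r; exists L => // h x y1 y2 t Hh xr y1r y2r.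
apply/ler_addgt0Pr => e e0; have e20 : 0 < e / 2 by rewrite divr_gt0.
have [s [H1 H2]] := hull_approx_seq (x, y1, t) (x, y2, t) Hh e20.
have {}H : `|translate g s (x, y1, t) - translate g s (x, y2, t)| <= L * `|y1 - y2|.
  exact: H.
set a := h _; set b := h _; set a' := translate g s _ in H1 H; set b' := translate g s _ in H2 H.
have -> : a - b = (a - a') + (a' - b') + (b' - b).
  by rewrite !subrKA.
apply: le_trans (ler_normD _ _) _; apply: (@le_trans _ _ (`|a - a'| + `|a' - b'| + `|b' - b|)).
  by rewrite lerD2r ler_normD.
by rewrite [`|a - a'|]distrC; lra.
Qed.

(* Uniform equicontinuity turns pointwise convergence along an ultrafilter
   into locally uniform convergence. *)
Lemma hull_ultra_compact (F : set_system VF) : UltraFilter F -> F (hull g) ->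
  exists2 h : VF, hull g h & F --> h.
Proof.
move=> FU FH.
have ptw q : exists v : Y, (fun k : VF => k q) @ F --> v.
  case: q => -[x y] t.
  have [M HM] := hull_bound (Num.max `|x| `|y|).
  have := @compact_closed_ball0 R m M.
  rewrite compact_ultra => /(_ _ (ultra_fmap (fun k : VF => k (x, y, t)) FU))[|v [_ Hv]].
    suff : F [set k | `|k (x, y, t)| <= M] by [].
    by apply: filterS FH => k Hk /=; apply: HM; rewrite // le_max lexx ?orbT.
  by exists v.
have [h Hh] := choice ptw.
(* The modulus shared by all members of the hull survives in their pointwise limit [h]. *)
have hmod (r e : R) : 0 < e -> exists2 d : R, 0 < d &
    forall x1 y1 t1 x2 y2 t2,
    `|x1| <= r -> `|y1| <= r -> `|x2| <= r -> `|y2| <= r ->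
    `|x1 - x2| < d -> `|y1 - y2| < d -> `|t1 - t2| < d ->
    `|h (x1, y1, t1) - h (x2, y2, t2)| <= e /\
    (forall k, hull g k -> `|k (x1, y1, t1) - k (x2, y2, t2)| <= e).
  move=> e0; have [d d0 H] := hull_modulus r e0.
  exists d => // x1 y1 t1 x2 y2 t2 *; split; last by move=> k Hk; exact: H.
  have c1 : (fun k : VF => `|k (x1, y1, t1) - k (x2, y2, t2)|) @ F -->
      `|h (x1, y1, t1) - h (x2, y2, t2)| by apply: cvg_norm; apply: cvgB.
  apply: (closed_cvg (fun x : R => x <= e) (@closed_le R e) _ _ c1).
  by apply: filterS FH => k Hk /=; exact: H.
have hc : continuous (h : (X * Y * R)%type -> Y).
  move=> [[x y] t]; apply/cvgrPdist_le => e e0.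
  have [d d0 H] := hmod (`|x| + `|y| + 1) e e0.
  have d10 : 0 < Num.min d 1 by rewrite lt_min d0 ltr01.
apply: filterS (nbhsx_ballx (x, y, t) _ d10).
  move=> [[x' y'] t'] [[/= xx' yy'] tt'].
  move: xx' yy' tt'; rewrite -!ball_normE /= !lt_min.
  move=> /andP[xd x1] /andP[yd y1] /andP[td _].
  have hx' : `|x'| <= `|x| + 1.
    by rewrite -{1}(subKr x x') (le_trans (ler_normB _ _))// lerD2l ltW.
  have hy' : `|y'| <= `|y| + 1.
    by rewrite -{1}(subKr y y') (le_trans (ler_normB _ _))// lerD2l ltW.
  have := normr_ge0 x; have := normr_ge0 y => ny nx.
  by have [||||||| //] := H x y t x' y' t'; lra.
have Fh : F --> (h : VF).
  apply/(@co_cvgP _ _ _ (h : VF) F _ hc) => K Kc e e0.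
  have e30 : 0 < e / 3 by rewrite divr_gt0.
  apply: (compact_near_coveringP K).1 => // -[[x y] t] Kq.
  have [d d0 H] := hmod (`|x| + `|y| + 1) _ e30.
  have hxyt := Hh (x, y, t); move/cvgrPdist_le : hxyt => /(_ _ e30) hxyt.
  exists (ball (x, y, t) (Num.min d 1), [set k | hull g k /\ `|h (x, y, t) - k (x, y, t)| <= e / 3]).
    split; first by apply: nbhsx_ballx; rewrite lt_min d0 ltr01.
    exact: filterI.
  move=> [[[x' y'] t'] k] [/= [[/= xx' yy'] tt'] [Hk hk]].
  move: xx' yy' tt'; rewrite -!ball_normE /= !lt_min.
  move=> /andP[xd x1] /andP[yd y1] /andP[td _].
  have hx' : `|x'| <= `|x| + 1.
    by rewrite -{1}(subKr x x') (le_trans (ler_normB _ _))// lerD2l ltW.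
  have hy' : `|y'| <= `|y| + 1.
    by rewrite -{1}(subKr y y') (le_trans (ler_normB _ _))// lerD2l ltW.
  have ny := normr_ge0 y; have nx := normr_ge0 x.
  have [||||||| H1 H2] := H x y t x' y' t'; try lra; try exact: xd; try exact: yd; try exact: td.
  have {}H2 := H2 k Hk.
  set a := k (x', y', t'); set b := h (x', y', t').
  have -> : a - b = (a - k (x, y, t)) + (k (x, y, t) - h (x, y, t)) + (h (x, y, t) - b).
    by rewrite !subrKA.
  apply: le_trans (ler_normD _ _) _.
  have h3 := ler_normD (a - k (x, y, t)) (k (x, y, t) - h (x, y, t)).
  rewrite distrC in hk; rewrite distrC in H2; rewrite -/a in H2; rewrite -/b in H1; lra.
exists (h : VF) => //; split => //.
move: Fh; apply: closed_cvg; first exact: closed_closure.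
by apply: filterS FH => k [].
Qed.

End HullBounds.

(** * Solutions of the slow-fast system *)

Section PointwiseContinuity.
Context {A B C D : topologicalType}.

Lemma pair_continuous_at (u : A -> B) (v : A -> C) (z : A) :
  {for z, continuous u} -> {for z, continuous v} -> {for z, continuous (fun q => (u q, v q))}.
Proof. by move=> cu cv; exact: (@cvg_pair _ _ _ _ (nbhs (u z)) (nbhs (v z)) _ _ _ _ _ cu cv). Qed.

Lemma comp_continuous_at (h : B -> C) (u : A -> B) (z : A) :
  continuous h -> {for z, continuous u} -> {for z, continuous (fun q => h (u q))}.
Proof. by move=> ch cu; apply: continuous_comp => //; exact: ch. Qed.

Lemma fst_continuous_at (z : A * B) : {for z, continuous (@fst A B)}.
Proof. exact: cvg_fst. Qed.

Lemma snd_continuous_at (z : A * B) : {for z, continuous (@snd A B)}.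
Proof. exact: cvg_snd. Qed.

Lemma cst_continuous_at (c : B) (z : A) : {for z, continuous (fun=> c)}.
Proof. exact: cvg_cst. Qed.

End PointwiseContinuity.

Section PointwiseContinuity2.
Context {A B C D : topologicalType}.

Lemma comp2_continuous_at (h : B * C -> D) (u : A -> B) (v : A -> C) (z : A) :
  continuous h -> {for z, continuous u} -> {for z, continuous v} ->
  {for z, continuous (fun q => h (u q, v q))}.
Proof. by move=> ch cu cv; apply: comp_continuous_at => //; exact: pair_continuous_at. Qed.

Lemma fst_snd_continuous_at (z : A * (B * C)) : {for z, continuous (fun q : A * (B * C) => q.2.1)}.
Proof. by apply: (@comp_continuous_at _ _ _ fst snd); [move=> ?; exact: fst_continuous_at|exact: snd_continuous_at]. Qed.

Lemma snd_snd_continuous_at (z : A * (B * C)) : {for z, continuous (fun q : A * (B * C) => q.2.2)}.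
Proof. by apply: (@comp_continuous_at _ _ _ snd snd); [move=> ?; exact: snd_continuous_at|exact: snd_continuous_at]. Qed.

End PointwiseContinuity2.

Section DwPair.
Context {R : realType} {V W : normedModType R}.

Lemma dw_pair (I : set R) (x : R -> V) (y : R -> W) t v w :
  dw I x t v -> dw I y t w -> dw I (fun s => (x s, y s)) t (v, w).
Proof.
move=> Hx Hy e e0; have [d1 d10 {}Hx] := Hx e e0; have [d2 d20 {}Hy] := Hy e e0.
exists (Num.min d1 d2); first by rewrite lt_min d10.
move=> s Is; rewrite lt_min => /andP[s1 s2].
by rewrite prod_normE /= ge_max Hx// Hy.
Qed.

Lemma dw_fst (I : set R) (u : R -> V * W) t v :
  dw I u t v -> dw I (fun s => (u s).1) t v.1.
Proof.
move=> H e e0; have [d d0 {}H] := H e e0; exists d => // s Is sd.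
by have := H s Is sd; rewrite prod_normE /= ge_max => /andP[].
Qed.

Lemma dw_snd (I : set R) (u : R -> V * W) t v :
  dw I u t v -> dw I (fun s => (u s).2) t v.2.
Proof.
move=> H e e0; have [d d0 {}H] := H e e0; exists d => // s Is sd.
by have := H s Is sd; rewrite prod_normE /= ge_max => /andP[].
Qed.

End DwPair.

Section SlowFast.
Context {R : realType} {n m : nat} (S : fast_system R n m).
Notation X := 'rV[R]_n.
Notation Y := 'rV[R]_m.
Notation P := (base S).
Variables (f : X * Y -> X) (a b : R).
Hypothesis fc : continuous f.
Hypothesis a0 : 0 < a.
Hypothesis b0 : 0 < b.
Hypothesis f_growth : forall x y, `|f (x, y)| <= a + b * `|x|.

Definition sf_solution (e : R) (I : set R) (x : R -> X) (y : R -> Y) : Prop :=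
  forall t, I t -> dw I x t (f (x t, y t)) /\
    dw I y t (e^-1 *: vf (flow (t / e) (base0 S)) (x t) (y t)).

Lemma sf_solutionS e (I J : set R) x y : J `<=` I -> sf_solution e I x y -> sf_solution e J x y.
Proof. by move=> JI H t /JI/H[h1 h2]; split; exact: dwS JI _. Qed.

(** The Gronwall bound for [|x'| <= a + b |x|]; the factor 2 is there because [dw_gronwall] grants
    the derivative only [eta / 2]. *)
Definition slow_radius (x0 : X) (t0 : R) : R := (`|x0| + 2 * a * t0) * expR (b * t0).

Lemma slow_radius_ge0 x0 t0 : 0 <= t0 -> 0 <= slow_radius x0 t0.
Proof.
by move=> t00; rewrite mulr_ge0 ?expR_ge0// addr_ge0// mulr_ge0// mulr_ge0// ltW.
Qed.

Lemma slow_bound (x0 : X) (t0 s : R) (x x' : R -> X) : 0 <= s <= t0 -> x 0 = x0 ->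
  (forall t, 0 <= t <= s -> dw `[0, s] x t (x' t)) ->
  (forall t, 0 <= t <= s -> `|x' t| <= a + b * `|x t|) ->
  forall t, 0 <= t <= s -> `|x t| <= slow_radius x0 t0.
Proof.
move=> /andP[s0 st0] x0E dx xg t ts.
have a20 : 0 < 2 * a by rewrite mulr_gt0.
have mono r : 0 <= r <= t0 -> (`|x0| + 2 * a * r) * expR (b * r) <= slow_radius x0 t0.
  move=> /andP[r0 rt0]; rewrite /slow_radius ler_pM ?expR_ge0//.
  - by apply: addr_ge0 => //; rewrite mulr_ge0// ltW.
  - by rewrite lerD2l ler_pM2l.
  - by rewrite ler_expR ler_pM2l.
have := @dw_gronwall R X 0 s b (2 * a) `|x0| (slow_radius x0 t0) x x' (ltW b0) a20 (normr_ge0 _).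
rewrite x0E lexx subr0 => /(_ isT (mono s _) dx) H.
have {}H : `|x t| <= (`|x0| + 2 * a * (t - 0)) * expR (b * (t - 0)).
  apply: H => //; first by rewrite s0.
  move=> r rs _; apply: le_trans (xg r rs) _; rewrite addrC lerD2l; lra.
rewrite subr0 in H; apply: le_trans H _; apply: mono.
by have /andP[t0' ts'] := ts; rewrite t0' (le_trans ts').
Qed.

Lemma dw_rescale {V : normedModType R} (e s : R) (y : R -> V) (w : R -> V) : 0 < e ->
  (forall t, 0 <= t <= s -> dw `[0, s] y t (e^-1 *: w t)) ->
  forall tau, 0 <= tau <= s / e -> dw `[0, s / e] (fun tau => y (e * tau)) tau (w (e * tau)).
Proof.
move=> e0 dy tau /andP[tau0 taus].
have ets : 0 <= e * tau <= s by rewrite mulr_ge0 ?(ltW e0)//= mulrC -ler_pdivlMr.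
have := @dw_itv_shift R V `[0, s] y e 0 tau (e^-1 *: w (e * tau)) e0.
rewrite add0r scalerA mulfV ?gt_eqF// scale1r => /(_ (dy _ ets)) H.
move=> k k0; have [d d0 {}H] := H k k0; exists d => // r.
rewrite /= in_itv /= => /andP[r0 rs] rd.
have := H r; rewrite /= !add0r in_itv /= mulr_ge0 ?(ltW e0)//= mulrC -ler_pdivlMr// rs.
by rewrite mulrC; apply.
Qed.

Lemma sf_rescale (e s : R) x y : 0 < e -> sf_solution e `[0, s] x y ->
  forall tau, 0 <= tau <= s / e ->
    dw `[0, s / e] (fun tau => y (e * tau)) tau (vf (flow tau (base0 S)) (x (e * tau)) (y (e * tau))).
Proof.
move=> e0 H tau taus.
have := @dw_rescale Y e s y (fun t => vf (flow (t / e) (base0 S)) (x t) (y t)) e0.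
move=> /(_ _ tau taus); rewrite [e * tau / e]mulrAC mulfV ?gt_eqF// mul1r; apply.
by move=> t ts; apply: (H t _).2; rewrite /= in_itv.
Qed.

Lemma sf_slow_lip (e s C : R) x y : 0 <= C -> sf_solution e `[0, s] x y ->
  (forall t, 0 <= t <= s -> `|f (x t, y t)| <= C) ->
  forall t t', 0 <= t <= s -> 0 <= t' <= s -> `|x t - x t'| <= C * `|t - t'|.
Proof.
move=> C0 H fC.
suff W t t' : 0 <= t -> t <= t' -> t' <= s -> `|x t' - x t| <= C * (t' - t).
  move=> t t' /andP[t0 ts] /andP[t'0 t's]; have [tt'|t't] := leP t t'.
    by rewrite distrC ler0_norm ?subr_le0// opprB W.
  by rewrite gtr0_norm ?subr_gt0// W// ltW.
move=> t0 tt' t's.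
have sub r : t <= r <= t' -> 0 <= r <= s.
  by move=> /andP[h1 h2]; rewrite (le_trans t0 h1) (le_trans h2 t's).
apply: (@dw_lipschitz _ _ t t' C x (fun r => f (x r, y r))) => // r rtt'; last exact: fC (sub r rtt').
apply: dwS (H r _).1; first by move=> z /=; rewrite !in_itv /=; exact: sub.
by rewrite /= in_itv /=; exact: sub.
Qed.

(** The growth bound on [f] is uniform in [y], so the slow component is bounded and Lipschitz with a
    constant [C] whatever the fast one does. In fast time the constant is [e C], and
    [coupled_bounded], whose bound ignores the length of the interval, applies up to [s / e]. *)
Lemma sf_apriori (x0 : X) (y0 : Y) (t0 : R) : 0 < t0 -> exists (M e1 : R), [/\ 0 <= M, 0 < e1 &
  forall e s x y, 0 < e < e1 -> 0 <= s <= t0 -> x 0 = x0 -> y 0 = y0 ->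
    sf_solution e `[0, s] x y -> forall t, 0 <= t <= s ->
    [/\ `|x t| <= slow_radius x0 t0, `|y t| <= M & forall t', 0 <= t' <= s ->
      `|x t - x t'| <= (a + b * slow_radius x0 t0) * `|t - t'|]].
Proof.
move=> t00; pose R0 := slow_radius x0 t0; pose C := a + b * R0.
have R00 : 0 <= R0 by apply: slow_radius_ge0; exact: ltW.
have C0 : 0 < C by rewrite ltr_wpDr// mulr_ge0// ltW.
have [M [e1 [e10 H]]] := coupled_bounded S R0 `|y0|.
exists (Num.max M 0), (e1 / C); split; [by rewrite le_max lexx orbT|by rewrite divr_gt0|].
move=> e s x y /andP[e0 ee1] sst x0E y0E sf.
have xR : forall t, 0 <= t <= s -> `|x t| <= R0.
  apply: (@slow_bound x0 t0 s x (fun t => f (x t, y t)) sst x0E).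
    by move=> t ts; apply: (sf t _).1; rewrite /= in_itv.
  by move=> t ts; exact: f_growth.
have fC t : 0 <= t <= s -> `|f (x t, y t)| <= C.
  by move=> ts; apply: le_trans (f_growth _ _) _; rewrite lerD2l ler_pM2l//; exact: xR.
have lip := sf_slow_lip (ltW C0) sf fC.
have sc tau : 0 <= tau <= s / e -> 0 <= e * tau <= s.
  by move=> /andP[h1 h2]; rewrite mulr_ge0 ?(ltW e0)//= mulrC -ler_pdivlMr.
move=> t ts; split; [exact: xR| |by move=> t' t's; exact: lip].
have := H (base0 S) (s / e) (fun tau => x (e * tau)) (fun tau => y (e * tau)).
rewrite mulr0 y0E lexx => /(_ isT (sf_rescale e0 sf)) /(_ _ _ (t / e)).
rewrite mulrCA mulfV ?gt_eqF// mulr1 le_max => H'.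
rewrite H'//.
- by move=> tau taus; apply: xR; exact: sc.
- move=> tau tau' ts1 ts2; apply: le_trans (lip _ _ (sc _ ts1) (sc _ ts2)) _.
  rewrite -mulrBr normrM gtr0_norm// mulrA ler_wpM2r//.
  by rewrite mulrC ltW// -ltr_pdivlMr.
- have /andP[t0' ts'] := ts; rewrite divr_ge0 ?(ltW e0)//=.
  by rewrite ler_pM2r// invr_gt0.
Qed.

Lemma vf_bounded (r : R) : exists M : R, forall p x y, `|x| <= r -> `|y| <= r ->
  `|vf (p : P) x y| <= M.
Proof.
have Kc : compact ([set: P] `*` [set x : X | `|x| <= r] `*` [set y : Y | `|y| <= r]).
  by do 2 (apply: compact_setX; last exact: compact_closed_ball0); exact: base_compact.
have := @continuous_compact _ _ (fun q : P * X * Y => vf q.1.1 q.1.2 q.2) _ _ Kc.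
move=> /(_ _)/wrap[]; first by apply: continuous_subspaceT; exact: vf_cont.
move=> /compact_bounded[M [_ HM]]; exists (M + 1) => p x y xr yr.
apply: (HM (M + 1)); first by rewrite ltrDl.
by exists (p, x, y).
Qed.

(** Retracting both components onto balls larger by 1 than the a priori bounds gives a bounded
    continuous field, whose solutions extend to [[0, t0]]. It remains to see that the retractions
    never act on the extended solution. *)
Lemma sf_extend (x0 : X) (y0 : Y) (t0 : R) : 0 < t0 -> exists2 e1 : R, 0 < e1 &
  forall e J x y, 0 < e < e1 -> is_interval J -> J 0 -> J `<=` `[0, +oo[ ->
    x 0 = x0 -> y 0 = y0 -> sf_solution e J x y ->
    exists u v, [/\ sf_solution e `[0, t0] u v, u 0 = x0, v 0 = y0 &
      forall t, J t -> t <= t0 -> u t = x t /\ v t = y t].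
Proof.
move=> t00; have [M [e1 [M0 e10 Hap]]] := sf_apriori x0 y0 t00.
exists e1 => // e J x y ee1 Ji J0 Jpos x0E y0E sf.
have /andP[e0 _] := ee1.
pose R0 := slow_radius x0 t0; have R00 : 0 <= R0 by apply: slow_radius_ge0; exact: ltW.
have R10 : 0 < R0 + 1 by rewrite ltr_wpDl.
have M10 : 0 < M + 1 by rewrite ltr_wpDl.
pose rx := @retract R n (R0 + 1); pose ry := @retract R m (M + 1).
pose F (t : R) (q : X * Y) : X * Y :=
  (f (rx q.1, ry q.2), e^-1 *: vf (flow (t / e) (base0 S)) (rx q.1) (ry q.2)).
have Fc : continuous (fun q : R * (X * Y) => F q.1 q.2).
  move=> q.
  have c1 : {for q, continuous (fun q : R * (X * Y) => rx q.2.1)}.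
    by apply: (comp_continuous_at (h := rx)); [exact: retract_continuous|exact: fst_snd_continuous_at].
  have c2 : {for q, continuous (fun q : R * (X * Y) => ry q.2.2)}.
    by apply: (comp_continuous_at (h := ry)); [exact: retract_continuous|exact: snd_snd_continuous_at].
  have c3 : {for q, continuous (fun q : R * (X * Y) => flow (q.1 / e) (base0 S))}.
    have c0 : {for q, continuous (fun q : R * (X * Y) => q.1 / e)}.
      by apply: (@comp_continuous_at _ _ _ (fun z : R => z / e) fst); [exact: mulrr_continuous|exact: fst_continuous_at].
    exact: (@comp2_continuous_at _ _ _ _ (fun z : R * P => flow z.1 z.2) (fun q : R * (X * Y) => q.1 / e)
      (fun=> base0 S) q (@flow_cont _ _ _ S) c0 (@cst_continuous_at _ _ _ _)).
  have c4 := @comp2_continuous_at _ _ _ _ f (fun q : R * (X * Y) => rx q.2.1) (fun q => ry q.2.2) q fc c1 c2.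
  have c5 := @pair_continuous_at _ _ _ (fun q : R * (X * Y) => flow (q.1 / e) (base0 S))
    (fun q : R * (X * Y) => rx q.2.1) q c3 c1.
  have c6 := @comp2_continuous_at _ _ _ _ (fun z : P * X * Y => vf z.1.1 z.1.2 z.2)
    (fun q : R * (X * Y) => (flow (q.1 / e) (base0 S), rx q.2.1)) (fun q => ry q.2.2) q
    (@vf_cont _ _ _ S) c5 c2.
  have c7 := @comp_continuous_at _ _ _ (fun v : Y => e^-1 *: v) _ q (@scaler_continuous _ _ _) c6.
  exact: (@pair_continuous_at _ _ _ _ _ q c4 c7).
have [MF FM] : exists MF : R, forall t q, `|F t q| <= MF.
  have [M1 HM1] := vf_bounded (Num.max (R0 + 1) (M + 1)).
  exists (Num.max (a + b * (R0 + 1)) (e^-1 * M1)) => t q.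
  rewrite prod_normE /= ge_max !le_max; apply/andP; split; apply/orP; [left|right].
    apply: le_trans (f_growth _ _) _; rewrite lerD2l ler_pM2l//.
    exact: (retract_norm q.1 R10).1.
  rewrite normrZ gtr0_norm ?invr_gt0// ler_pM2l ?invr_gt0//; apply: HM1.
    by rewrite le_max (retract_norm q.1 R10).1.
  by rewrite le_max (retract_norm q.2 M10).1 orbT.
have Jsub t s : J t -> 0 <= s <= t -> J s by move=> Jt st; apply: (Ji 0 t).
have Jge t : J t -> 0 <= t by move=> /Jpos /=; rewrite in_itv/= andbT.
have apJ t : J t -> t <= t0 -> `|x t| <= R0 /\ `|y t| <= M.
  move=> Jt tt0; have t0' := Jge t Jt.
  have sft : sf_solution e `[0, t] x y.
    by apply: sf_solutionS sf => s /=; rewrite in_itv/=; exact: Jsub.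
  have := Hap e t x y ee1 _ x0E y0E sft t; rewrite t0' tt0 lexx => /(_ isT isT).
  by case.
have [|w [wE dw_w]] := @ode_extend R _ (@closed_ball_compact R n m) F MF Fc FM J
  (fun t => (x t, y t)) t0 Ji J0 Jpos (ltW t00).
  move=> t Jt tt0; have [xt yt] := apJ t Jt tt0.
  have -> : F t (x t, y t) = (f (x t, y t), e^-1 *: vf (flow (t / e) (base0 S)) (x t) (y t)).
    rewrite /F /= /rx /ry !retract_id//; first by rewrite (le_trans yt)// lerDl.
    by rewrite (le_trans xt)// lerDl.
  by have [h1 h2] := sf t Jt; exact: dw_pair.
pose u t := (w t).1; pose v t := (w t).2.
have wJ t : J t -> t <= t0 -> u t = x t /\ v t = y t.
  by move=> Jt tt0; rewrite /u /v wE.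
have [u0 v0] := wJ 0 J0 (ltW t00).
rewrite x0E in u0; rewrite y0E in v0.
have uR : forall t, 0 <= t <= t0 -> `|u t| <= R0.
  (* Retractions do not increase the norm, so the slow bound holds for the retracted equation
     directly. *)
  apply: (@slow_bound x0 t0 t0 u (fun t => f (rx (u t), ry (v t)))) => //.
  - by rewrite (ltW t00) lexx.
  - by move=> t tt0; exact: (dw_fst (dw_w t tt0)).
  - move=> t tt0; apply: le_trans (f_growth _ _) _; rewrite lerD2l ler_pM2l//.
    exact: (retract_norm (u t) R10).2.
have sol_upto s : 0 <= s <= t0 -> (forall t, 0 <= t <= s -> `|v t| <= M + 1) ->
    sf_solution e `[0, s] u v.
  move=> /andP[s0 st0] vM t; rewrite /= in_itv /= => ts.
  have /andP[t0' ts'] := ts.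
  have tt0 : 0 <= t <= t0 by rewrite t0' (le_trans ts').
  have H : dw `[0, s] w t (F t (w t)).
    apply: dwS (dw_w t tt0) => z /=; rewrite !in_itv/= => /andP[-> zs].
    exact: le_trans zs _.
  have E : F t (w t) = (f (u t, v t), e^-1 *: vf (flow (t / e) (base0 S)) (u t) (v t)).
    rewrite /F /= /rx /ry !retract_id//; first exact: vM.
    by rewrite (le_trans (uR t tt0))// lerDl.
  by rewrite E in H; split; [exact: (dw_fst H)|exact: (dw_snd H)].
have vc t : 0 <= t <= t0 -> exists2 d : R, 0 < d & forall s, 0 <= s <= t0 -> `|s - t| < d ->
    `|v s - v t| <= 1.
  move=> tt0; have [d d0 H] := dw_cont (dw_snd (dw_w t tt0)) ltr01.
  by exists d => // s st0; apply: H; rewrite /= in_itv.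
(* While [v] stays within [M + 1] the pair solves the original system, and the a priori bound
   improves this to [M]; continuity keeps [v] inside the gap of 1 at each step of the induction. *)
have vM : forall t, 0 <= t <= t0 -> `|v t| <= M.
  apply: (@real_induction R 0 t0 (fun t => `|v t| <= M)) => t.
  - move=> tt0 IH; have /andP[t0' tt0'] := tt0.
    have [|tpos] := leP t 0.
      move=> tle; have -> : t = 0 by apply/eqP; rewrite eq_le tle t0'.
      rewrite v0; have := Hap e 0 x y ee1 _ x0E y0E _ 0.
      rewrite lexx (ltW t00) => /(_ isT _ isT)/wrap[]; last by case=> _; rewrite y0E.
      by apply: sf_solutionS sf => s /=; rewrite in_itv/=; exact: Jsub.
    have vM1 : `|v t| <= M + 1.
      have [d d0 Hd] := vc t tt0.
      pose s := Num.max 0 (t - d / 2).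
      have s0 : 0 <= s by rewrite le_max lexx.
      have st : s < t by rewrite gt_max tpos/=; lra.
      have sd : `|s - t| < d.
        have : t - d / 2 <= s by rewrite le_max lexx orbT.
        rewrite ltr0_norm ?subr_lt0//; lra.
      have h := Hd s _ sd; rewrite s0 (le_trans (ltW st)) in h; last by [].
      have {}h := h isT; have hs : `|v s| <= M by apply: IH; rewrite s0.
      rewrite -(subKr (v s) (v t)) (le_trans (ler_normB _ _))//; exact: lerD.
    have sfu : sf_solution e `[0, t] u v.
      apply: sol_upto => // s /andP[s0]; rewrite le_eqVlt => /predU1P[->//|st].
      by apply: (@le_trans _ _ M); [apply: IH; rewrite s0|rewrite lerDl].
    have := Hap e t u v ee1 tt0 u0 v0 sfu t; rewrite t0' lexx => /(_ isT).
    by case.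
  - move=> /andP[t0' tt0'] IH.
    have tt0 : 0 <= t <= t0 by rewrite t0' ltW.
    have [d d0 Hd] := vc t tt0.
    exists d => // s /andP[ts sd] st0.
    have s0 : 0 <= s by rewrite (le_trans t0')// ltW.
    have sfu : sf_solution e `[0, s] u v.
      apply: sol_upto; first by rewrite s0.
      move=> r /andP[r0 rs]; have [rt|tr] := leP r t.
        by apply: (@le_trans _ _ M); [apply: IH; rewrite r0|rewrite lerDl].
      have h : `|v r - v t| <= 1.
        apply: Hd; first by rewrite r0 (le_trans rs).
        by rewrite gtr0_norm ?subr_gt0//; lra.
      have ht : `|v t| <= M by apply: IH; rewrite t0' lexx.
      rewrite -(subrK (v t) (v r)) addrC (le_trans (ler_normD _ _))//; exact: lerD.
    have := Hap e s u v ee1 _ u0 v0 sfu s; rewrite s0 st0 lexx => /(_ isT isT).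
    by case.
exists u, v; split => //.
apply: sol_upto; first by rewrite (ltW t00) lexx.
by move=> t tt0; rewrite (le_trans (vM t tt0))// lerDl.
Qed.

Lemma tracking (r rho T eta : R) : 0 <= T -> 0 < eta -> exists2 e1 : R, 0 < e1 &
  forall (p : P) xb (Xf : R -> X) (v : R -> Y), `|xb| <= r -> `|v 0| <= rho ->
  (forall t, 0 <= t <= T -> dw `[0, T] v t (vf (flow t p) (Xf t) (v t))) ->
  (forall t, 0 <= t <= T -> `|xb - Xf t| <= e1) ->
  forall t, 0 <= t <= T -> `|v t - sol p xb (v 0) t| <= eta.
Proof.
move=> T0 eta0; have [M HM] := sol_bounded S (Num.max r rho) T0.
have [e1 e10 H] := perturb S (Num.max M r) T0 eta0.
exists e1 => // p xb Xf v xr vr dv xX t tT.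
apply: (H p p xb (sol p xb (v 0)) v Xf T) => //.
- by rewrite T0 lexx.
- by rewrite le_max xr orbT.
- by move=> z; exact: sol_dw.
- move=> z zT; rewrite le_max HM//.
  + by rewrite le_max xr.
  + by rewrite le_max vr orbT.
- exact: ballxx.
- by rewrite sol0 subrr normr0 ltW.
Qed.

End SlowFast.

(** * Probabilities from averages along an ultrafilter *)

Section PseudoMetricSeparation.
Context {R : realType} {T : pseudoMetricType R}.

Lemma compact_ball_sub (C U : set T) : compact C -> open U -> C `<=` U ->
  exists2 e : R, 0 < e & forall x y, C x -> ball x e y -> U y.
Proof.
move=> /compact_near_coveringP Cc oU CU.
have := Cc R (0^'+) (fun e x => forall y, ball x e y -> U y).
move=> /(_ _)[].
  move=> x Cx; have /nbhs_ballP[r /= r0 rU] := open_nbhs_nbhs (conj oU (CU x Cx)).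
  have r20 : 0 < r / 2 by rewrite divr_gt0.
  exists (ball x (r / 2), [set d : R | 0 < d < r / 2]).
    split; first exact: nbhsx_ballx.
    by near=> d => /=; apply/andP; split; near: d; [exact: nbhs_right_gt|exact: nbhs_right_lt].
  move=> [y d] [/= xy /andP[d0 dr]] z yz; apply: rU.
  by rewrite [r]splitr; apply: ball_triangle xy _; apply: le_ball yz; exact: ltW.
move=> r /= r0 H; exists (r / 2); first by rewrite divr_gt0.
move=> x y Cx; apply: H => //=; last by rewrite divr_gt0.
by rewrite sub0r normrN gtr0_norm ?divr_gt0//; lra.
Unshelve. all: end_near. Qed.

Lemma urysohn_compact (C F : set T) : compact C -> closed F -> C `&` F = set0 ->
  exists phi : T -> R, [/\ continuous phi, forall x, 0 <= phi x <= 1,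
    forall x, F x -> phi x = 0 & forall x, C x -> phi x = 1].
Proof.
move=> Cc Fc CF.
have CnF : C `<=` ~` F by move=> x Cx Fx; rewrite -[False]/(set0 x) -CF.
have [e e0 He] := compact_ball_sub Cc (closed_openC Fc) CnF.
have sep : uniform_separator F C.
  apply: uniform_separatorW; exists [set xy | ball xy.1 e xy.2].
    exact: entourage_ball (PosNum e0).
  rewrite -subset0 => -[x y] [/= [Fx Cy] xy].
  by apply: (He y x Cy) => //; exact: ball_sym.
exists (Urysohn F C); split.
- exact: Urysohn_continuous.
- move=> x; have := @Urysohn_range T R F C (Urysohn F C x).
  by rewrite /= in_itv/=; apply; exists x.
- by move=> x Fx; apply: (@Urysohn_sub0 _ R _ _ sep); exists x.
- by move=> x Cx; apply: (@Urysohn_sub1 _ R _ _ sep); exists x.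
Qed.

(** The part of [C] outside [V] is compact in [U], so a whole [e]-neighbourhood of it lies in [U].
    Cutting [C] along the [e / 2]-neighbourhood leaves closed pieces on both sides; this is what
    makes [lam] subadditive. *)
Lemma closed_split (C U V : set T) : compact C -> closed C -> open U -> open V ->
  C `<=` U `|` V -> exists C1 C2, [/\ closed C1, closed C2,
    C1 `<=` U, C2 `<=` V & C = C1 `|` C2].
Proof.
move=> Cc Ccl oU oV CUV.
have C1c : compact (C `\` V).
  apply: subclosed_compact Cc _; last by move=> x [].
  by apply: closedI => //; exact: open_closedC.
have C1U : C `\` V `<=` U by move=> x [/CUV[]].
have [e e0 He] := compact_ball_sub C1c oU C1U.
have e20 : 0 < e / 2 by rewrite divr_gt0.
pose O := [set y | exists2 x, (C `\` V) x & ball x (e / 2) y].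
exists (C `&` closure O), (C `\` O°); split.
- by apply: closedI => //; exact: closed_closure.
- by apply: closedI => //; apply: open_closedC; exact: open_interior.
- move=> y [_ /(_ (ball y (e / 2)) (nbhsx_ballx _ _ e20))[z [[x Dx xz] yz]]].
  apply: (He x) => //; rewrite [e]splitr; apply: ball_triangle xz _.
  exact: ball_sym.
- move=> y [Cy nO]; apply: contrapT => nVy; apply: nO.
  apply/nbhs_ballP; exists (e / 2) => //= z yz.
  by exists y.
- rewrite -setIUr; apply/seteqP; split => [x Cx|x []//]; split => //.
  have [Ox|] := pselect (O° x); last by right.
  by left; apply: subset_closure; exact: interior_subset.
Qed.

End PseudoMetricSeparation.

(* A finitely additive probability [m] on all subsets of [T], carried by a
   compact set, induces a Borel probability through
   [lam U = sup {m C | C closed, C `<=` U}] on open sets. *)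
Section FinitelyAdditive.
Context {R : realType} {T : pseudoPMetricType R}.
Variables (m : set T -> R) (K : set T).
Hypothesis m_ge0 : forall A, 0 <= m A.
Hypothesis mU : forall A B, A `&` B = set0 -> m (A `|` B) = m A + m B.
Hypothesis mT : m setT = 1.
Hypothesis Kc : compact K.
Hypothesis Kcl : closed K.
Hypothesis mK : m (~` K) = 0.

Let m0 : m set0 = 0.
Proof.
have := mU (setI0 (@set0 T)).
by rewrite setU0 -{1}[m set0]addr0 => /addrI.
Qed.

Let le_m A B : A `<=` B -> m A <= m B.
Proof.
by move=> AB; rewrite -(setDUK AB) mU ?setDIK// lerDl.
Qed.

Let mU2 A B : m (A `|` B) <= m A + m B.
Proof.
have -> : A `|` B = A `|` (B `\` A) by apply/seteqP; split => x; [move=> [|]; [left|have [|] := pselect (A x); [left|right]]|move=> [|[]]; [left|right]].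
by rewrite mU ?setDIK// lerD2l le_m// => x [].
Qed.

Let mIK A : m A = m (A `&` K).
Proof.
rewrite -{1}(setUIDK A K) mU ?setDIK//; last first.
  by rewrite -subset0 => x [[_ Kx] [_ /(_ Kx)]].
rewrite [m (A `\` K)](_ : _ = 0) ?addr0//.
by apply/eqP; rewrite eq_le m_ge0 andbT -mK le_m// => x [].
Qed.

Let lam (U : set T) : R := sup [set m C | C in [set C | closed C /\ C `<=` U]].

Let lam_has_sup U : has_sup [set m C | C in [set C | closed C /\ C `<=` U]].
Proof.
split; first by exists (m set0), set0 => //; split => //; exact: closed0.
by exists 1 => _ [C _ <-]; rewrite -mT le_m.
Qed.

Let lam_ub U C : closed C -> C `<=` U -> m C <= lam U.
Proof. by move=> Cc CU; apply: ub_le_sup; [exact: (lam_has_sup U).2|exists C]. Qed.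

Let lam_le U x : (forall C, closed C -> C `<=` U -> m C <= x) -> lam U <= x.
Proof.
move=> H; apply: ge_sup; first exact: (lam_has_sup U).1.
by move=> _ [C [Cc CU] <-]; exact: H.
Qed.

Let lam_adh U e : 0 < e -> exists C, [/\ closed C, C `<=` U & lam U - e < m C].
Proof.
by move=> e0; have [_ [C [Cc CU] <-] h] := sup_adherent e0 (lam_has_sup U); exists C.
Qed.

Let lam_ge0 U : 0 <= lam U.
Proof. by apply: le_trans (lam_ub (@closed0 T) (@sub0set _ U)). Qed.

Let lam_mono U V : U `<=` V -> lam U <= lam V.
Proof. by move=> UV; apply: lam_le => C Cc CU; apply: lam_ub => // x /CU/UV. Qed.

Let lam0 : lam set0 = 0.
Proof.
apply/eqP; rewrite eq_le lam_ge0 andbT; apply: lam_le => C _.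
by rewrite subset0 => ->; rewrite m0.
Qed.

Let lamT : lam setT = 1.
Proof.
have h : m setT <= lam setT by apply: lam_ub => //; exact: closedT.
apply/eqP; rewrite eq_le -{2}mT h andbT.
by apply: lam_le => C _ _; rewrite -mT le_m.
Qed.

Let lamU2 U V : open U -> open V -> lam (U `|` V) <= lam U + lam V.
Proof.
move=> oU oV; apply: lam_le => C Cc CUV; rewrite mIK.
have CKcl : closed (C `&` K) by exact: closedI.
have CKc : compact (C `&` K) by apply: subclosed_compact Kc _ => // x [].
have [|C1 [C2 [c1 c2 C1U C2V ->]]] := closed_split CKc CKcl oU oV.
  by move=> x [/CUV].
by apply: le_trans (mU2 _ _) _; rewrite lerD// lam_ub.
Qed.

Let open_bigU (U : (set T)^nat) n : (forall i, open (U i)) ->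
  open (\big[setU/set0]_(i < n) U i).
Proof.
by move=> oU; rewrite -bigcup_mkord; apply: bigcup_open => i _.
Qed.

Let lam_bigU (U : (set T)^nat) n : (forall i, open (U i)) ->
  lam (\big[setU/set0]_(i < n) U i) <= \sum_(i < n) lam (U i).
Proof.
move=> oU; elim: n => [|n IH]; first by rewrite !big_ord0 lam0.
rewrite !big_ord_recr/=; apply: le_trans (lamU2 _ (oU n)) _; first exact: open_bigU.
by rewrite lerD2r.
Qed.

(** Although [m] is only finitely additive, compactness of [C] inside [K] reduces the countable
    cover to a finite one. *)
Let lam_bigcup (U : (set T)^nat) x : (forall i, open (U i)) ->
  (forall n, \sum_(i < n) lam (U i) <= x) -> lam (\bigcup_i U i) <= x.
Proof.
move=> oU Hx; apply: lam_le => C Cc CU; rewrite mIK.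
have CKcl : closed (C `&` K) by exact: closedI.
have CKc : compact (C `&` K) by apply: subclosed_compact Kc _ => // x0 [].
suff [n Hn] : exists n, C `&` K `<=` \big[setU/set0]_(i < n) U i.
  apply: le_trans (Hx n); apply: le_trans (lam_bigU n oU).
  exact: lam_ub.
have := (compact_near_coveringP _).1 CKc nat \oo
  (fun n x => (\big[setU/set0]_(i < n) U i) x).
move=> /(_ _)[].
  move=> y [/CU[i _ Uiy] _].
  exists (U i, [set n | (i < n)%N]) => /=.
    split; first exact: open_nbhs_nbhs.
    by exists i.+1 => // n.
  by move=> [z n] [/= Uiz ltin]; rewrite -bigcup_mkord; exists i.
by move=> n _ Hn; exists n; exact: Hn (leqnn n).
Qed.

Definition fa_outer (A : set T) : \bar R :=
  ereal_inf [set (lam U)%:E | U in [set U | open U /\ A `<=` U]].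

Local Notation nu := fa_outer.

Let nu_lb A U : open U -> A `<=` U -> (nu A <= (lam U)%:E)%E.
Proof. by move=> oU AU; apply: ereal_inf_lbound; exists U. Qed.

Let nu_ge A x : (forall U, open U -> A `<=` U -> (x <= (lam U)%:E)%E) -> (x <= nu A)%E.
Proof. by move=> H; apply: le_ereal_inf_tmp => _ [U [oU AU] <-]; exact: H. Qed.

Let nu_open U : open U -> nu U = (lam U)%:E.
Proof.
move=> oU; apply/eqP; rewrite eq_le nu_lb//=.
by apply: nu_ge => V oV UV; rewrite lee_fin lam_mono.
Qed.

Let nu_ge0 A : (0 <= nu A)%E.
Proof. by apply: nu_ge => U _ _; rewrite lee_fin. Qed.

Let nu_mono : {homo nu : A B / A `<=` B >-> (A <= B)%E}.
Proof. by move=> A B AB; apply: nu_ge => U oU BU; apply: nu_lb => // x /AB/BU. Qed.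

Let nu0 : nu set0 = 0%E.
Proof. by rewrite nu_open ?lam0//; exact: open0. Qed.

Let nu_le1 A : (nu A <= 1)%E.
Proof. by rewrite -[1%E]/(1%:E) -lamT; apply: nu_lb => //; exact: openT. Qed.

Let nu_fin A : nu A \is a fin_num.
Proof. by rewrite ge0_fin_numE//; apply: le_lt_trans (nu_le1 A) _; exact: ltry. Qed.

Let nu_adh A e : 0 < e -> exists U, [/\ open U, A `<=` U & ((lam U)%:E <= nu A + e%:E)%E].
Proof.
move=> e0.
have [_ [U [oU AU] <-] h] := lb_ereal_inf_adherent e0 (nu_fin A).
by exists U; split => //; exact: ltW.
Qed.

Let nu_subadd : sigma_subadditive nu.
Proof.
move=> F; apply/lee_addgt0Pr => e e0.
have : forall n, exists U, [/\ open U, F n `<=` U &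
    ((lam U)%:E <= nu (F n) + (e / (2 ^ n.+1)%:R)%:E)%E].
  by move=> n; apply: nu_adh; rewrite divr_gt0// ltr0n expn_gt0.
move=> /choice[U HU].
have oU n : open (U n) by have [] := HU n.
apply: (@le_trans _ _ (lam (\bigcup_n U n))%:E).
  apply: nu_lb; first by apply: bigcup_open => i _.
  by apply: subset_bigcup => n _; have [] := HU n.
have Ht := epsilon_trick xpredT (fun n => nu_ge0 (F n)) (ltW e0).
apply: le_trans Ht.
set S := (X in (_ <= X)%E).
have S0 n : (\sum_(i < n) (lam (U i))%:E <= S)%E.
  apply: (@le_trans _ _ (\sum_(i < n) (nu (F i) + (e / (2 ^ i.+1)%:R)%:E))%E).
    by apply: lee_sum => i _; have [] := HU i.
  rewrite -(big_mkord xpredT (fun i => (nu (F i) + (e / (2 ^ i.+1)%:R)%:E)%E)).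
  by apply: nneseries_lim_ge => i _ _; rewrite adde_ge0// lee_fin divr_ge0// ltW.
have [->|] := eqVneq S +oo%E; first exact: leey.
move=> Sy; have Sf : S \is a fin_num.
  rewrite ge0_fin_numE ?ltey//.
  by have := S0 0%N; rewrite big_ord0.
rewrite -(fineK Sf) lee_fin; apply: lam_bigcup => // n.
by have := S0 n; rewrite sumEFin -(fineK Sf) lee_fin.
Qed.

HB.instance Definition _ := isOuterMeasure.Build R T nu nu0 nu_ge0 nu_mono nu_subadd.

(** An open [V] around the test set is divided by a closed [C] inside both [V] and [U] that nearly
    exhausts their intersection. Additivity of [m] on closed sets disjoint from [C] yields
    [lam (V \ C) <= lam V - m C]. *)
Let open_caratheodory U : open U -> nu.-caratheodory U.
Proof.
move=> oU; apply: le_caratheodory_measurable => X /=; apply: nu_ge => V oV XV.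
apply/lee_addgt0Pr => e e0.
have [C [Cc CVU hC]] := lam_adh (V `&` U) e0.
have oVC : open (V `\` C) by rewrite setDE; apply: openI => //; exact: closed_openC.
have h1 : (nu (X `&` U) <= (lam (V `&` U))%:E)%E.
  by apply: nu_lb; [exact: openI|move=> x [/XV]].
have h2 : (nu (X `&` ~` U) <= (lam (V `\` C))%:E)%E.
  by apply: nu_lb => // x [/XV Vx nUx]; split => // /CVU[].
have h3 : lam (V `\` C) <= lam V - m C.
  apply: lam_le => D Dc DVC; rewrite lerBrDr -mU; last first.
    by rewrite -subset0 => x [/DVC[]].
  apply: lam_ub; first exact: closedU.
  by move=> x [/DVC[]|/CVU[]].
apply: le_trans (leeD h1 h2) _; rewrite -!EFinD lee_fin; lra.
Qed.

Definition fa_measure : set (borel T) -> \bar R := nu.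

Let borel_caratheodory (A : set (borel T)) : measurable A -> nu.-caratheodory A.
Proof.
(* A Borel set belongs to every sigma-algebra containing the open sets, in particular to that of the
   Caratheodory measurable sets. *)
move=> mA; apply: mA; split; last by move=> U oU; exact: open_caratheodory.
split.
- exact: caratheodory_measurable_set0.
- by move=> B cB; rewrite setTD; exact: caratheodory_measurable_setC.
- by move=> F cF; exact: caratheodory_measurable_bigcup.
Qed.

Let fa_sigma_additive : semi_sigma_additive fa_measure.
Proof.
move=> F mF tF mUF.
apply: (@caratheodory_measure_sigma_additive R T nu F) => //.
  by move=> i; exact: borel_caratheodory.
exact: borel_caratheodory.
Qed.

HB.instance Definition _ := isMeasure.Build _ (borel T) R fa_measure
  nu0 nu_ge0 fa_sigma_additive.

Let fa_measureT : fa_measure setT = 1%E.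
Proof. by rewrite /fa_measure nu_open ?lamT//; exact: openT. Qed.

HB.instance Definition _ := Measure_isProbability.Build _ (borel T) R fa_measure fa_measureT.

(** On an open set [p] may be strictly smaller than [m]. The second clause bounds [p] through the
    values of [m] on compact subsets; null sets and invariance are derived from it. *)
Lemma finitely_additive_to_borel : exists p : probability (borel T) R,
  (forall U : set T, open U -> (p U <= (m U)%:E)%E) /\
  (forall (U : set T) (r : R), open U ->
    (forall C, compact C -> closed C -> C `<=` U -> C `<=` K -> m C <= r) ->
    (p U <= r%:E)%E).
Proof.
exists fa_measure; split => [U oU|U r oU H]; rewrite [X in (X <= _)%E]nu_open// lee_fin.
  by apply: lam_le => C _ CU; exact: le_m.
apply: lam_le => C Cc CU; rewrite mIK.
apply: H; last by move=> x [].
- by apply: subclosed_compact Kc _; [exact: closedI|move=> x []].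
- exact: closedI.
- by move=> x [/CU].
Qed.

End FinitelyAdditive.

Section Averages.
Context {R : realType} {T : Type}.
Variables (N_ : nat -> nat) (pt : nat -> nat -> T).
Hypothesis N_gt0 : forall j, (0 < N_ j)%N.

Definition avg (phi : T -> R) (j : nat) : R :=
  (\sum_(i < N_ j) phi (pt j i)) / (N_ j)%:R.

Definition sample_bounded (phi : T -> R) :=
  exists B : R, forall j i, (i < N_ j)%N -> `|phi (pt j i)| <= B.

Lemma le_avg (phi psi : T -> R) j :
  (forall i, (i < N_ j)%N -> phi (pt j i) <= psi (pt j i)) ->
  avg phi j <= avg psi j.
Proof.
move=> H; rewrite /avg ler_pM2r ?invr_gt0 ?ltr0n//.
by apply: ler_sum => i _; exact: H.
Qed.

Lemma avg_cst (c : R) j : avg (fun=> c) j = c.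
Proof.
by rewrite /avg sumr_const card_ord -[c *+ _]mulr_natr mulfK// pnatr_eq0 -lt0n.
Qed.

Lemma avgD (phi psi : T -> R) j :
  avg (fun x => phi x + psi x) j = avg phi j + avg psi j.
Proof. by rewrite /avg big_split mulrDl. Qed.

Lemma avgZ (c : R) (phi : T -> R) j : avg (fun x => c * phi x) j = c * avg phi j.
Proof. by rewrite /avg -mulr_sumr mulrA. Qed.

Lemma avg_norm_le (phi : T -> R) (B : R) j :
  (forall i, (i < N_ j)%N -> `|phi (pt j i)| <= B) -> `|avg phi j| <= B.
Proof.
move=> H; rewrite ler_norml -{1}(avg_cst (- B) j) -{2}(avg_cst B j).
by rewrite !le_avg// => i /H; rewrite ler_norml => /andP[].
Qed.

Variable U : set_system nat.
Context {UU : UltraFilter U}.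

(** Along an ultrafilter this limit exists for every bounded function, measurable or not, so [mean]
    is linear on all of them and gives a mass to every subset. *)
Definition mean (phi : T -> R) : R := lim (avg phi @ U).

Lemma mean_cvg phi : sample_bounded phi -> avg phi @ U --> mean phi.
Proof.
move=> [B HB].
have UF := ultra_fmap (avg phi) UU.
have := @segment_compact R (- B) B; rewrite compact_ultra => /(_ _ UF)[].
  suff : U [set j | `[- B, B]%classic (avg phi j)] by [].
  apply: filterE => j; rewrite /= in_itv/= -ler_norml.
  exact: avg_norm_le (HB j).
by move=> l [_ Hl]; apply: cvgP Hl.
Qed.

Lemma mean_unique phi l : avg phi @ U --> l -> mean phi = l.
Proof. by move=> H; apply/cvg_lim. Qed.

Lemma sample_boundedD phi psi : sample_bounded phi -> sample_bounded psi ->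
  sample_bounded (fun x => phi x + psi x).
Proof.
move=> [B HB] [C HC]; exists (B + C) => j i ij.
by rewrite (le_trans (ler_normD _ _))// lerD ?HB ?HC.
Qed.

Lemma sample_boundedZ c phi : sample_bounded phi -> sample_bounded (fun x => c * phi x).
Proof.
by move=> [B HB]; exists (`|c| * B) => j i ij; rewrite normrM ler_wpM2l// HB.
Qed.

Lemma sample_bounded_cst c : sample_bounded (fun=> c).
Proof. by exists `|c|. Qed.

Lemma meanD phi psi : sample_bounded phi -> sample_bounded psi ->
  mean (fun x => phi x + psi x) = mean phi + mean psi.
Proof.
move=> b1 b2; apply: mean_unique.
rewrite (_ : avg _ = (fun j => avg phi j + avg psi j)); last by apply/funext => j; rewrite avgD.
by apply: cvgD; exact: mean_cvg.
Qed.

Lemma meanZ c phi : sample_bounded phi -> mean (fun x => c * phi x) = c * mean phi.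
Proof.
move=> b1; apply: mean_unique.
rewrite (_ : avg _ = (fun j => c * avg phi j)); last by apply/funext => j; rewrite avgZ.
by apply: cvgMr => //; exact: mean_cvg.
Qed.

Lemma mean_cst c : mean (fun=> c) = c.
Proof.
apply: mean_unique; rewrite (_ : avg _ = cst c); first exact: cvg_cst.
by apply/funext => j; rewrite avg_cst.
Qed.

Lemma le_mean phi psi : sample_bounded phi -> sample_bounded psi ->
  (forall j i, (i < N_ j)%N -> phi (pt j i) <= psi (pt j i)) -> mean phi <= mean psi.
Proof.
move=> b1 b2 H; apply: ler_cvg_to (mean_cvg b1) (mean_cvg b2) _.
by apply: nearW => j; apply: le_avg => i; exact: H.
Qed.

Lemma sample_bounded_indic (A : set T) : sample_bounded \1_A.
Proof. by exists 1 => j i _; rewrite indicE; case: (_ \in _); rewrite ?normr1 ?normr0. Qed.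

Definition mass (A : set T) : R := mean \1_A.

Lemma mass_ge0 A : 0 <= mass A.
Proof.
rewrite -(mean_cst 0); apply: le_mean; [exact: sample_bounded_cst|exact: sample_bounded_indic|].
by move=> j i _; rewrite indicE.
Qed.

Lemma massU A B : A `&` B = set0 -> mass (A `|` B) = mass A + mass B.
Proof.
move=> AB; rewrite /mass -meanD; [|exact: sample_bounded_indic..].
congr (lim (avg _ @ U)); apply/funext => x.
rewrite !indicE in_setU.
have [Ax|] := boolP (x \in A); have [Bx|] := boolP (x \in B); rewrite ?addr0 ?add0r//.
have : set0 x by rewrite -AB; split; exact/set_mem.
by [].
Qed.

Lemma massT : mass setT = 1.
Proof. by rewrite -(mean_cst 1) /mass; congr mean; apply/funext => x; rewrite indicE in_setT. Qed.

Lemma mass_sum n (A : nat -> set T) :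
  sample_bounded (fun x => \sum_(i < n) \1_(A i) x : R) /\
  mean (fun x => \sum_(i < n) \1_(A i) x) = \sum_(i < n) mass (A i).
Proof.
elim: n => [|n [bn IH]].
  rewrite big_ord0 (_ : (fun x => _) = fun=> 0); last by apply/funext => x; rewrite big_ord0.
  by split; [exact: sample_bounded_cst|exact: mean_cst].
rewrite (_ : (fun x => _) = (fun x => \sum_(i < n) \1_(A i) x + \1_(A n) x)); last first.
  by apply/funext => x; rewrite big_ord_recr.
rewrite big_ord_recr /= -IH; split.
  by apply: sample_boundedD => //; exact: sample_bounded_indic.
by rewrite meanD//; exact: sample_bounded_indic.
Qed.

End Averages.

Section LayerCake.
Context {R : realType}.

(** The sum counts the integers among 1, ..., n lying strictly below [y]. With the next lemma it
    approximates [y] from below to within 1 when [y <= n], which is the layer cake formula used for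
    integrals. *)
Lemma step_count_le n (y : R) : 0 <= y ->
  \sum_(i < n) (i.+1%:R < y)%R%:R <= y /\ \sum_(i < n) (i.+1%:R < y)%R%:R <= n%:R :> R.
Proof.
move=> y0; elim: n => [|n [IH1 IH2]]; first by rewrite big_ord0.
rewrite big_ord_recr /=; have [ny|_] := ltP; last first.
  by rewrite addr0; split => //; rewrite (le_trans IH2)// ler_nat.
rewrite -natr1 in ny; rewrite -natr1 (_ : (true : nat)%:R = 1 :> R)//.
by split; lra.
Qed.

Lemma step_count_ge n (y : R) :
  Num.min y n.+1%:R <= 1 + \sum_(i < n) (i.+1%:R < y)%R%:R :> R.
Proof.
elim: n => [|n IH]; first by rewrite big_ord0 addr0 ge_min lexx orbT.
rewrite big_ord_recr /=; have [ny|yn] := ltP.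
  rewrite (le_trans (y := n.+2%:R)) ?ge_min ?lexx ?orbT// -natr1 addrA lerD2r.
  by apply: le_trans IH; rewrite le_min lexx ltW.
rewrite addr0; apply: le_trans IH.
by rewrite le_min ge_min lexx/= (le_trans _ yn)// ge_min lexx.
Qed.

End LayerCake.

Section BorelContinuous.
Context {R : realType} {T : ptopologicalType}.

Lemma borel_open (A : set T) : open A -> measurable (A : set (borel T)).
Proof. exact: sub_sigma_algebra. Qed.

Lemma borel_closed (A : set T) : closed A -> measurable (A : set (borel T)).
Proof.
by move=> cA; rewrite -[A]setCK; apply: measurableC; apply: borel_open; exact: closed_openC.
Qed.

Lemma borel_continuous (T' : ptopologicalType) (h : T -> T') :
  continuous h -> measurable_fun setT (h : borel T -> borel T').
Proof.
move=> hc; apply: (@measurability _ _ (borel T) (borel T') setT h (@open T')) => //.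
move=> _ [A oA <-]; rewrite setTI; apply: borel_open.
by apply: open_comp => // x _; exact: hc.
Qed.

Lemma borel_continuousR (phi : T -> R) :
  continuous phi -> measurable_fun setT (phi : borel T -> R).
Proof.
move=> hc; apply: (@measurability _ _ (borel T) _ setT phi (@RGenOInfty.G R)).
  exact: RGenOInfty.measurableE.
move=> _ [_ [x ->] <-]; rewrite setTI; apply: borel_open.
by apply: open_comp => [y _|]; [exact: hc|exact: interval_open].
Qed.

Lemma Rintegral_prob_cst (p : probability (borel T) R) (c : R) :
  (\int[p]_x c = c)%R.
Proof.
by rewrite Rintegral_cst//; have := @probability_setT _ _ _ p => /= ->; rewrite /= mulr1.
Qed.

Lemma borel_integrable (p : probability (borel T) R) (phi : T -> R) (B : R) :
  continuous phi -> (forall x, `|phi x| <= B) -> p.-integrable setT (EFin \o phi).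
Proof.
move=> hc HB; apply: measurable_bounded_integrable => //.
- by have := @probability_setT _ _ _ p => /= ->; exact: ltry.
- exact: borel_continuousR.
- exists B; split; first exact: num_real.
  by move=> x Bx y _ /=; rewrite (le_trans (HB y))// ltW.
Qed.

End BorelContinuous.

Section EFinIntegrable.
Context d (T : measurableType d) {R : realType} (mu : {measure set T -> \bar R}).

Lemma integrable_EFinD (f g : T -> R) : mu.-integrable setT (EFin \o f) ->
  mu.-integrable setT (EFin \o g) ->
  mu.-integrable setT (EFin \o (fun x => f x + g x)).
Proof. by move=> hf hg; exact: (integrableD measurableT hf hg). Qed.

Lemma integrable_EFinZ (c : R) (f : T -> R) : mu.-integrable setT (EFin \o f) ->
  mu.-integrable setT (EFin \o (fun x => c * f x)).
Proof. by move=> hf; exact: (integrableZl measurableT c hf). Qed.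

End EFinIntegrable.

Section MeanMeasure.
Context {R : realType} {T : pseudoPMetricType R}.
Variables (N_ : nat -> nat) (pt : nat -> nat -> T) (U : set_system nat).
Hypothesis N_gt0 : forall j, (0 < N_ j)%N.
Context {UU : UltraFilter U}.
Variable K : set T.
Hypothesis Kc : compact K.
Hypothesis Kcl : closed K.
Hypothesis ptK : forall j i, (i < N_ j)%N -> K (pt j i).

Local Notation mean := (mean N_ pt U).
Local Notation mass := (mass N_ pt U).

Let massK : mass (~` K) = 0 :> R.
Proof.
apply/eqP; rewrite eq_le mass_ge0// andbT -(@mean_cst R T N_ pt N_gt0 U UU 0).
apply: le_mean => //; [exact: sample_bounded_indic|exact: sample_bounded_cst|].
move=> j i ij; rewrite indicE memNset//= => /(_ (ptK ij)); exact.
Qed.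

(** Layer cake: [N phi] exceeds by at most 1 a sum of indicators of its superlevel sets. These are
    open, so [p] is at most [mass] on each; dividing by [N] leaves the error [1 / N]. *)
Lemma le_integral_mean (p : probability (borel T) R) (phi : T -> R) :
  (forall O : set T, open O -> (p O <= (mass O)%:E)%E) ->
  continuous phi -> (forall x, 0 <= phi x <= 1) ->
  \int[p]_x phi x <= mean phi.
Proof.
move=> pm phic phi01.
have phiB x : `|phi x| <= 1 by have /andP[h0 h1] := phi01 x; rewrite ger0_norm.
have sb : sample_bounded N_ pt phi by exists 1.
apply/ler_addgt0Pr => e e0.
pose N := (Num.truncn e^-1).+1.
have N0 : 0 < N%:R :> R by rewrite ltr0n.
have Ne : N%:R^-1 <= e.
  rewrite invf_ple ?posrE//; apply: ltW; exact: truncnS_gt.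
pose A (i : nat) : set T := [set x | i.+1%:R < N%:R * phi x].
have oA i : open (A i).
  have -> : A i = (fun x => N%:R * phi x) @^-1` [set y | i.+1%:R < y] by [].
  apply: open_comp; last exact: open_gt.
  by move=> x _; apply: cvgMr; exact: phic.
pose s x : R := \sum_(i < N) \1_(A i) x.
have sE x : s x = \sum_(i < N) (i.+1%:R < N%:R * phi x)%R%:R.
  by apply: eq_bigr => i _; rewrite indicE /A mem_setE.
have Nphi x : 0 <= N%:R * phi x <= N%:R.
  have /andP[h0 h1] := phi01 x; rewrite mulr_ge0//=.
  by rewrite ler_piMr.
have sle x : s x <= N%:R * phi x.
  rewrite sE; have /andP[h0 _] := Nphi x; exact: (step_count_le N h0).1.
have sge x : N%:R * phi x <= 1 + s x.
  rewrite sE; apply: le_trans (step_count_ge N _); rewrite le_min lexx/=.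
  by have /andP[_ /le_trans] := Nphi x; apply; rewrite ler_nat.
have intphi : p.-integrable setT (EFin \o phi) by exact: borel_integrable phiB.
have ints : p.-integrable setT (EFin \o s).
  rewrite (_ : EFin \o s = fun x => (\sum_(i < N) (\1_(A i) x)%:E)%E).
    apply: integrable_sum => // i _; apply: integrable_indic; exact: borel_open.
  by apply/funext => x; rewrite /= sumEFin.
have Is : \int[p]_x s x = \sum_(i < N) fine (p (A i)).
  rewrite /Rintegral.
  under eq_integral do rewrite -sumEFin.
  rewrite ge0_integral_sum//; last first.
    move=> i; apply/measurable_EFinP; apply: measurable_indic; exact: borel_open.
  rewrite (eq_bigr (fun i : 'I_N => (fine (p (A i)))%:E)) ?sumEFin// => i _.
  rewrite integral_indic//; last exact: borel_open.
  by rewrite setIT fineK// fin_num_measure//; exact: borel_open.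
have H1 : N%:R * \int[p]_x phi x <= 1 + \int[p]_x s x.
  rewrite -RintegralZl//.
  have -> : 1 + \int[p]_x s x = \int[p]_x (1 + s x).
    rewrite RintegralD//; last exact: finite_measure_integrable_cst.
    by rewrite Rintegral_prob_cst.
  apply: le_Rintegral => //.
  - exact: integrable_EFinZ.
  - apply: integrable_EFinD => //; exact: finite_measure_integrable_cst.
have H2 : \int[p]_x s x <= N%:R * mean phi.
  rewrite -meanZ//.
  apply: (@le_trans _ _ (\sum_(i < N) mass (A i))).
    rewrite Is; apply: ler_sum => i _; rewrite -lee_fin fineK; first exact: pm.
    by apply: fin_num_measure; exact: borel_open.
  have [bs <-] := @mass_sum R T N_ pt N_gt0 U UU N A.
  by apply: le_mean => // [|j i _]; [exact: sample_boundedZ|exact: sle].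
have : N%:R * \int[p]_x phi x <= N%:R * (mean phi + N%:R^-1).
  by rewrite mulrDr mulfV ?gt_eqF// addrC; apply: le_trans H1 _; rewrite lerD2l.
rewrite ler_pM2l// => /le_trans; apply; by rewrite lerD2l.
Qed.

(** The inequality between integral and mean, applied to [psi] and to [1 - psi], is an equality,
    although [p] and [mass] may differ on sets. *)
Lemma mean_measure : exists p : probability (borel T) R,
  (forall (phi : T -> R) (B : R), continuous phi -> (forall x, `|phi x| <= B) ->
     avg N_ pt phi @ U --> (\int[p]_x phi x)%R) /\
  (forall (O : set T) (r : R), open O ->
    (forall C, compact C -> closed C -> C `<=` O -> C `<=` K -> mass C <= r) ->
    (p O <= r%:E)%E).
Proof.
have [p [pO pr]] := finitely_additive_to_borel (@mass_ge0 R T N_ pt N_gt0 U UU)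
  (@massU R T N_ pt N_gt0 U UU) (@massT R T N_ pt N_gt0 U UU) Kc Kcl massK.
exists p; split => // phi B phic HB.
have H01 (psi : T -> R) : continuous psi -> (forall x, 0 <= psi x <= 1) ->
    \int[p]_x psi x = mean psi.
  move=> psic psi01; apply/eqP; rewrite eq_le le_integral_mean//=.
  have psiB x : `|psi x| <= 1 by have /andP[h0 h1] := psi01 x; rewrite ger0_norm.
  have sb : sample_bounded N_ pt psi by exists 1.
  have := @le_integral_mean p (fun x => 1 + (-1) * psi x) pO.
  have intpsi : p.-integrable setT (EFin \o psi) by exact: borel_integrable psiB.
  rewrite meanD ?mean_cst ?meanZ//; last 2 first.
    exact: sample_bounded_cst.
    exact: sample_boundedZ.
  rewrite RintegralD ?RintegralZl//; last 2 first.
    exact: finite_measure_integrable_cst.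
    exact: integrable_EFinZ.
  rewrite Rintegral_prob_cst => H.
  have : 1 + -1 * \int[p]_x psi x <= 1 + -1 * mean psi.
    apply: H.
      move=> x; apply: cvgD; first exact: cvg_cst.
      by apply: cvgMr; exact: psic.
    by move=> x; have := psi01 x; lra.
  by rewrite lerD2l !mulN1r lerN2.
pose B' := `|B| + 1.
have B'0 : 0 < B' by rewrite ltr_wpDl.
have phiB x : `|phi x| <= B'.
  by rewrite (le_trans (HB x))// (le_trans (ler_norm B))// lerDl.
(* Affine change of scale from [[- B', B']] to [[0, 1]]. *)
pose psi x := 2^-1 + (2 * B')^-1 * phi x.
have E x : phi x = 2 * B' * psi x + (- B') by rewrite /psi; field; rewrite gt_eqF.
have psic : continuous psi.
  move=> x; apply: cvgD; first exact: cvg_cst.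
  by apply: cvgMr; exact: phic.
have psi01 x : 0 <= psi x <= 1.
  have := phiB x; rewrite ler_norml E => /andP[h1 h2].
  apply/andP; split.
    have : 0 <= 2 * B' * psi x by lra.
    by rewrite pmulr_rge0// mulr_gt0.
  have : 2 * B' * psi x <= 2 * B' * 1 by lra.
  by rewrite ler_pM2l// mulr_gt0.
have psiB x : `|psi x| <= 1 by have /andP[h0 h1] := psi01 x; rewrite ger0_norm.
have sb : sample_bounded N_ pt psi by exists 1.
have intpsi : p.-integrable setT (EFin \o psi) by exact: borel_integrable psiB.
have sphi : sample_bounded N_ pt phi by exists B.
have -> : \int[p]_x phi x = mean phi; last exact: mean_cvg.
have -> : phi = fun x => 2 * B' * psi x + (- B') by apply/funext => x; rewrite -E.
rewrite meanD ?mean_cst ?meanZ//; last 2 first.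
  exact: sample_boundedZ.
  exact: sample_bounded_cst.
rewrite RintegralD ?RintegralZl//; last 2 first.
  exact: integrable_EFinZ.
  exact: finite_measure_integrable_cst.
by rewrite Rintegral_prob_cst H01.
Qed.

End MeanMeasure.

Section MeanInvariance.
Context {R : realType} {T : pseudoPMetricType R}.
Variables (N_ : nat -> nat) (pt : nat -> nat -> T) (U : set_system nat).
Hypothesis N_gt0 : forall j, (0 < N_ j)%N.
Context {UU : UltraFilter U}.
Variable K : set T.

Local Notation mean := (mean N_ pt U).
Local Notation mass := (mass N_ pt U).

Variable p : probability (borel T) R.
Hypothesis p_cvg : forall (phi : T -> R) (B : R), continuous phi ->
  (forall x, `|phi x| <= B) -> avg N_ pt phi @ U --> (\int[p]_x phi x)%R.
Hypothesis p_open : forall (O : set T) (r : R), open O ->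
  (forall C, compact C -> closed C -> C `<=` O -> C `<=` K -> mass C <= r) ->
  (p O <= r%:E)%E.

Let mean_int (phi : T -> R) : continuous phi -> (forall x, 0 <= phi x <= 1) ->
  mean phi = (\int[p]_x phi x)%R.
Proof.
move=> phic phi01; apply: mean_unique; apply: (p_cvg (B := 1)) => // x.
by have /andP[h0 h1] := phi01 x; rewrite ger0_norm.
Qed.

Lemma mean_le_open (phi : T -> R) (O : set T) : continuous phi ->
  (forall x, 0 <= phi x <= 1) -> open O -> (forall x, ~ O x -> phi x = 0) ->
  mean phi <= fine (p O).
Proof.
move=> phic phi01 oO phi0; rewrite mean_int//.
have phiB x : `|phi x| <= 1 by have /andP[h0 h1] := phi01 x; rewrite ger0_norm.
have mO : measurable (O : set (borel T)) by exact: borel_open.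
have -> : fine (p O) = (\int[p]_x \1_O x)%R.
  by rewrite /Rintegral integral_indic// setIT.
apply: le_Rintegral => //.
- exact: borel_integrable phiB.
- exact: integrable_indic.
- move=> x _; rewrite indicE; have [xO|/negP xO] := boolP (x \in O).
    by have /andP[] := phi01 x.
  by rewrite phi0// => Ox; apply: xO; rewrite inE.
Qed.

Lemma mass_le_mean (C : set T) (phi : T -> R) : (forall x, 0 <= phi x <= 1) ->
  (forall x, C x -> 1 <= phi x) -> mass C <= mean phi.
Proof.
move=> phi01 C1; apply: le_mean => //.
- exact: sample_bounded_indic.
- by exists 1 => j i _; have /andP[h0 h1] := phi01 (pt j i); rewrite ger0_norm.
- move=> j i _; rewrite indicE; have [xC|_] := boolP (_ \in C).
    by apply: C1; rewrite inE in xC.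
  by have /andP[] := phi01 (pt j i).
Qed.

(** Invariance is known for means of continuous functions only. A compact subset of an open set, or
    its image under [h], is separated from the complement by a Urysohn function, and the two
    inequalities between [p (h^-1 O)] and [p O] follow. *)
Lemma mean_invariance (h : T -> T) : continuous h ->
  (forall (phi : T -> R), continuous phi -> (forall x, 0 <= phi x <= 1) ->
     (avg N_ pt (phi \o h) j - avg N_ pt phi j) @[j --> U] --> 0) ->
  forall B : set (borel T), measurable B -> p (h @^-1` B) = p B.
Proof.
move=> hc Hinv.
have mean_eq (phi : T -> R) : continuous phi -> (forall x, 0 <= phi x <= 1) ->
    mean (phi \o h) = mean phi.
  move=> phic phi01.
  have sb1 : sample_bounded N_ pt phi.
    by exists 1 => j i _; have /andP[h0 h1] := phi01 (pt j i); rewrite ger0_norm.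
  have sb2 : sample_bounded N_ pt (phi \o h).
    by exists 1 => j i _; have /andP[h0 h1] := phi01 (h (pt j i)); rewrite ger0_norm.
  apply/eqP; rewrite -subr_eq0; apply/eqP.
  have h1 : (avg N_ pt (phi \o h) j - avg N_ pt phi j) @[j --> U] -->
      mean (phi \o h) - mean phi by apply: cvgB; exact: mean_cvg.
  have h2 := Hinv phi phic phi01.
  rewrite -(cvg_lim (@Rhausdorff R) h1); exact: (cvg_lim (@Rhausdorff R) h2).
have finO (O : set T) : open O -> ((fine (p O))%:E = p O)%E.
  by move=> oO; rewrite fineK// fin_num_measure//; exact: borel_open.
have open_eq (O : set T) : open O -> p (h @^-1` O) = p O.
  move=> oO.
  have ohO : open (h @^-1` O) by apply: open_comp => // x _; exact: hc.
  apply/eqP; rewrite eq_le; apply/andP; split.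
    rewrite -(finO _ oO); apply: p_open => // C Cc _ CO _.
    have hCc : compact (h @` C).
      by apply: continuous_compact => //; apply: continuous_subspaceT.
    have [|phi [phic phi01 phi0 phi1]] := urysohn_compact hCc (open_closedC oO).
      by rewrite -subset0 => _ [[x /CO Cx <-]].
    have phi01' x : 0 <= (phi \o h) x <= 1 by exact: phi01.
    apply: (@le_trans _ _ (mean (phi \o h))).
      by apply: mass_le_mean => // x Cx; rewrite /= phi1//; exists x.
    by rewrite mean_eq//; apply: mean_le_open.
  rewrite -(finO _ ohO); apply: p_open => // C Cc _ CO _.
  have [|phi [phic phi01 phi0 phi1]] := urysohn_compact Cc (open_closedC oO).
    by rewrite -subset0 => x [/CO].
  apply: (@le_trans _ _ (mean phi)).
    by apply: mass_le_mean => // x Cx; rewrite phi1.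
  rewrite -mean_eq//; apply: mean_le_open => //.
  - by move=> x; apply: continuous_comp; [exact: hc|exact: phic].
  - by move=> x; exact: phi01.
  - by move=> x nO; apply: phi0.
have hm : measurable_fun setT (h : borel T -> borel T) by exact: borel_continuous.
move=> B mB.
(* Open sets are stable under intersection and generate the Borel sets; the constant sequence [setT]
   serves as the exhaustion. *)
have := @measure_unique _ R (borel T) (@open T) (fun=> setT) _ _ _ _
  (pushforward p (h : borel T -> borel T)) p _ _ B mB.
apply => //.
- by move=> A1 A2; exact: openI.
- by move=> i; exact: openT.
- by apply/seteqP; split => // x _; exists 0%N.
- move=> i; rewrite [X in (X < _)%E](_ : _ = p setT)//.
  by have := @probability_setT _ _ _ p => /= ->; exact: ltry.
Qed.

End MeanInvariance.

(** * The hull as a compact metric space *)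

(* The hull as a type of its own, with the metric [d]; the proofs are phantom
   arguments that let the structures below be inferred. *)
Definition hull_space {R : realType} {n m : nat} (g : vfield R n m)
  (d : vfield R n m -> vfield R n m -> R)
  (d_metric : metrizes (hull g) d) (g_hull : hull g g) : Type :=
  {h : vfield R n m | hull g h}.

Section HullSpace.
Context {R : realType} {n m : nat} (g : vfield R n m)
  (d : vfield R n m -> vfield R n m -> R)
  (d_metric : metrizes (hull g) d) (g_hull : hull g g).
Notation X := 'rV[R]_n.
Notation Y := 'rV[R]_m.
Notation VF := (vfield R n m).
Notation P := (hull_space d_metric g_hull).

Definition hfield (p : P) : VF := sval p.

Lemma hfieldP (p : P) : hull g (hfield p). Proof. exact: svalP. Qed.

Lemma hfield_inj (p q : P) : hfield p = hfield q -> p = q.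
Proof.
case: p q => [h Hh] [k Hk] /= hk; rewrite /hfield /= in hk; subst k.
by congr exist; exact: Prop_irrelevance.
Qed.

HB.instance Definition _ := gen_eqMixin P.
HB.instance Definition _ := gen_choiceMixin P.

Let dist (p q : P) : R := d (hfield p) (hfield q).

Let distxx p : dist p p = 0.
Proof. by have [_ H _ _ _] := d_metric; apply/H => //; exact: hfieldP. Qed.

Let dist_eq0 p q : dist p q = 0 -> p = q.
Proof.
have [_ H _ _ _] := d_metric => pq; have {}pq := (H _ _ (hfieldP p) (hfieldP q)).1 pq.
by apply: hfield_inj.
Qed.

Let dist_sym p q : dist p q = dist q p.
Proof. by have [_ _ H _ _] := d_metric; apply: H; exact: hfieldP. Qed.

Let dist_triangle q p r : dist p r <= dist p q + dist q r.
Proof. by have [_ _ _ H _] := d_metric; apply: H; exact: hfieldP. Qed.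

HB.instance Definition _ := @isMetric.Build R P dist distxx dist_eq0 dist_sym dist_triangle.
HB.instance Definition _ := isPointed.Build P (exist _ g g_hull).

Lemma hull_ballE (p q : P) (e : R) : ball p e q <-> d (hfield p) (hfield q) < e.
Proof. by rewrite ballEmdist. Qed.

Lemma hull_hausdorff : hausdorff_space P.
Proof. exact: (@metric_hausdorff R P). Qed.

Lemma hfield_continuous : continuous (hfield : P -> VF).
Proof.
move=> p A pA; have [_ _ _ _ H] := d_metric.
have : within (hull g) (nbhs (hfield p)) A by apply: filterS pA => h Ah _.
move=> /(H _ _ (hfieldP p))[e e0 eA].
apply: filterS (nbhsx_ballx p e e0) => q /hull_ballE pq.
by apply: eA => //; exact: hfieldP.
Qed.

Lemma hfield_cvg {I : Type} (F : set_system I) (u : I -> P) (p : P) : Filter F ->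
  (hfield \o u) @ F --> hfield p -> u @ F --> p.
Proof.
move=> FF up; have [_ _ _ _ H] := d_metric.
move=> A /nbhs_ballP[e /= e0 eA].
have : within (hull g) (nbhs (hfield p)) [set k | hull g k -> d (hfield p) k < e].
  have [_ H2] := H (hfield p) [set k | hull g k -> d (hfield p) k < e] (hfieldP p).
  by apply: H2; exists e => // k _ hk _.
move=> /up Hup.
have {}Hup : F [set i | hull g (hfield (u i)) -> hull g (hfield (u i)) ->
  d (hfield p) (hfield (u i)) < e] := Hup.
suff : F [set i | A (u i)] by [].
apply: filterS Hup => i /= Hi.
by apply: eA; apply/hull_ballE; apply: Hi; exact: hfieldP.
Qed.

Hypothesis g_adm : admissible g.
Hypothesis g_lip : uniformly_lipschitz g.

Lemma hull_space_compact : compact [set: P].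
Proof.
rewrite compact_ultra => F FU _.
have [|h Hh Fh] := hull_ultra_compact g_adm (ultra_fmap hfield FU).
  suff : F [set p | hull g (hfield p)] by [].
  by apply: filterE => p /=; exact: hfieldP.
exists (exist _ h Hh); split => //.
by apply: (@hfield_cvg _ F id (exist _ h Hh)).
Qed.

(** Joint continuity of the translation at a continuous [h]. It is stated for filters because it
    serves both the flow on the hull and limits along translates of [g] inside [VF]. *)
Lemma translate_cvg (F : set_system (VF * R)) (h : VF) (s : R) : Filter F ->
  continuous h -> F --> (h, s) ->
  (fun ks : VF * R => translate ks.1 ks.2) @ F --> translate h s.
Proof.
move=> FF hc Fhs.
have F1 : fst @ F --> h by apply: cvg_trans (cvg_app fst Fhs) _; exact: cvg_fst.
have F2 : snd @ F --> s by apply: cvg_trans (cvg_app snd Fhs) _; exact: cvg_snd.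
apply/(co_cvgP _ (translate_cont (s := s) hc)) => K Kc e e0.
have e20 : 0 < e / 2 by rewrite divr_gt0.
pose sh (q : X * Y * R * R) : X * Y * R := (q.1.1, q.1.2 + q.2).
have shc : continuous sh.
  move=> q; apply: (@cvg_pair _ _ _ _ (nbhs q.1.1) (nbhs (q.1.2 + q.2))).
    by apply: (cvg_comp _ _ (cvg_fst (F := nbhs q.1) (G := nbhs q.2))); exact: cvg_fst.
  apply: cvgD; last exact: cvg_snd.
  by apply: (cvg_comp _ _ (cvg_fst (F := nbhs q.1) (G := nbhs q.2))); exact: cvg_snd.
(* The compact set swept by [K] under all shifts within distance 1 of [s]; closeness of fields on it
   covers every nearby shift. *)
pose K' := sh @` (K `*` `[s - 1, s + 1]).
have K'c : compact K'.
  apply: continuous_compact; first exact: continuous_subspaceT.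
  by apply: compact_setX => //; exact: segment_compact.
have N1 : \forall ks \near F, forall q, K' q -> `|ks.1 q - h q| <= e / 2.
  exact: (F1 _ (near_co hc K'c e20)).
have [d1 d10 Hd1] := unif_on_compact K'c (fun q _ => hc q) e20.
have N2 : \forall ks \near F, `|s - ks.2| < Num.min d1 1.
  move/cvgrPdist_lt : F2; apply; by rewrite lt_min d10 ltr01.
apply: filterS2 N1 N2 => -[k s'] /= H1; rewrite lt_min => /andP[sd s1] q Kq.
have K'q r : s - 1 <= r <= s + 1 -> K' (q.1, q.2 + r).
  by move=> sr; exists (q, r) => //; split => //=; rewrite in_itv.
have Hs' : s - 1 <= s' <= s + 1.
  by move: s1; rewrite ltr_norml => /andP[? ?]; apply/andP; split; lra.
case: q Kq K'q => -[x y] t Kq K'q; rewrite /translate /=.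
rewrite -(subrKA (h (x, y, t + s'))) (le_trans (ler_normD _ _))//.
have := H1 _ (K'q s' Hs') => h1.
have h2 : ball (h (x, y, t + s)) (e / 2) (h (x, y, t + s')).
  apply: Hd1; first by apply: (K'q s); apply/andP; split; lra.
  split => /=; first by split; exact: ballxx.
  by rewrite -ball_normE /= opprD addrACA subrr add0r.
move: h2; rewrite -ball_normE /= distrC => h2.
by rewrite /= in h1; lra.
Qed.

Lemma hull_translate h s : hull g h -> hull g (translate h s).
Proof.
move=> [hcl hc]; split; last exact: translate_cont.
(* [h] is approached by translates of [g]; translating these further stays in the orbit, so the
   limit is in its closure. *)
have : (fun ks : VF * R => translate ks.1 ks.2) @ (filter_prod (within [set translate g r | r in [set: R]] (nbhs h)) (nbhs s)) --> translate h s.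
  apply: translate_cvg => //.
  move=> A [[A1 A2] /= [hA1 sA2] sA]; exists (A1, A2) => //; split => //=.
  by apply: filterS hA1 => k A1k _.
have PF : ProperFilter (within [set translate g r | r in [set: R]] (nbhs h)).
  apply: Build_ProperFilter_ex => A hA.
  by have [k [Ak kA]] := hcl _ hA; exists k; exact: kA.
apply: closed_cvg; first exact: closed_closure.
exists ([set translate g r | r in [set: R]], setT) => /=.
  by split; [exact: withinT|exact: filterT].
move=> [k r] [/= [r' _ <-] _]; apply: subset_closure; exists (r' + r) => //.
by apply/funext => -[[x y] t]; rewrite /translate /=; congr (g (_, _, _)); ring.
Qed.

Definition hflow (s : R) (p : P) : P := exist _ _ (hull_translate s (hfieldP p)).

Lemma hfield_flow s p : hfield (hflow s p) = translate (hfield p) s. Proof. by []. Qed.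

Lemma hflow0 p : hflow 0 p = p.
Proof.
apply: hfield_inj; rewrite hfield_flow.
by apply/funext => -[[x y] t]; rewrite /translate /= addr0.
Qed.

Lemma hflowD s t p : hflow (s + t) p = hflow s (hflow t p).
Proof.
apply: hfield_inj; rewrite !hfield_flow.
by apply/funext => -[[x y] r]; rewrite /translate /= -addrA.
Qed.

Lemma hflow_continuous : continuous (fun q : R * P => hflow q.1 q.2).
Proof.
move=> [s p]; apply: hfield_cvg; rewrite /comp /=.
have hc : continuous (hfield p : (X * Y * R)%type -> Y) by case: (hfieldP p).
have := @translate_cvg ((fun q : R * P => (hfield q.2, q.1)) @ (nbhs (s, p))) (hfield p) s _ hc.
apply.
apply: (@cvg_pair _ _ _ _ (nbhs (hfield p)) (nbhs s)); last exact: cvg_fst.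
by apply: (cvg_comp _ _ (cvg_snd (F := nbhs s) (G := nbhs p))); exact: hfield_continuous.
Qed.

(** Evaluation at time 0; following it along [hflow] recovers the nonautonomous field, so that the
    equation becomes a skew product. *)
Definition hvec (p : P) (x : X) (y : Y) : Y := hfield p (x, y, 0).

Lemma hvec_flow t p x y : hvec (hflow t p) x y = hfield p (x, y, t).
Proof. by rewrite /hvec hfield_flow /translate /= add0r. Qed.

Lemma hvec_continuous : continuous (fun q : P * X * Y => hvec q.1.1 q.1.2 q.2).
Proof.
move=> [[p x] y]; rewrite /hvec /=; apply/cvgrPdist_le => e e0.
have e20 : 0 < e / 2 by rewrite divr_gt0.
have hc : continuous (hfield p : (X * Y * R)%type -> Y) by case: (hfieldP p).
pose K := [set q : X * Y | `|q| <= `|x| + `|y| + 1] `*` [set (0 : R)].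
have Kc : compact K.
  by apply: compact_setX; [exact: closed_ball_compact|exact: compact_set1].
have N1 := hfield_continuous (near_co hc Kc e20).
have N2 : \forall q \near (x, y, 0 : R), `|hfield p (x, y, 0) - hfield p q| <= e / 2.
  by move/cvgrPdist_le : (hc (x, y, 0)); exact.
move: N2 => /nbhs_ballP[r /= r0 N2].
have r10 : 0 < Num.min r 1 by rewrite lt_min r0 ltr01.
exists ([set q | (\forall q' \near q, True) /\ (forall q0, K q0 -> `|hfield q.1 q0 - hfield p q0| <= e / 2) /\ ball x (Num.min r 1) q.2], ball y (Num.min r 1)) => /=.
  split; last exact: nbhsx_ballx.
  exists ([set q | forall q0, K q0 -> `|hfield q q0 - hfield p q0| <= e / 2], ball x (Num.min r 1)) => /=.
    by split => //; exact: nbhsx_ballx.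
  by move=> [p' x'] [/= H1 H2]; split => //; exact: filterT.
move=> [[p' x'] y'] [/= [_ [H1 xx']] yy'].
have h2 : `|hfield p (x, y, 0) - hfield p (x', y', 0)| <= e / 2.
  apply: N2; split => /=; last exact: ballxx.
  by split; [apply: le_ball xx'|apply: le_ball yy']; rewrite ge_min lexx.
have h1 : `|hfield p' (x', y', 0) - hfield p (x', y', 0)| <= e / 2.
  apply: H1; split => //=.
  move: xx' yy'; rewrite -!ball_normE /= !lt_min => /andP[_ x1] /andP[_ y1].
  have hx' : `|x'| <= `|x| + 1.
    by rewrite -{1}(subKr x x') (le_trans (ler_normB _ _))// lerD2l ltW.
  have hy' : `|y'| <= `|y| + 1.
    by rewrite -{1}(subKr y y') (le_trans (ler_normB _ _))// lerD2l ltW.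
  have ny := normr_ge0 y; have nx := normr_ge0 x.
  by rewrite prod_normE /= ge_max; apply/andP; split; lra.
rewrite -(subrKA (hfield p (x', y', 0))) (le_trans (ler_normD _ _))//.
by rewrite [e in leRHS]splitr lerD// distrC.
Qed.

End HullSpace.

(** * Invariant measures from fast windows *)

(** After matching [u i] with [w (i + k)], there remain [k] terms of [u] at the end and [k] of [w]
    at the beginning. Both blocks are between 0 and [k] and enter with opposite signs, so they cost
    [k] in all. *)
Lemma sum_shift_close {R : realType} (N k : nat) (u w : nat -> R) (e : R) :
  0 <= e -> (forall i, 0 <= u i <= 1) -> (forall i, 0 <= w i <= 1) ->
  (forall i, (i + k < N)%N -> `|u i - w (i + k)%N| <= e) ->
  `|\sum_(i < N) u i - \sum_(i < N) w i| <= N%:R * e + k%:R.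
Proof.
move=> e0 u01 w01 H.
have sum01 (v : nat -> R) m' n' : (forall i, 0 <= v i <= 1) ->
    0 <= \sum_(m' <= i < n') v i <= (n' - m')%:R.
  move=> v01; rewrite sumr_ge0 /=; last by move=> i _; have /andP[] := v01 i.
  apply: (@le_trans _ _ (\sum_(m' <= i < n') 1)).
    by apply: ler_sum => i _; have /andP[] := v01 i.
  by rewrite sumr_const_nat.
rewrite -!(big_mkord xpredT).
have [kN|Nk] := leqP k N; last first.
  have := sum01 u 0%N N u01; have := sum01 w 0%N N w01; rewrite subn0.
  move=> /andP[w0 w1] /andP[u0 u1].
  have h1 : 0 <= N%:R * e by rewrite mulr_ge0.
  have h2 : N%:R <= k%:R :> R by rewrite ler_nat ltnW.
  by rewrite ler_norml; apply/andP; split; lra.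
rewrite (@big_cat_nat _ _ _ (N - k)%N 0 N) ?leq_subr//=.
rewrite (@big_cat_nat _ _ _ k 0 N _ w)//=.
have -> : \sum_(k <= i < N) w i = \sum_(0 <= i < N - k) w (i + k)%N.
  by rewrite -{1}[k]add0n big_addn.
have := sum01 u (N - k)%N N u01; have := sum01 w 0%N k w01; rewrite subn0 subKn//.
set U2 := \sum_(N - k <= i < N) u i; set W1 := \sum_(0 <= i < k) w i.
move=> /andP[w0 w1] /andP[u0 u1].
have : `|\sum_(0 <= i < N - k) u i - \sum_(0 <= i < N - k) w (i + k)%N| <= N%:R * e.
  rewrite -sumrB; apply: le_trans (ler_norm_sum _ _ _) _.
  apply: (@le_trans _ _ (\sum_(0 <= i < N - k) e)).
    by apply: ler_sum_nat => i /andP[_ ik]; apply: H; rewrite -ltn_subRL in ik *; lia.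
  rewrite sumr_const_nat subn0 -[e *+ _]mulr_natl ler_wpM2r// ler_nat; lia.
set A := \sum_(0 <= i < N - k) u i; set B := \sum_(0 <= i < N - k) w _.
rewrite !ler_norml => /andP[h1 h2]; apply/andP; split; lra.
Qed.

(* The library lacks the joins of the pointed structure of products and matrices
   with their topological or pseudometric structure. *)
HB.instance Definition _ (P Q : ptopologicalType) := Pointed.on (P * Q)%type.

Section PointedPseudoMetric.
Context {R : realType}.
HB.instance Definition _ (P Q : pseudoPMetricType R) := Pointed.on (P * Q)%type.
HB.instance Definition _ m n := Pointed.on 'M[R]_(m, n).
End PointedPseudoMetric.

Lemma sampling_measure {R : realType} {T : pseudoPMetricType R} (N_ : nat -> nat)
    (pt : nat -> nat -> T) (U : set_system nat) (K : set T) :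
  (forall j, (0 < N_ j)%N) -> UltraFilter U -> compact K -> closed K ->
  (forall j i, (i < N_ j)%N -> K (pt j i)) ->
  exists p : probability (borel T) R,
  [/\ forall (phi : T -> R) (B : R), continuous phi -> (forall x, `|phi x| <= B) ->
        avg N_ pt phi @ U --> (\int[p]_x phi x)%R,
      forall h : T -> T, continuous h ->
        (forall (phi : T -> R), continuous phi -> (forall x, 0 <= phi x <= 1) ->
          (avg N_ pt (phi \o h) j - avg N_ pt phi j) @[j --> U] --> 0) ->
        forall B : set (borel T), measurable B -> p (h @^-1` B) = p B
    & forall O : set T, open O ->
        (forall C, compact C -> C `<=` O -> mass N_ pt U C <= 0 :> R) -> p O = 0%E].
Proof.
move=> N_gt0 UU Kc Kcl ptK.
have [p [pc po]] := mean_measure N_gt0 Kc Kcl ptK (U := U).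
exists p; split; [exact: pc| |].
- by move=> h hc hinv B mB; apply: (mean_invariance N_gt0 pc po).
- move=> O oO CO; apply/eqP; rewrite eq_le measure_ge0 andbT.
  by apply: po => // C Cc _ CsubO _; exact: CO.
Qed.

Section WindowMeasure.
Context {R : realType} {n m : nat} (S : fast_system R n m).
Notation X := 'rV[R]_n.
Notation Y := 'rV[R]_m.
Notation P := (base S).
Notation Z := (P * Y)%type.
Variables (xb : X) (rho : R).
Variables (tau eta kappa : nat -> R) (M_ : nat -> nat) (Xf : nat -> R -> X) (Yf : nat -> R -> Y).
Hypothesis M_gt0 : forall j, (0 < M_ j)%N.
Hypothesis eta_gt0 : forall j, 0 < eta j.
Hypothesis eta0 : eta @ \oo --> 0.
Hypothesis kappa0 : kappa @ \oo --> 0.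
Hypothesis tauoo : tau @ \oo --> +oo.
Let len j := (M_ j)%:R * eta j.
Hypothesis lenoo : len @ \oo --> +oo.
Hypothesis Ydw : forall j t, 0 <= t <= len j ->
  dw `[0, len j] (Yf j) t (vf (flow (tau j + t) (base0 S)) (Xf j t) (Yf j t)).
Hypothesis Yrho : forall j t, 0 <= t <= len j -> `|Yf j t| <= rho.
Hypothesis Xxb : forall j t, 0 <= t <= len j -> `|xb - Xf j t| <= kappa j.

Definition frozen_flow (s : R) (z : Z) : Z := (flow s z.1, sol z.1 xb z.2 s).

(** Window [j] starts at fast time [tau j] and is sampled with mesh [eta j]; averages over these
    points replace time averages of the trajectory. *)
Definition sample (j i : nat) : Z :=
  (flow (tau j + i%:R * eta j) (base0 S), Yf j (i%:R * eta j)).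

Lemma sample_time j i : (i <= M_ j)%N -> 0 <= i%:R * eta j <= len j.
Proof.
move=> iM; rewrite mulr_ge0 ?(ltW (eta_gt0 j))//=.
by rewrite /len ler_pM2r// ler_nat.
Qed.

Let K : set Z := [set: P] `*` [set y : Y | `|y| <= rho].

Let Kc : compact K.
Proof. by apply: compact_setX; [exact: base_compact|exact: compact_closed_ball0]. Qed.

Let Kcl : closed K.
Proof.
rewrite (_ : K = snd @^-1` [set y : Y | `|y| <= rho]).
  apply: closed_comp; first by move=> z _; exact: cvg_snd.
  by apply: compact_closed; [exact: norm_hausdorff|exact: compact_closed_ball0].
by apply/seteqP; split => -[h y] //= [].
Qed.

Lemma sampleK j i : (i < M_ j)%N -> K (sample j i).
Proof. by move=> iM; split => //=; apply: Yrho; apply: sample_time; exact: ltnW. Qed.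

Lemma frozen_flow_continuous s : 0 <= s -> continuous (frozen_flow s).
Proof.
move=> s0 z.
have c1 := @comp2_continuous_at _ _ _ _ (fun q : R * P => flow q.1 q.2) (fun=> s) (@fst P Y) z
  (@flow_cont _ _ _ S) (@cst_continuous_at _ _ s z) (@fst_continuous_at _ _ z).
have c2 := @pair_continuous_at _ _ _ (@fst P Y) (fun=> xb) z (@fst_continuous_at _ _ z) (@cst_continuous_at _ _ xb z).
have c3 := @comp2_continuous_at _ _ _ _ (fun q : P * X * Y => sol q.1.1 q.1.2 q.2 s)
  (fun z : Z => (z.1, xb)) (@snd P Y) z (@sol_continuous _ _ _ S s s0) c2 (@snd_continuous_at _ _ z).
exact: (@pair_continuous_at _ _ _ _ _ z c1 c3).
Qed.

Lemma window_lipschitz : exists2 C : R, 0 < C & forall j t t', kappa j <= 1 ->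
  0 <= t -> t <= t' -> t' <= len j -> `|Yf j t' - Yf j t| <= C * (t' - t).
Proof.
have [C HC] := vf_bounded S (Num.max (`|xb| + 1) rho).
exists (`|C| + 1) => [|j t t' k1 t0 tt' t'l]; first by rewrite ltr_wpDl.
have sub r : t <= r <= t' -> 0 <= r <= len j.
  by move=> /andP[r1 r2]; rewrite (le_trans t0 r1) (le_trans r2 t'l).
apply: (@dw_lipschitz _ _ _ _ _ (Yf j) (fun t => vf (flow (tau j + t) (base0 S)) (Xf j t) (Yf j t))) => //.
- by move=> r /sub rl; apply: dwS (Ydw rl) => z /=; rewrite !in_itv/=; exact: sub.
- move=> r /sub rl; apply: (@le_trans _ _ C).
    apply: HC; rewrite le_max; last by rewrite Yrho ?orbT.
    apply/orP; left; rewrite -(subKr xb (Xf j r)) (le_trans (ler_normB _ _))// lerD2l.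
    by apply: le_trans (Xxb rl) _.
  by rewrite (le_trans (ler_norm _))// lerDl.
Qed.

Lemma window_close (s d : R) : 0 <= s -> 0 < d -> \forall j \near \oo,
  forall i, (i + Num.truncn (s / eta j) < M_ j)%N ->
    ball (sample j (i + Num.truncn (s / eta j))) d (frozen_flow s (sample j i)).
Proof.
move=> s0 d0; have d20 : 0 < d / 4 by rewrite divr_gt0.
have [e1 e10 He1] := tracking S `|xb| rho s0 d20.
have [df df0 Hdf] := flow_small S d0.
have [C' C'0 HC'] := window_lipschitz.
have Neta : \forall j \near \oo, eta j < Num.min df (d / 4 / C').
  move/cvgrPdist_lt : eta0 => /(_ (Num.min df (d / 4 / C'))).
  rewrite lt_min df0 divr_gt0//= => /(_ isT); apply: filterS => j.
  by rewrite sub0r normrN gtr0_norm.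
have Nkap : \forall j \near \oo, kappa j < Num.min e1 1.
  move/cvgrPdist_lt : kappa0 => /(_ (Num.min e1 1)).
  rewrite lt_min e10 ltr01 => /(_ isT); apply: filterS => j.
  by rewrite sub0r normrN; apply: le_lt_trans; exact: ler_norm.
apply: filterS2 Neta Nkap => j; rewrite !lt_min => /andP[etaf etad] /andP[ke1 k1] i.
set k := Num.truncn (s / eta j) => ikM.
have eta_ := eta_gt0 j.
have /andP[ks sk] : k%:R <= s / eta j < k.+1%:R by apply: truncn_itv; rewrite divr_ge0// ltW.
rewrite ler_pdivlMr// in ks; rewrite ltr_pdivrMr// -natr1 mulrDl mul1r in sk.
have iM : (i <= M_ j)%N := leq_trans (leq_addr k i) (ltnW ikM).
have /andP[i0 il] := sample_time iM.
have isl : i%:R * eta j + s <= len j.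
  apply: (@le_trans _ _ ((i + k).+1%:R * eta j)); last by rewrite /len ler_pM2r// ler_nat.
  by rewrite -natr1 natrD mulrDl mul1r mulrDl; lra.
have sub t : 0 <= t <= s -> 0 <= i%:R * eta j + t <= len j.
  by move=> /andP[t0 ts]; rewrite addr_ge0//= (le_trans _ isl)// lerD2l.
have h2 : `|Yf j (i%:R * eta j + s) - sol (flow (tau j + i%:R * eta j) (base0 S)) xb (Yf j (i%:R * eta j)) s| <= d / 4.
  have := He1 (flow (tau j + i%:R * eta j) (base0 S)) xb (fun t => Xf j (i%:R * eta j + t))
    (fun t => Yf j (i%:R * eta j + t)) (lexx _).
  rewrite addr0; apply; last by rewrite s0 lexx.
  - by apply: Yrho; rewrite i0.
  - move=> t ts; rewrite -flowD addrC -addrA.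
    apply: dwS (dw_shift (Ydw (sub t ts))) => z /=; rewrite !in_itv/=; exact: sub.
  - by move=> t ts; apply: (le_trans (Xxb (sub t ts))); exact: ltW.
have h3 : `|Yf j (i%:R * eta j + s) - Yf j ((i + k)%:R * eta j)| <= d / 4.
  have ikl : (i + k)%:R * eta j <= i%:R * eta j + s by rewrite natrD mulrDl lerD2l.
  have ik0 : 0 <= (i + k)%:R * eta j by rewrite mulr_ge0// ltW.
  apply: (@le_trans _ _ (C' * (i%:R * eta j + s - (i + k)%:R * eta j))).
    by apply: HC' => //; exact: ltW.
  apply: (@le_trans _ _ (C' * eta j)).
    by rewrite ler_pM2l// natrD mulrDl; lra.
  by rewrite mulrC -ler_pdivlMr// ltW.
split => /=.
  have -> : flow s (flow (tau j + i%:R * eta j) (base0 S)) =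
    flow (s - k%:R * eta j) (flow (tau j + (i + k)%:R * eta j) (base0 S)).
    by rewrite -!flowD natrD; congr (flow _ _); ring.
  apply: Hdf; rewrite ger0_norm ?subr_ge0//; lra.
rewrite -ball_normE /=.
rewrite -(subrKA (Yf j (i%:R * eta j + s))) (le_lt_trans (ler_normD _ _))//.
rewrite [`|Yf j ((i + k)%:R * eta j) - _|]distrC; lra.
Qed.

Variable U : set_system nat.
Context {UU : UltraFilter U}.
Hypothesis Uoo : \oo `<=` U.

(** By [window_close] the flow acts as a shift of indices, which affects a fraction of at most
    [s / len j] of the average, and the windows become infinitely long. *)
Lemma window_invariant (s : R) (phi : Z -> R) : 0 <= s -> continuous phi ->
  (forall x, 0 <= phi x <= 1) ->
  (avg M_ sample (phi \o frozen_flow s) j - avg M_ sample phi j) @[j --> U] --> 0.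
Proof.
move=> s0 phic phi01.
have H : (avg M_ sample (phi \o frozen_flow s) j - avg M_ sample phi j) @[j --> \oo] --> 0; last first.
  by apply: cvg_trans H; exact: cvg_app.
apply/cvgrPdist_le => e e0; have e20 : 0 < e / 2 by rewrite divr_gt0.
have [d d0 Hd] := unif_on_compact Kc (fun z _ => phic z) e20.
have N1 := window_close s0 d0.
have N2 : \forall j \near \oo, s / len j <= e / 2.
  have p0 : 0 < s / (e / 2) + 1 by rewrite ltr_wpDl// divr_ge0// ltW.
  move/cvgryPge : (lenoo) => /(_ (s / (e / 2) + 1)).
  apply: filterS => j hj.
  have l0 : 0 < len j by exact: lt_le_trans hj.
  by rewrite ler_pdivrMr// mulrC -ler_pdivrMr// (le_trans _ hj)// lerDl.
apply: filterS2 N1 N2 => j H1 H2; rewrite sub0r normrN.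
set k := Num.truncn (s / eta j) in H1.
have M0 : 0 < (M_ j)%:R :> R by rewrite ltr0n.
rewrite /avg -mulrBl normrM [`|(_)^-1|]gtr0_norm ?invr_gt0// ler_pdivrMr//.
apply: (@le_trans _ _ ((M_ j)%:R * (e / 2) + k%:R)).
  apply: (@sum_shift_close R _ k (fun i => (phi \o frozen_flow s) (sample j i)) (fun i => phi (sample j i))) => //.
  - exact: ltW.
  - by move=> i; exact: phi01.
  - move=> i ikM; rewrite distrC.
    have := Hd _ _ (sampleK ikM) (H1 i ikM).
    by rewrite -ball_normE /= => /ltW.
have : k%:R <= (M_ j)%:R * (e / 2).
  rewrite ler_pdivrMr ?mulr_gt0// in H2.
  have ks : k%:R * eta j <= s.
    rewrite -ler_pdivlMr//; have /andP[//] := truncn_itv (divr_ge0 s0 (ltW (eta_gt0 j))).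
  have h : k%:R * eta j <= (M_ j)%:R * (e / 2) * eta j.
    by apply: le_trans ks _; apply: le_trans H2 _; rewrite /len; lra.
  by rewrite ler_pM2r in h.
by lra.
Qed.

(** Take a Urysohn function equal to 1 on [C] and to 0 away from [C], in particular near [A0]. At
    the attraction time [s] all samples have been carried to where it vanishes, and invariance makes
    its mean zero. *)
Lemma attracting_null (A0 : set Z) (C : set Z) :
  (forall V, open V -> A0 `<=` V -> exists s : R, 0 <= s /\
     forall z, `|z.2| <= rho -> V (frozen_flow s z)) ->
  compact C -> C `<=` ~` A0 -> open (~` A0) -> mass M_ sample U C <= 0 :> R.
Proof.
move=> attr Cc CA oA.
have [e e0 He] := compact_ball_sub Cc oA CA.
have e20 : 0 < e / 2 by rewrite divr_gt0.
pose N := [set y : Z | forall x, C x -> ~ ball x (e / 2) y].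
have [||phi [phic phi01 phi0 phi1]] := @urysohn_compact R _ C (closure N) Cc.
- exact: closed_closure.
- rewrite -subset0 => x [Cx /(_ (ball x (e / 2)) (nbhsx_ballx _ _ e20))[y [Ny xy]]].
  exact: (Ny x Cx).
have [||s [s0 Hs]] := attr N°.
- exact: open_interior.
- move=> q Aq; apply/nbhs_ballP; exists (e / 2) => //= y qy x Cx xy.
  apply: (He x q Cx) Aq; rewrite [e]splitr; apply: ball_triangle xy _; exact: ball_sym.
have phiC x : C x -> 1 <= phi x by move=> Cx; rewrite phi1.
have hm := @mass_le_mean R _ M_ sample U M_gt0 UU C phi phi01 phiC.
apply: (le_trans hm).
have Hinv := window_invariant s0 phic phi01.
have E j : avg M_ sample (phi \o frozen_flow s) j = 0.
  rewrite /avg big1 ?mul0r// => i _ /=; apply: phi0; apply: subset_closure.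
  by apply: interior_subset; apply: Hs; have [] := sampleK (ltn_ord i).
have H0 : (- avg M_ sample phi j) @[j --> U] --> (0 : R).
  move: Hinv; rewrite (_ : (fun j => _ - _) = (fun j => - avg M_ sample phi j))//.
  by apply/funext => j; rewrite E sub0r.
rewrite (@mean_unique R _ M_ sample U UU phi 0)//.
rewrite (_ : avg M_ sample phi = fun j => - - avg M_ sample phi j).
  by rewrite -oppr0; exact: cvgN H0.
by apply/funext => j; rewrite opprK.
Qed.

Definition orbit_limit : set P :=
  [set h | forall (T : R) (V : set P), nbhs h V -> exists2 t, T <= t & V (flow t (base0 S))].

Lemma orbit_limit_closed : closed orbit_limit.
Proof.
move=> h clh T V; rewrite nbhsE => -[W [oW Wh] WV].
have [k [Lk Wk]] := clh W (open_nbhs_nbhs (conj oW Wh)).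
have [t Tt Wt] := Lk T W (open_nbhs_nbhs (conj oW Wk)).
by exists t => //; exact: WV.
Qed.

(** By compactness the orbit of [base0] leaves the projection of [C] for good after some time [T];
    since [tau] tends to infinity, all but finitely many windows have no sample in [C]. *)
Lemma orbit_limit_null (C : set Z) : compact C -> C `<=` (~` orbit_limit) `*` setT ->
  mass M_ sample U C <= 0 :> R.
Proof.
move=> Cc CO.
have [T HT] : exists T : R, forall t y, T <= t -> ~ C (flow t (base0 S), y).
  apply: contrapT => /forallNP nT.
  pose b (T : R) := [set ty : R * Y | T <= ty.1 /\ C (flow ty.1 (base0 S), ty.2)].
  have FF : ProperFilter (filter_from setT b).
    apply: filter_from_proper.
      apply: filter_from_filter; first by exists 0.
      move=> T1 T2 _ _; exists (Num.max T1 T2) => //.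
      by move=> [t z] [/=]; rewrite ge_max => /andP[h1 h2] h3.
    move=> T _; apply: contrapT => nb; apply: (nT T) => t y Tt Cty.
    by apply: nb; exists (t, y).
  have [F [FU FG]] := ultraFilterLemma FF.
  pose ev (ty : R * Y) : Z := (flow ty.1 (base0 S), ty.2).
  have := Cc; rewrite compact_ultra => /(_ _ (ultra_fmap ev FU))[|[h y] [Chy Fhy]].
    suff : F [set ty | C (ev ty)] by [].
    by apply: FG; exists 0 => // -[t y] [].
  have [nO _] := CO _ Chy; apply: nO => T V hV.
  have FV : F [set ty | V (ev ty).1].
    have : nbhs (h, y) [set z : Z | V z.1] by exists (V, setT) => //=; [split => //; exact: filterT|move=> [? ?] []].
    by move=> /Fhy.
  have FT : F (b T) by apply: FG; exists T.
  by have [[t y'] [/= Vt [Tt _]]] := filterI_ex FV FT; exists t.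
have N1 : \forall j \near \oo, T <= tau j by move/cvgryPge : (tauoo) => /(_ T).
rewrite /mass (@mean_unique R _ M_ sample U UU _ 0)//.
apply: cvg_near_cst; apply: Uoo; apply: filterS N1 => j Tj.
rewrite /avg big1 ?mul0r// => i _.
rewrite indicE memNset//; apply: HT; apply: le_trans Tj _; rewrite lerDl.
by rewrite mulr_ge0// ltW.
Qed.

Local Notation Zs := [the pseudoPMetricType R of (P * Y)%type].

Lemma window_measure : exists p : probability (borel Zs) R,
  [/\ forall (phi : Zs -> R) (B : R), continuous phi -> (forall x, `|phi x| <= B) ->
        avg M_ sample phi @ U --> (\int[p]_x phi x)%R,
      forall (s : R) (B : set (borel Zs)), 0 <= s -> measurable B ->
        p (frozen_flow s @^-1` B) = p B,
      forall A0 : set Zs, closed A0 ->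
        (forall V, open V -> A0 `<=` V -> exists s : R, 0 <= s /\
          forall z, `|z.2| <= rho -> V (frozen_flow s z)) -> p (~` A0) = 0%E
    & p (~` (orbit_limit `*` setT)) = 0%E].
Proof.
have [p [pc pinv pnull]] := @sampling_measure R Zs M_ sample U K M_gt0 UU Kc Kcl sampleK.
exists p; split.
- exact: pc.
- move=> s B s0; apply: pinv; first exact: frozen_flow_continuous.
  by move=> phi phic phi01; exact: window_invariant.
- move=> A0 A0c attr; apply: pnull; first exact: closed_openC.
  by move=> C Cc CA; apply: (attracting_null attr Cc CA); exact: closed_openC.
- have cl : closed (orbit_limit `*` [set: Y]).
    rewrite (_ : _ `*` _ = fst @^-1` orbit_limit).
      apply: closed_comp; first by move=> z _; exact: cvg_fst.
      exact: orbit_limit_closed.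
    by apply/seteqP; split => -[h y] //= [].
  apply: pnull; first exact: closed_openC.
  move=> C Cc CA; apply: orbit_limit_null Cc _ => -[h y] /CA /= nO.
  by split => //= Oh; apply: nO.
Qed.

End WindowMeasure.

(** * Almost everywhere differentiability *)

(* [F t = w t + C t], frozen outside [0, t0], is nondecreasing; its Stieltjes
   measure is dominated by the Lebesgue measure, and its Radon-Nikodym density
   is the derivative at every Lebesgue point. *)
Section LipschitzDerivable.
Context {R : realType}.
Variables (w : R -> R) (t0 C : R).
Hypothesis t00 : 0 < t0.
Hypothesis C0 : 0 <= C.
Hypothesis wlip : forall s t, 0 <= s <= t0 -> 0 <= t <= t0 -> `|w s - w t| <= C * `|s - t|.

Let clamp (t : R) : R := Num.max 0 (Num.min t t0).

Let clampP t : 0 <= clamp t <= t0.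
Proof. by rewrite /clamp le_max lexx ge_max ge_min lexx orbT (ltW t00). Qed.

Let clamp_id t : 0 <= t <= t0 -> clamp t = t.
Proof. by move=> /andP[h1 h2]; rewrite /clamp (min_idPl h2) (max_idPr h1). Qed.

Let clamp_mono s t : s <= t -> clamp s <= clamp t /\ clamp t - clamp s <= t - s.
Proof.
move=> st; rewrite /clamp; have t0' := t00.
by case: (leP s t0) => s1; case: (leP t t0) => t1; case: (leP 0 s) => s2;
  case: (leP 0 t) => t2; case: (leP 0 t0) => t3; split; lra.
Qed.

Definition lip_cumulative (t : R) : R := w (clamp t) + C * clamp t.

Local Notation F := lip_cumulative.

Let F_mono s t : s <= t -> F s <= F t /\ F t - F s <= 2 * C * (t - s).
Proof.
move=> st; have [h1 h2] := clamp_mono st; rewrite /F.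
have := wlip (clampP t) (clampP s); rewrite [X in _ <= C * X]ger0_norm ?subr_ge0//.
rewrite ler_norml => /andP[h3 h4].
have h5 : C * (clamp t - clamp s) <= C * (t - s) by rewrite ler_wpM2l.
by split; lra.
Qed.

Let F_nd : {homo F : s t / s <= t}.
Proof. by move=> s t /F_mono[]. Qed.

Let F_rc : right_continuous F.
Proof.
move=> t; apply/cvgrPdist_le => e e0.
have C10 : 0 < 2 * C + 1 by rewrite ltr_wpDl// mulr_ge0.
near=> s.
have ts : t <= s by near: s; exact: nbhs_right_ge.
have [h1 h2] := F_mono ts.
rewrite distrC ger0_norm ?subr_ge0//; apply: le_trans h2 _.
have : s - t <= e / (2 * C + 1).
  rewrite lerBlDl; apply: ltW; near: s; apply: nbhs_right_lt.
  by rewrite ltrDl divr_gt0.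
rewrite ler_pdivlMr// => h.
have : 0 <= s - t by rewrite subr_ge0.
by lra.
Unshelve. all: by end_near. Qed.

HB.instance Definition _ := isCumulative.Build R _ R F F_nd F_rc.

Local Notation mu := (@lebesgue_measure R).

Let nu := lebesgue_stieltjes_measure F.

Let wlength_le (A : set (ocitv_type R)) : measurable A ->
  (wlength F A <= (2 * C)%:E * wlength idfun A)%E.
Proof.
move=> /ocitvP[->|[[x y] /= xy ->]]; first by rewrite !wlength0 mule0.
by rewrite !wlength_itv_bnd ?(ltW xy)// -EFinM lee_fin; apply: (F_mono (ltW xy)).2.
Qed.

(** A cover by half-open intervals of small total length has small total increment of [F], which
    grows at rate at most [2 C]. *)
Let nu_dominated (A : set (measurableTypeR R)) : measurable A -> mu A = 0%E -> nu A = 0%E.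
Proof.
move=> mA mA0; apply/eqP; rewrite eq_le measure_ge0 andbT.
have C20 : 0 < 2 * C + 1 by rewrite ltr_wpDl// mulr_ge0.
apply/lee_addgt0Pr => e e0; rewrite add0e.
pose k := e / (2 * C + 1); have k0 : 0 < k by rewrite divr_gt0.
have mAf : mu A \is a fin_num by rewrite mA0.
have [_ [B [mB AB] <-]] := lb_ereal_inf_adherent k0 mAf.
rewrite -/(mu A) [X in (X + _)%E]mA0 add0e => hB.
apply: (@le_trans _ _ (\sum_(i <oo) wlength F (B i))%E).
  by apply: ereal_inf_lbound; exists B.
apply: (@le_trans _ _ (\sum_(i <oo) (2 * C)%:E * wlength idfun (B i))%E).
  by apply: lee_nneseries => [i *|i _]; [exact: wlength_ge0|exact: (wlength_le (mB i))].
rewrite nneseriesZl; last by move=> i _; exact: wlength_ge0.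
apply: (@le_trans _ _ ((2 * C)%:E * k%:E)%E).
  by apply: lee_wpmul2l; [rewrite lee_fin mulr_ge0|exact: ltW].
rewrite -EFinM lee_fin /k mulrA ler_pdivrMr// mulrC ler_pM2l//; lra.
Qed.

Let D : set (measurableTypeR R) := `]0, t0]%classic.

Let mD : measurable D. Proof. exact: measurable_itv. Qed.

Let nu_itv (y : R) : 0 <= y -> nu `]0, y]%classic = (F y - F 0)%:E.
Proof.
move=> y0; rewrite /nu /lebesgue_stieltjes_measure /measure_extension measurable_mu_extE/=; last exact: is_ocitv.
by rewrite wlength_itv_bnd.
Qed.

Let nuD : (nu D < +oo)%E.
Proof. by rewrite [X in (X < _)%E]nu_itv ?ltW// ltry. Qed.

Lemma lipschitz_derivable_ae :
  {ae mu, forall t, 0 < t < t0 -> exists l : R, dw (V := R) `[0, t0] w t l}.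
Proof.
(* Restriction to []0, t0]] gives a finite measure, to which the Radon-Nikodym theorem is
   applied. *)
pose nuR : {finite_measure set (measurableTypeR R) -> \bar R} := mfrestr mD nuD.
have dom : nuR `<< mu.
  apply/null_content_dominatesP => A mA A0; rewrite /nuR /= /mfrestr /mrestr.
  apply: nu_dominated; first exact: measurableI.
  apply/eqP; rewrite eq_le measure_ge0 andbT -[X in (_ <= X)%E]A0.
  by apply: le_measure; rewrite ?inE//; exact: measurableI.
have [rho [rho0 rhofin rhoint rhoE]] := radon_nikodym_sigma_finite dom.
pose f : R -> R := fine \o rho.
have fE : EFin \o f = rho by apply/funext => x; rewrite /f /= fineK.
have fint : mu.-integrable setT (EFin \o f) by rewrite fE.
have floc : locally_integrable setT f by apply: open_integrable_locally => //; exact: openT.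
have := lebesgue_differentiation floc.
apply: (@filterS _ _ (ae_filter_ringOfSetsType mu)) => t tleb /andP[t0' tt0].
have fintD : mu.-integrable [set` Interval (BRight 0) (BRight t0)] (EFin \o f).
  by apply: integrableS fint => //; exact: measurable_itv.
pose G (y : R) : R := (\int[mu]_(s in [set` Interval (BRight 0) (BRight y)]) f s)%R.
have GE y : 0 <= y <= t0 -> G y = F y - F 0.
  move=> /andP[y0 yt]; rewrite /G /Rintegral.
  have -> : (\int[mu]_(x in `]0%R, y]) (f x)%:E = \int[mu]_(x in `]0%R, y]) rho x)%E.
    by apply: eq_integral => x _; rewrite /f /= fineK.
  rewrite -rhoE; last exact: measurable_itv.
  rewrite /nuR /= /mfrestr /mrestr setIidl; last first.
    by move=> x /=; rewrite /D /= !in_itv/= => /andP[-> /le_trans]; apply.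
  by rewrite [X in fine X]nu_itv.
have [Gd _] := FTC1_lebesgue_pt tt0 fintD (a := BRight 0) t0' tleb.
move: Gd; rewrite -/G => /cvg_ex[l].
move=> /cvgrPdist_le Gl.
(* [l] is the derivative of [F], which includes the added slope [C]. *)
exists (l - C) => e e0.
have [d /= d0 Hd] := Gl e e0.
(* The last two bounds keep [s] in [[0, t0]], where [clamp] is the identity. *)
exists (Num.min d (Num.min t (t0 - t))).
  by rewrite !lt_min d0 t0' subr_gt0.
move=> s _; rewrite !lt_min => /andP[sd /andP[st stt]].
have [->|sneq] := eqVneq s t; first by rewrite !subrr scale0r subr0 !normr0 mulr0.
have st0 : s - t != 0 by rewrite subr_eq0.
have s0t0 : 0 <= s <= t0.
  by move: st stt; rewrite !ltr_norml => /andP[? ?] /andP[? ?]; apply/andP; split; lra.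
have t0t0 : 0 <= t <= t0 by rewrite !ltW.
have := Hd (s - t); rewrite /= sub0r normrN => /(_ sd st0).
have -> : (s - t) *: 1 + t = s by rewrite /GRing.scale/= mulr1 subrK.
rewrite !GE// opprB addrA subrK /F !clamp_id//.
move=> H.
have -> : w s - w t - (s - t) *: (l - C) =
   - ((s - t) * (l - (s - t)^-1 *: (w s + C * s - (w t + C * t)))).
  by rewrite /GRing.scale/=; field.
by rewrite normrN normrM mulrC ler_wpM2r.
Qed.

End LipschitzDerivable.

Lemma lipschitz_rV_derivable_ae {R : realType} {n : nat} (z : R -> 'rV[R]_n) (t0 C : R) :
  0 < t0 -> 0 <= C ->
  (forall s t, 0 <= s <= t0 -> 0 <= t <= t0 -> `|z s - z t| <= C * `|s - t|) ->
  {ae @lebesgue_measure R, forall t, 0 < t < t0 -> exists v, dw `[0, t0] z t v}.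
Proof.
move=> t00 C0 zlip.
have H (i : 'I_n) : {ae @lebesgue_measure R, forall t, 0 < t < t0 ->
    exists l : R, dw (V := R) `[0, t0] (fun t => z t ord0 i) t l}.
  apply: (@lipschitz_derivable_ae R _ t0 C) => // s t s0 t0'.
  apply: le_trans (zlip s t s0 t0').
  by have := rV_norm_coord (z s - z t) i; rewrite !mxE.
have : {ae @lebesgue_measure R, forall t, forall i : 'I_n, 0 < t < t0 ->
    exists l : R, dw (V := R) `[0, t0] (fun t => z t ord0 i) t l}.
  (* The countable intersection of full sets runs over [nat]; an index [k >= n] matches no
     coordinate. *)
  have Hn : {ae @lebesgue_measure R, forall t, forall k : nat, forall i : 'I_n, i = k :> nat ->
      0 < t < t0 -> exists l : R, dw (V := R) `[0, t0] (fun t => z t ord0 i) t l}.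
    apply: ae_foralln => k; have [kn|nk] := ltnP k n.
      apply: (@filterS _ _ (ae_filter_ringOfSetsType (@lebesgue_measure R)) _ _ _ (H (Ordinal kn))).
      by move=> t Ht i ik; rewrite (_ : i = Ordinal kn)//; exact: val_inj.
    by apply: aeW => t i ik; move: (ltn_ord i); rewrite ik ltnNge nk.
  apply: (@filterS _ _ (ae_filter_ringOfSetsType (@lebesgue_measure R)) _ _ _ Hn).
  by move=> t Ht i; exact: (Ht i).
apply: (@filterS _ _ (ae_filter_ringOfSetsType (@lebesgue_measure R))) => t Ht tt0.
have /choice[l Hl] : forall i, exists l : R, dw (V := R) `[0, t0] (fun t => z t ord0 i) t l.
  by move=> i; exact: Ht.
exists (\row_i l i) => e e0.
have /choice[d Hd] : forall i, exists d : R, 0 < d /\ forall s, `[0, t0]%classic s -> `|s - t| < d ->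
    `|z s ord0 i - z t ord0 i - (s - t) *: (l i : R)| <= e * `|s - t|.
  by move=> i; have [d d0 H'] := Hl i e e0; exists d.
exists (\big[Num.min/1]_i d i).
  by apply: lt_bigmin => // i _; have [] := Hd i.
move=> s Is sd; apply: rV_norm_le => [|i]; first by rewrite mulr_ge0// ltW.
have [_ {}Hd] := Hd i; have := Hd s Is; rewrite !mxE; apply.
by apply: lt_le_trans sd _; exact: bigmin_le.
Qed.

(** * Averaging *)

(** A Riemann sum estimate without an integral: the mean value inequality on each cell, added up. *)
Lemma cell_increments {R : realType} {V : normedModType R} (t h om : R) (M : nat)
    (u u' : R -> V) (w : nat -> V) : 0 <= h -> 0 <= om ->
  (forall r, t <= r <= t + M%:R * h -> dw `[t, t + M%:R * h] u r (u' r)) ->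
  (forall i r, (i < M)%N -> t + i%:R * h <= r <= t + i.+1%:R * h -> `|u' r - w i| <= om) ->
  `|u (t + M%:R * h) - u t - h *: \sum_(i < M) w i| <= om * (M%:R * h).
Proof.
move=> h0 om0 du uw.
suff : forall k, (k <= M)%N ->
  `|u (t + k%:R * h) - u t - h *: \sum_(i < k) w i| <= om * (k%:R * h) by exact.
elim=> [_|k IH kM]; first by rewrite mul0r addr0 subrr big_ord0 scaler0 subr0 normr0 mulr0.
have E : t + k.+1%:R * h - (t + k%:R * h) = h by rewrite -natr1 mulrDl mul1r; ring.
have sub r : t + k%:R * h <= r <= t + k.+1%:R * h -> t <= r <= t + M%:R * h.
  move=> /andP[h1 h2]; apply/andP; split.
    by apply: le_trans h1; rewrite lerDl mulr_ge0.
  by apply: le_trans h2 _; rewrite lerD2l ler_wpM2r// ler_nat.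
have kk : t + k%:R * h <= t + k.+1%:R * h by rewrite -subr_ge0 E.
have := @dw_mean_value R V (t + k%:R * h) (t + k.+1%:R * h) om u u' (w k) kk om0 _ _.
rewrite E => H.
have {}H : `|u (t + k.+1%:R * h) - u (t + k%:R * h) - h *: w k| <= om * h.
  apply: H => r rk; last exact: uw.
  by apply: dwS (du r (sub r rk)) => q /=; rewrite !in_itv /=; exact: sub.
rewrite big_ord_recr /= scalerDr.
have -> : u (t + k.+1%:R * h) - u t - (h *: \sum_(i < k) w i + h *: w k) =
  (u (t + k%:R * h) - u t - h *: \sum_(i < k) w i) +
  (u (t + k.+1%:R * h) - u (t + k%:R * h) - h *: w k).
  by rewrite [RHS]addrACA -opprD [X in _ = X - _]addrC subrKA.
apply: le_trans (ler_normD _ _) _.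
by rewrite -[X in om * (X * h)]natr1 mulrDl mul1r mulrDr lerD// IH// ltnW.
Qed.

Section Averaging.
Context {R : realType} {n m : nat} (S : fast_system R n m).
Notation X := 'rV[R]_n.
Notation Y := 'rV[R]_m.
Notation P := (base S).
Local Notation Zs := [the pseudoPMetricType R of (P * Y)%type].
Variables (f : X * Y -> X) (a b : R).
Hypothesis fc : continuous f.
Hypothesis f_growth : forall x y, `|f (x, y)| <= a + b * `|x|.
Variables (t0 C rho : R) (eps : nat -> R) (x : nat -> R -> X) (y : nat -> R -> Y) (z : R -> X).
Hypothesis eps_gt0 : forall j, 0 < eps j.
Hypothesis eps0 : eps @ \oo --> 0.
Hypothesis xy_sol : forall j, sf_solution S f (eps j) `[0, t0] (x j) (y j).
Hypothesis C0 : 0 <= C.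
Hypothesis x_lip : forall j t t', 0 <= t <= t0 -> 0 <= t' <= t0 -> `|x j t - x j t'| <= C * `|t - t'|.
Hypothesis y_rho : forall j t, 0 <= t <= t0 -> `|y j t| <= rho.
Hypothesis x_unif : forall e, 0 < e -> \forall j \near \oo,
  forall t, 0 <= t <= t0 -> `|x j t - z t| <= e.

(** Window [l] has length [s l]; the index [k l] is taken so far out that the window is long in fast
    time ([eps / s] small), starts late in fast time ([eps / t] small), and that the distance from
    [x (k l)] to [z] is negligible relative to the window. *)
Lemma window_data t : 0 < t < t0 -> exists s : nat -> R, exists k : nat -> nat,
  [/\ forall l, 0 < s l, forall l, t + s l <= t0, s @ \oo --> 0,
      forall l, eps (k l) <= s l * harmonic l /\ eps (k l) <= t * harmonic l
    & forall l r, 0 <= r <= t0 -> `|x (k l) r - z r| <= s l * harmonic l].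
Proof.
move=> /andP[t_gt0 tt0].
pose s l := (t0 - t) * harmonic l.
have h0 l : 0 < harmonic l :> R by rewrite invr_gt0.
have s0 l : 0 < s l by rewrite mulr_gt0// subr_gt0.
have h1 l : harmonic l <= 1 :> R by rewrite invf_le1// ler1n.
have /choice[k Hk] : forall l, exists k, [/\ eps k <= s l * harmonic l, eps k <= t * harmonic l
    & forall r, 0 <= r <= t0 -> `|x k r - z r| <= s l * harmonic l].
  move=> l; have e1 : 0 < s l * harmonic l by rewrite mulr_gt0.
  have e2 : 0 < t * harmonic l by rewrite mulr_gt0.
  have N : \forall j \near \oo, eps j < Num.min (s l * harmonic l) (t * harmonic l).
    move/cvgrPdist_lt : eps0 => /(_ (Num.min (s l * harmonic l) (t * harmonic l))).
    rewrite lt_min e1 e2 => /(_ isT); apply: filterS => j.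
    by rewrite sub0r normrN gtr0_norm.
  have [k [k1 k2]] := filterI_ex N (x_unif e1).
  by move: k1; rewrite lt_min => /andP[k11 k12]; exists k; split => //; exact: ltW.
exists s, k; split => //.
- move=> l; rewrite -lerBrDl -[leRHS]mulr1 ler_wpM2l// subr_ge0; exact: ltW.
- rewrite -(mulr0 (t0 - t)); apply: cvgMr; exact: cvg_harmonic.
- by move=> l; have [] := Hk l.
- by move=> l; have [] := Hk l.
Qed.

Lemma f_unif (r e : R) : 0 < e -> exists2 d : R, 0 < d &
  forall x1 y1 x2 y2, `|x1| <= r -> `|y1| <= r -> `|x1 - x2| < d -> `|y1 - y2| < d ->
  `|f (x1, y1) - f (x2, y2)| <= e.
Proof.
move=> e0.
have Kc : compact ([set x : X | `|x| <= r] `*` [set y : Y | `|y| <= r]).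
  by apply: compact_setX; exact: compact_closed_ball0.
have [d d0 H] := unif_on_compact Kc (fun z _ => @fc z) e0.
exists d => // x1 y1 x2 y2 xr yr xx yy.
have : ball (f (x1, y1)) e (f (x2, y2)).
  by apply: H; [split|split => /=; rewrite -ball_normE].
by rewrite -ball_normE /= => /ltW.
Qed.

Lemma averaged_derivative t v : 0 < t < t0 -> dw `[0, t0] z t v ->
  exists p : probability (borel Zs) R,
  [/\ forall (s : R) (B : set (borel Zs)), 0 <= s -> measurable B ->
        p (@frozen_flow _ _ _ S (z t) s @^-1` B) = p B,
      forall A0 : set Zs, closed A0 ->
        (forall V, open V -> A0 `<=` V -> exists s : R, 0 <= s /\
          forall q, `|q.2| <= rho -> V (@frozen_flow _ _ _ S (z t) s q)) -> p (~` A0) = 0%E,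
      p (~` (@orbit_limit _ _ _ S `*` setT)) = 0%E
    & forall i, v 0 i = (\int[p]_q f (z t, q.2) 0 i)%R].
Proof.
move=> tt0 dz; have /andP[t_gt0 t_lt] := tt0.
have [s [k [s_gt0 st0 s0 ek xk]]] := window_data tt0.
pose e l := eps (k l); have e_gt0 l : 0 < e l by exact: eps_gt0.
pose len l := s l / e l; have len_gt0 l : 0 < len l by rewrite divr_gt0.
have h0 l : 0 < harmonic l :> R by rewrite invr_gt0.
(* More than [len l * l.+1] samples keep the mesh [eta l] at most [1 / l.+1]. *)
pose M_ l := (Num.truncn (len l * l.+1%:R)).+1.
have M_gt0 l : (0 < M_ l)%N by [].
have MR_gt0 l : 0 < (M_ l)%:R :> R by rewrite ltr0n.
pose eta l := len l / (M_ l)%:R.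
have etaM l : (M_ l)%:R * eta l = len l by rewrite mulrC divfK// gt_eqF.
have eta_gt0 l : 0 < eta l by rewrite divr_gt0.
have eta_le l : eta l <= harmonic l.
  by rewrite ler_pdivrMr// -ler_pdivrMl// invrK mulrC; apply/ltW; exact: truncnS_gt.
have eta0 : eta @ \oo --> 0.
  apply: (squeeze_cvgr (f := fun=> 0) (h := harmonic)); [|exact: cvg_cst|exact: cvg_harmonic].
  by apply: nearW => l; rewrite ltW//=.
pose kappa l := C * s l + s l * harmonic l.
have kappa0 : kappa @ \oo --> 0.
  have -> : 0 = C * 0 + 0 * 0 :> R by rewrite !mulr0 addr0.
  by apply: cvgD; [apply: cvgMr|apply: cvgM => //; exact: cvg_harmonic].
pose tau l := t / e l.
have oo_of (u : nat -> R) : (forall l, l.+1%:R <= u l) -> u @ \oo --> +oo.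
  move=> Hu; apply/cvgryPge => A; have := nbhs_infty_ger A.
  apply: filterS => l /le_trans; apply; apply: le_trans (Hu l).
  by rewrite ler_nat.
have tauoo : tau @ \oo --> +oo.
  apply: oo_of => l; rewrite ler_pdivlMr// mulrC -ler_pdivlMr//.
  exact: (ek l).2.
have lenoo : (fun l => (M_ l)%:R * eta l) @ \oo --> +oo.
  apply: oo_of => l; rewrite etaM ler_pdivlMr// mulrC -ler_pdivlMr//.
  exact: (ek l).1.
have in0 l r : 0 <= r <= (M_ l)%:R * eta l -> 0 <= t + e l * r <= t0.
  rewrite etaM => /andP[r0 rl]; rewrite addr_ge0 ?(ltW t_gt0) ?mulr_ge0 ?(ltW (e_gt0 l))//=.
  by apply: le_trans (st0 l); rewrite lerD2l mulrC -ler_pdivlMr.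
pose Xf l r := x (k l) (t + e l * r); pose Yf l r := y (k l) (t + e l * r).
have Ydw l r : 0 <= r <= (M_ l)%:R * eta l -> dw `[0, (M_ l)%:R * eta l] (Yf l) r
    (vf (flow (tau l + r) (base0 S)) (Xf l r) (Yf l r)).
  move=> rl; have := (xy_sol (k l) (t := t + e l * r)) _.
  rewrite /= in_itv /= => /(_ (in0 l r rl))[_ /(dw_itv_shift (e_gt0 l))].
  rewrite scalerA mulfV ?gt_eqF// scale1r mulrDl [e l * r / _]mulrAC mulfV ?gt_eqF// mul1r.
  by apply: dwS => q /=; rewrite !in_itv /=; exact: in0.
have Yrho l r : 0 <= r <= (M_ l)%:R * eta l -> `|Yf l r| <= rho.
  by move=> rl; apply: y_rho; exact: in0.
have tin : 0 <= t <= t0 by rewrite !ltW.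
have Xz l r : 0 <= r <= s l -> `|z t - x (k l) (t + r)| <= kappa l.
  move=> /andP[r0 rs].
  have trin : 0 <= t + r <= t0 by rewrite addr_ge0 ?(ltW t_gt0)//= (le_trans _ (st0 l))// lerD2l.
  rewrite -(subrKA (x (k l) t)) addrC (le_trans (ler_normD _ _))//; apply: lerD.
    apply: le_trans (x_lip _ tin trin) _; rewrite ler_wpM2l//.
    by rewrite opprD addNKr normrN ger0_norm.
  by rewrite distrC; exact: xk.
have Xxb l r : 0 <= r <= (M_ l)%:R * eta l -> `|z t - Xf l r| <= kappa l.
  rewrite etaM => /andP[r0 rl]; apply: Xz; rewrite mulr_ge0 ?(ltW (e_gt0 l))//=.
  by rewrite mulrC -ler_pdivlMr.
have [U [UU Uoo]] := @ultraFilterLemma _ \oo _.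
have [p [pc pinv patt porb]] := @window_measure R n m S (z t) rho tau eta kappa M_ Xf Yf
  M_gt0 eta_gt0 eta0 kappa0 tauoo lenoo Ydw Yrho Xxb U UU Uoo.
exists p; split; [exact: pinv|exact: patt|exact: porb|].
move=> i.
pose phi (q : Zs) : R := f (z t, q.2) 0 i.
have phiB q : `|phi q| <= a + b * `|z t|.
  by apply: le_trans (rV_norm_coord _ _) _; exact: f_growth.
have phic : continuous phi.
  move=> q.
  have c1 := @comp2_continuous_at _ _ _ _ f (fun=> z t) (@snd P Y) q fc (@cst_continuous_at _ _ (z t) q) (@snd_continuous_at _ _ q).
  exact: (@comp_continuous_at _ _ _ (fun v : X => v 0 i) _ q (@coord_continuous _ _ _ 0 i) c1).
have H1 := pc phi _ phic phiB.
(* [U] refines the filter of [\oo], so this limit must agree with the integral obtained along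
   [U]. *)
suff H2 : avg M_ (@sample R n m S tau eta Yf) phi @ \oo --> v 0 i.
  have H3 : avg M_ (@sample R n m S tau eta Yf) phi @ U --> v 0 i.
    by apply: cvg_trans H2; exact: cvg_app.
  by rewrite -(cvg_lim _ H3)// (cvg_lim _ H1).
have [C' C'0 HC'] := @window_lipschitz R n m S (z t) rho tau eta kappa M_ Xf Yf Ydw Yrho Xxb.
apply/cvgrPdist_le => om om0; have om30 : 0 < om / 3 by rewrite divr_gt0.
have [df df0 Hf] := f_unif (Num.max `|z t| rho) om30.
have [dz0 dz00 Hz] := dz _ om30.
have N1 : \forall l \near \oo, kappa l < Num.min df 1.
  move/cvgrPdist_lt : kappa0 => /(_ (Num.min df 1)).
  rewrite lt_min df0 ltr01 => /(_ isT); apply: filterS => l.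
  by rewrite sub0r normrN; apply: le_lt_trans; exact: ler_norm.
have N2 : \forall l \near \oo, eta l < df / C'.
  move/cvgrPdist_lt : eta0 => /(_ (df / C')).
  rewrite divr_gt0// => /(_ isT); apply: filterS => l.
  by rewrite sub0r normrN gtr0_norm.
have N3 : \forall l \near \oo, s l < dz0.
  move/cvgrPdist_lt : s0 => /(_ _ dz00); apply: filterS => l.
  by rewrite sub0r normrN gtr0_norm.
have N4 : \forall l \near \oo, harmonic l < om / 6.
  have := @cvg_harmonic R; move/cvgrPdist_lt => /(_ (om / 6)).
  rewrite divr_gt0// => /(_ isT); apply: filterS => l.
  by rewrite sub0r normrN gtr0_norm.
apply: filterS2 (filterI N1 N2) (filterI N3 N4) => l [].
rewrite lt_min => /andP[kd k1] etad [sd hd].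
pose w j := f (z t, Yf l (j%:R * eta l)).
have -> : avg M_ (@sample R n m S tau eta Yf) phi l = ((M_ l)%:R^-1 *: \sum_(j < M_ l) w j) 0 i.
  by rewrite mxE summxE mulrC.
have -> : v 0 i - ((M_ l)%:R^-1 *: \sum_(j < M_ l) w j) 0 i =
  (v - (M_ l)%:R^-1 *: \sum_(j < M_ l) w j) 0 i by rewrite [RHS]mxE [X in _ = _ + X]mxE.
apply: le_trans (rV_norm_coord _ _) _.
(* After multiplication by the window length, the increment of the slow component is compared with
   the Riemann sum in [B1] and with [s l *: v] in [B2]. *)
rewrite -(ler_pM2l (s_gt0 l)) -[X in X * `|_|]gtr0_norm// -normrZ.
set SW := _ *: (_ - _).
pose h := e l * eta l.
have Mh : (M_ l)%:R * h = s l by rewrite mulrCA etaM mulrC divfK// gt_eqF.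
have hs : s l / (M_ l)%:R = h by rewrite -Mh mulrC mulKf// gt_eqF.
have SWE : SW = (x (k l) (t + s l) - x (k l) t - h *: \sum_(j < M_ l) w j)
   - (x (k l) (t + s l) - x (k l) t - s l *: v).
  by rewrite /SW scalerBr scalerA hs opprB [RHS]addrC subrKA.
have h_ge0 : 0 <= h by rewrite mulr_ge0 ?(ltW (e_gt0 l)) ?(ltW (eta_gt0 l)).
have hM j : (j <= M_ l)%N -> j%:R * h <= s l by move=> jM; rewrite -Mh ler_wpM2r// ler_nat.
have B1 : `|x (k l) (t + s l) - x (k l) t - h *: \sum_(j < M_ l) w j| <= om / 3 * s l.
  have := @cell_increments R _ t h (om / 3) (M_ l) (x (k l))
    (fun r => f (x (k l) r, y (k l) r)) w h_ge0 (ltW om30).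
  rewrite Mh; apply.
    move=> r /andP[r1 r2]; have sub q : t <= q <= t + s l -> 0 <= q <= t0.
      by move=> /andP[q1 q2]; rewrite (le_trans (ltW t_gt0) q1) (le_trans q2 (st0 l)).
    have rin : 0 <= r <= t0 by apply: sub; rewrite r1.
    by apply: dwS (xy_sol _ _).1; [move=> q /=; rewrite !in_itv /=; exact: sub|rewrite /= in_itv].
  move=> j r jM /andP[r1 r2].
  have rt : t <= r by apply: le_trans r1; rewrite lerDl mulr_ge0.
  have rs : r - t <= s l.
    by rewrite lerBlDl (le_trans r2)// lerD2l hM.
  have xr : `|z t - x (k l) r| <= kappa l.
    by have := Xz l (r - t); rewrite subrKC subr_ge0 rt rs; exact.
  have jin : 0 <= j%:R * eta l <= (M_ l)%:R * eta l.
    by rewrite mulr_ge0 ?(ltW (eta_gt0 l))//= ler_pM2r// ler_nat ltnW.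
  rewrite distrC; apply: Hf.
  - by rewrite le_max lexx.
  - by rewrite le_max Yrho ?orbT.
  - exact: le_lt_trans kd.
  - have -> : y (k l) r = Yf l ((r - t) / e l).
      by rewrite /Yf mulrC divfK ?gt_eqF// subrKC.
    have jr : j%:R * eta l <= (r - t) / e l.
      by rewrite ler_pdivlMr// -mulrA [eta l * _]mulrC lerBrDl.
    have rj : (r - t) / e l <= j%:R * eta l + eta l.
      rewrite ler_pdivrMr// mulrDl -mulrA [eta l * _]mulrC lerBlDl.
      by move: r2; rewrite -natr1 mulrDl mul1r.
    rewrite distrC; apply: (@le_lt_trans _ _ (C' * ((r - t) / e l - j%:R * eta l))).
      apply: HC' => //; [exact: ltW|by have /andP[] := jin|].
      by rewrite etaM ler_pM2r ?invr_gt0.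
    apply: (@le_lt_trans _ _ (C' * eta l)); first by rewrite ler_pM2l// lerBlDl.
    by rewrite mulrC -ltr_pdivlMr.
(* The derivative of [z] at [t] costs [om / 3 * s l], and exchanging [x (k l)] for [z] at the two
   ends costs [s l * harmonic l] each; these two make up the last third. *)
have B2 : `|x (k l) (t + s l) - x (k l) t - s l *: v| <= om / 3 * s l + (s l * harmonic l + s l * harmonic l).
  have tsin : 0 <= t + s l <= t0 by rewrite addr_ge0 ?(ltW t_gt0) ?(ltW (s_gt0 l)) ?st0.
  have E : t + s l - t = s l by ring.
  have := Hz (t + s l); rewrite /= in_itv /= E gtr0_norm//.
  move=> /(_ tsin sd) Hz'.
  have -> : x (k l) (t + s l) - x (k l) t - s l *: v = (z (t + s l) - z t - s l *: v) +
      ((x (k l) (t + s l) - z (t + s l)) - (x (k l) t - z t)).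
    rewrite [RHS]addrAC; congr (_ - _).
    rewrite (_ : x (k l) (t + s l) - z (t + s l) - (x (k l) t - z t) =
      x (k l) (t + s l) - x (k l) t - (z (t + s l) - z t)) ?subrKC//.
    by rewrite !opprB addrACA [RHS]addrACA; congr (_ + _); exact: addrC.
  apply: le_trans (ler_normD _ _) _; apply: lerD => //.
  by apply: le_trans (ler_normB _ _) _; apply: lerD; exact: xk.
rewrite SWE (le_trans (ler_normB _ _))//.
have hs6 : harmonic l * s l <= om / 6 * s l by rewrite ler_pM2r// ltW.
clear -B1 B2 hs6; lra.
Qed.

End Averaging.

(** * Attractors over the hull *)

Lemma dw_unique {R : realType} {V : normedModType R} (L s : R) (u v u' v' : R -> V) :
  0 <= s -> 0 <= L -> u 0 = v 0 ->
  (forall t, 0 <= t <= s -> dw `[0, s] u t (u' t)) ->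
  (forall t, 0 <= t <= s -> dw `[0, s] v t (v' t)) ->
  (forall t, 0 <= t <= s -> `|u' t - v' t| <= L * `|u t - v t|) ->
  u s = v s.
Proof.
move=> s0 L0 uv0 du dv uv; apply/eqP; rewrite -subr_eq0 -normr_le0; apply/ler_addgt0Pr => e e0.
rewrite add0r.
pose c := (s + 1) * expR (L * s).
have s10 : 0 < s + 1 by rewrite ltr_wpDl.
have c0 : 0 < c by rewrite mulr_gt0// expR_gt0.
have ec0 : 0 < e / c by rewrite divr_gt0.
have B : (0 + e / c * (s - 0)) * expR (L * (s - 0)) <= e.
  rewrite add0r subr0 -mulrA [leRHS](_ : e = e / c * c); last by rewrite divfK// gt_eqF.
  by rewrite ler_pM2l// ler_wpM2r ?expR_ge0// lerDl.
have := @dw_gronwall R V 0 s L (e / c) 0 e (fun t => u t - v t) (fun t => u' t - v' t)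
  L0 ec0 (lexx _).
rewrite uv0 subrr normr0 lexx => /(_ isT B) H.
apply: le_trans (H _ _ s _) B; last by rewrite s0 lexx.
  by move=> t ts; apply: dwB; [exact: du|exact: dv].
move=> t ts _; apply: le_trans (uv t ts) _; rewrite lerDl; apply: ltW; exact: divr_gt0.
Qed.

Section HullSystem.
Context {R : realType} {n m : nat} (g : vfield R n m)
  (d : vfield R n m -> vfield R n m -> R).
Hypothesis d_metric : metrizes (hull g) d.
Hypothesis g_adm : admissible g.
Hypothesis g_lip : uniformly_lipschitz g.
Hypothesis fwd_sol : forall h x y0, hull g h -> exists u, fast_sol h x 0 y0 u.
Hypothesis g_uub : forall K0 : set 'rV[R]_n, compact K0 -> unif_ult_bounded g K0.
Notation X := 'rV[R]_n.
Notation Y := 'rV[R]_m.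
Notation VF := (vfield R n m).
Notation P := (hull_space d_metric (hull_g g_adm)).

Definition hsol (p : P) (x : X) (y : Y) : R -> Y := ysol (hfield p) x 0 y.

Lemma hsol_spec p x y : fast_sol (hfield p) x 0 y (hsol p x y).
Proof. by apply: getPex; apply: fwd_sol; exact: hfieldP. Qed.

Lemma hsol0 p x y : hsol p x y 0 = y.
Proof. by have [] := hsol_spec p x y. Qed.

Lemma hsolP p x y t : 0 <= t ->
  dw `[0, +oo[ (hsol p x y) t (hvec (hflow t p) x (hsol p x y t)).
Proof. by move=> t0; rewrite hvec_flow; apply/deriv_withinP; exact: (hsol_spec p x y).2. Qed.

Lemma fast_sol_unique h x y u v t : hull g h -> fast_sol h x 0 y u -> fast_sol h x 0 y v ->
  0 <= t -> u t = v t.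
Proof.
move=> Hh [u0 du] [v0 dv] t0.
have sub w r : (forall tau, 0 <= tau -> deriv_within `[0, +oo[ w tau (h (x, w tau, tau))) ->
    0 <= r <= t -> dw `[0, t] w r (h (x, w r, r)).
  move=> dw_ /andP[r0 rt]; have /deriv_withinP := dw_ r r0; apply: dwS => q /=.
  by rewrite !in_itv /= => /andP[-> _].
have [Mu HMu] := dw_bounded (fun r => @sub u r du).
have [Mv HMv] := dw_bounded (fun r => @sub v r dv).
have [L L0 HL] := hull_lip g_lip (Num.max (Num.max Mu Mv) `|x|).
apply: (dw_unique t0 L0 (u' := fun r => h (x, u r, r)) (v' := fun r => h (x, v r, r))).
- by rewrite u0 v0.
- by move=> r; exact: sub.
- by move=> r; exact: sub.
- by move=> r rt; apply: HL => //; rewrite !le_max ?lexx ?HMu ?HMv ?orbT.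
Qed.

Lemma hull_space_dense (p : P) e : 0 < e -> exists s, ball p e (hflow s (point : P)).
Proof.
move=> e0; have [_ _ _ _ H] := d_metric.
have : within (hull g) (nbhs (hfield p)) [set k | hull g k -> d (hfield p) k < e].
  by apply/(H _ _ (hfieldP p)); exists e => // k _ kd _.
move=> H1; have [hcl _] := hfieldP p.
have [k [[s _ <-] Hk]] := hcl _ H1; exists s; apply/hull_ballE => /=.
by apply: Hk; exact: hull_translate (hull_g g_adm).
Qed.

(** [ysol] is a choice among solutions, so the two sides can be identified only through uniqueness.
    A solution of [g] starting at [s] is obtained by shifting one of [translate g s] starting at
    0. *)
Lemma hsol_translate (s : R) x y t : 0 <= t ->
  hsol (hflow s (point : P)) x y t = ysol g x s y (t + s).
Proof.
move=> t0; pose v := hsol (hflow s (point : P)) x y.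
have [v0 dv] : fast_sol (translate g s) x 0 y v := hsol_spec _ x y.
have E : exists u, fast_sol g x s y u.
  exists (fun r => v (- s + r)); split => [|r sr]; first by rewrite addNr.
  have rs : 0 <= - s + r by rewrite addrC subr_ge0.
  have /deriv_withinP H := dv _ rs.
  apply/deriv_withinP; have := dw_shift H.
  rewrite /translate /= [- s + r + s]addrC addrA subrr add0r.
  by apply: dwS => q /=; rewrite !in_itv /= !andbT addrC subr_ge0.
have [w0 dw_] := getPex E; rewrite -/(ysol g x s y) in w0 dw_.
have Hh : hull g (translate g s) by exact: hull_translate (hull_g g_adm).
suff F : fast_sol (translate g s) x 0 y (fun r => ysol g x s y (s + r)).
  by rewrite [t + s]addrC; exact: (fast_sol_unique Hh (conj v0 dv) F t0).
split => [|r r0]; first by rewrite addr0.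
have sr : s <= s + r by rewrite lerDl.
have /deriv_withinP H := dw_ _ sr.
apply/deriv_withinP; have := dw_shift H.
rewrite /translate /= [r + s]addrC.
by apply: dwS => q /=; rewrite !in_itv /= !andbT lerDl.
Qed.

Lemma hsol_ub (r : R) : exists2 c : R, 0 < c & forall rho : R, exists2 T : R, 0 <= T &
  forall s x y t, `|x| <= r -> `|y| <= rho -> T <= t ->
  `|hsol (hflow s (point : P)) x y t| <= c.
Proof.
have [c c0 H] := g_uub (@compact_closed_ball0 R n r); exists c => // rho.
(* A Euclidean radius containing the sup-norm ball; the added 1 makes it positive, as
   [unif_ult_bounded] asks. *)
have rho0 : 0 < m.+1%:R * `|rho| + 1 :> R by rewrite ltr_wpDl// mulr_ge0.
have [T T0 {}H] := H _ rho0; exists T => // s x y t xr yr Tt.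
rewrite hsol_translate ?(le_trans T0)//; apply: le_trans (norm_le_eucl _) _.
apply: H => //; apply: le_trans (eucl_le_norm _) _.
by rewrite ler_wpDr// ler_wpM2l// (le_trans yr)// ler_norm.
Qed.

Lemma hvec_lip (r : R) : exists2 L : R, 0 <= L & forall (p : P) x y1 y2,
  `|x| <= r -> `|y1| <= r -> `|y2| <= r -> `|hvec p x y1 - hvec p x y2| <= L * `|y1 - y2|.
Proof.
have [L L0 H] := hull_lip g_lip r; exists L => // p x y1 y2 xr y1r y2r.
by apply: H => //; exact: hfieldP.
Qed.

Definition hull_system : fast_system R n m := @FastSystem R n m
  [the pseudoPMetricType R of P] (@hflow _ _ _ g d d_metric (hull_g g_adm)) (@hvec _ _ _ g d d_metric (hull_g g_adm)) hsol point
  (@hull_space_compact _ _ _ g d d_metric (hull_g g_adm) g_adm) (@hull_hausdorff _ _ _ g d d_metric (hull_g g_adm))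
  (@hflow0 _ _ _ _ _ _ _) (@hflowD _ _ _ _ _ _ _) (@hflow_continuous _ _ _ _ _ _ _)
  (@hvec_continuous _ _ _ _ _ _ _) hvec_lip hsol0 hsolP hull_space_dense hsol_ub.

End HullSystem.

(** Singletons are compact, so evaluation at a point is continuous for the compact-open topology, at
    discontinuous functions too. *)
Lemma vfield_hausdorff {R : realType} {n m : nat} : hausdorff_space (vfield R n m).
Proof.
move=> h k hk; apply/funext => q; apply: (@norm_hausdorff R 'rV[R]_m) => A B hA kB.
have ev (l : vfield R n m) C : nbhs (l q) C -> nbhs l [set u : vfield R n m | C (u q)].
  rewrite nbhsE => -[V [oV Vl] VC].
  have oE : open ([set u | u @` [set q] `<=` V] : set (vfield R n m)).
    by apply: compact_open_open => //; exact: compact_set1.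
  have : nbhs l ([set u | u @` [set q] `<=` V] : set (vfield R n m)).
    by apply: open_nbhs_nbhs; split => // _ [_ -> <-].
  by apply: filterS => u Hu; apply: VC; apply: Hu; exists q.
by have [u [Au Bu]] := hk _ _ (ev h A hA) (ev k B kB); exists (u q).
Qed.

Section Semidist.
Context {R : realType} {V : Type} (dV : V -> V -> R).

Lemma semidist_le (A B : set V) (e : R) :
  (forall a, A a -> exists2 b, B b & dV a b <= e) -> (semidist dV A B <= e%:E)%E.
Proof.
move=> H; apply: ge_ereal_sup => _ [a Aa <-].
have [b Bb ab] := H a Aa; apply: (@le_trans _ _ (dV a b)%:E); last by rewrite lee_fin.
by apply: ereal_inf_lbound; exists b.
Qed.

Lemma semidist_ge0 (A B : set V) : (forall a b, 0 <= dV a b) -> A !=set0 ->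
  (0 <= semidist dV A B)%E.
Proof.
move=> d0 [a Aa]; apply: (@le_trans _ _ (ereal_inf [set (dV a b)%:E | b in B])).
  by apply: le_ereal_inf_tmp => _ [b _ <-]; rewrite lee_fin.
by apply: ereal_sup_ubound; exists a.
Qed.

Lemma semidist_lt (A B : set V) (e : R) : (semidist dV A B < e%:E)%E ->
  forall a, A a -> exists2 b, B b & dV a b < e.
Proof.
move=> H a Aa.
have : (ereal_inf [set (dV a b)%:E | b in B] < e%:E)%E.
  by apply: le_lt_trans H; apply: ereal_sup_ubound; exists a.
by move=> /ereal_inf_lt[_ [b Bb <-]]; rewrite lte_fin => ab; exists b.
Qed.

Lemma cvgy_ereal0 (F : R -> \bar R) :
  (forall e : R, 0 < e -> exists T : R, forall t, T <= t -> (0 <= F t <= e%:E)%E) ->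
  F t @[t --> +oo] --> 0%E.
Proof.
move=> H.
have near_oo (T : R) (Q : R -> Prop) : (forall t, T <= t -> Q t) -> \forall t \near +oo, Q t.
  move=> HQ; exists T; split; first exact: num_real.
  by move=> t /ltW; exact: HQ.
apply/fine_cvgP; split.
  have [T HT] := H 1 ltr01; apply: (near_oo T) => t /HT /andP[F0 F1].
  by rewrite ge0_fin_numE// (le_lt_trans F1)// ltry.
apply/cvgrPdist_le => e e0; have [T HT] := H e e0; apply: (near_oo T) => t /HT /= /andP[F0 F1].
have Ff : F t \is a fin_num by rewrite ge0_fin_numE// (le_lt_trans F1)// ltry.
by rewrite sub0r normrN ger0_norm ?fine_ge0// -lee_fin fineK.
Qed.

Lemma cvgy_lt0 (F : R -> \bar R) (e T0 : R) : 0 < e -> F t @[t --> +oo] --> 0%E ->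
  exists2 T : R, T0 < T & (F T < e%:E)%E.
Proof.
move=> e0 H.
have N : nbhs (0 : \bar R)%E [set x | (x < e%:E)%E].
  by apply: (@open_ereal_lt' R 0%E e%:E); rewrite lte_fin.
have [M [_ HM]] := H _ N; exists (Num.max M T0 + 1).
  by rewrite ltr_pwDr// le_max lexx orbT.
by apply: HM; rewrite ltr_pwDr// le_max lexx.
Qed.

End Semidist.

Section AttractorTransport.
Context {R : realType} {k : nat} {W : pseudoMetricType R} {W' : topologicalType}.
Notation Y := 'rV[R]_k.
Notation Z := (W * Y)%type.
Variables (B : set W) (phi : R -> Z -> Z).
Hypothesis WH : hausdorff_space W.
Hypothesis Bc : compact B.
Hypothesis Bcl : closed B.
Hypothesis B0 : B !=set0.
Hypothesis phiD : forall (s t : R) z, 0 <= s -> 0 <= t -> B z.1 ->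
  phi (s + t) z = phi t (phi s z).
Hypothesis phiB : forall (t : R) z, 0 <= t -> B z.1 -> B (phi t z).1.
Hypothesis phic : forall t : R, 0 <= t -> continuous (phi t).
Variable rho : R.
Hypothesis absorb : forall r : R, exists2 T : R, 0 <= T & forall (t : R) z,
  T <= t -> B z.1 -> `|z.2| <= r -> `|(phi t z).2| <= rho.
Variables (i : W -> W') (dW : W' -> W' -> R) (c : R) (phi' : R -> W' * Y -> W' * Y).
Hypothesis ic : continuous i.
Hypothesis c0 : 0 < c.
Hypothesis dW_le : forall w w' (e : R), 0 < e -> ball w e w' -> dW (i w) (i w') <= c * e.
Hypothesis phi'E : forall t z, 0 <= t -> B z.1 -> phi' t (i z.1, z.2) = (i (phi t z).1, (phi t z).2).

Let j (z : Z) : W' * Y := (i z.1, z.2).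

(** The semiflow [phi'] on the target is controlled only over the image of [B]. The attractor is
    built on the source, where [phi] is continuous, and mapped forward by [j]. *)
Lemma attractor_transport : exists A, is_global_attractor (i @` B) dW phi' A.
Proof.
have [A [AB A0 Ac Ainv Aatt]] := attractor_exists WH Bc Bcl B0 phiD phiB phic absorb.
have jc : continuous j.
  move=> z; have c1 := @comp_continuous_at _ _ _ i (@fst W Y) z ic (@fst_continuous_at _ _ z).
  exact: (@pair_continuous_at _ _ _ _ _ z c1 (@snd_continuous_at _ _ z)).
exists (j @` A); split.
- by move=> _ [z Az <-] /=; have [Bz _] := AB z Az; split => //; exists z.1.
- by have [z Az] := A0; exists (j z), z.
- by apply: continuous_compact => //; exact: continuous_subspaceT.
- move=> t t0; rewrite -[in RHS](Ainv t t0); apply/seteqP; split.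
    move=> _ [_ [z Az <-] <-]; rewrite phi'E//; last by have [] := AB z Az.
    by exists (phi t z) => //; exists z.
  move=> _ [_ [z Az <-] <-]; exists (j z); first by exists z.
  by rewrite /j phi'E//; have [] := AB z Az.
move=> D [y0 Dy0] Db; apply: cvgy_ereal0 => e e0.
have [r HDr] : exists r : R, forall y, D y -> `|y| <= r.
  move: Db => /= [M [_ HM]]; exists (M + 1); exact: (HM _ (ltr_pwDr ltr01 (lexx _))).
(* [c] turns balls of the base into [dW], and [k.+1] the sup norm into the Euclidean one. *)
pose c' := Num.max c k.+1%:R; have c'0 : 0 < c' by rewrite lt_max c0.
pose e' := e / c'; have e'0 : 0 < e' by rewrite divr_gt0.
have e'e : c' * e' = e by rewrite mulrC divfK// gt_eqF.
pose N := \bigcup_(a in A) ball a e'.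
have [||T HT] := Aatt r N°.
- exact: open_interior.
- move=> a Aa; apply: filterS (nbhsx_ballx a e' e'0) => z az; by exists a.
exists (Num.max T 0) => t; rewrite ge_max => /andP[Tt t0].
apply/andP; split.
  apply: semidist_ge0 => [p q|]; first by rewrite le_max sqrtr_ge0 orbT.
  have [b Bb] := B0; exists (phi' t (i b, y0)); exists (i b, y0) => //.
  by split => //=; exists b.
apply: semidist_le => _ [[w y] [/= [b Bb <-] Dy] <-].
have [a Aa [ab1 ab2]] : N (phi t (b, y)).
  by apply: interior_subset; apply: HT => //; exact: HDr.
exists (j a); first by exists a.
rewrite (phi'E (z := (b, y)))//= ge_max; apply/andP; split.
  apply: (@le_trans _ _ (c * e')); last by rewrite -e'e ler_pM2r// le_max lexx.
  by apply: dW_le => //; exact: ball_sym.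
apply: le_trans (eucl_le_norm _) _.
apply: (@le_trans _ _ (k.+1%:R * e')); last by rewrite -e'e ler_pM2r// le_max lexx orbT.
by rewrite ler_pM2l// distrC; move: ab2; rewrite -ball_normE => /ltW.
Qed.

End AttractorTransport.

Lemma bounded_closed_ball {R : realType} {k : nat} (r : R) : bounded_set [set y : 'rV[R]_k | `|y| <= r].
Proof.
exists r; split; first exact: num_real.
by move=> M /ltW rM y /= yr; exact: le_trans rM.
Qed.

Lemma compact_norm_bounded {R : realType} {k : nat} (K : set 'rV[R]_k) : compact K ->
  exists r : R, forall y, K y -> `|y| <= r.
Proof.
move=> /compact_bounded[M [_ HM]]; exists (M + 1); exact: (HM _ (ltr_pwDr ltr01 (lexx _))).
Qed.

Lemma hausdorff_pair {T U : topologicalType} :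
  hausdorff_space T -> hausdorff_space U -> hausdorff_space (T * U)%type.
Proof.
move=> TH UH [t u] [t' u'] H; congr pair.
  apply: TH => A B tA tB.
  have hA : nbhs (t, u) (A `*` setT) by exists (A, setT) => //; split => //; exact: filterT.
  have hB : nbhs (t', u') (B `*` setT) by exists (B, setT) => //; split => //; exact: filterT.
  by have [[x y] [[/= Ax _] [/= Bx _]]] := H _ _ hA hB; exists x.
apply: UH => A B uA uB.
have hA : nbhs (t, u) (setT `*` A) by exists (setT, A) => //; split => //; exact: filterT.
have hB : nbhs (t', u') (setT `*` B) by exists (setT, B) => //; split => //; exact: filterT.
by have [[x y] [[/= _ Ay] [/= _ By]]] := H _ _ hA hB; exists y.
Qed.

Lemma frozen_flowD {R : realType} {n m : nat} (S : fast_system R n m) (x : 'rV[R]_n) (s t : R) z :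
  0 <= s -> 0 <= t ->
  @frozen_flow _ _ _ S x (s + t) z = frozen_flow x t (frozen_flow x s z).
Proof.
move=> s0 t0; rewrite /frozen_flow /= sol_cocycle//; congr pair.
by rewrite addrC flowD.
Qed.

Section HullAttractors.
Context {R : realType} {n m : nat} (g : vfield R n m)
  (d : vfield R n m -> vfield R n m -> R).
Hypothesis d_metric : metrizes (hull g) d.
Hypothesis g_adm : admissible g.
Hypothesis g_lip : uniformly_lipschitz g.
Hypothesis fwd_sol : forall h x y0, hull g h -> exists u, fast_sol h x 0 y0 u.
Hypothesis g_uub : forall K0 : set 'rV[R]_n, compact K0 -> unif_ult_bounded g K0.
Notation X := 'rV[R]_n.
Notation Y := 'rV[R]_m.
Notation VF := (vfield R n m).
Notation P := (hull_space d_metric (hull_g g_adm)).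
Notation S := (hull_system d_metric g_adm g_lip fwd_sol g_uub).

Lemma hfield_image : @hfield _ _ _ _ _ d_metric (hull_g g_adm) @` setT = hull g.
Proof.
apply/seteqP; split => [_ [p _ <-]|h Hh]; first exact: hfieldP.
by exists (exist _ h Hh).
Qed.

(** [attractor_at] is picked by [get], so the existence of an attractor is what gives it its
    defining properties. *)
Lemma attractor_atP (x : X) :
  is_global_attractor (hull g) d (semiflow_at x) (attractor_at g d x).
Proof.
apply: getPex; rewrite -hfield_image.
have [c c0 Hc] := sol_ub S `|x|.
apply: (@attractor_transport R m P VF setT (@frozen_flow _ _ _ S x) _ _ _ _ _ _ _ c _
  (@hfield _ _ _ _ _ d_metric (hull_g g_adm)) d 1) => //.
- exact: (@base_hausdorff _ _ _ S).
- exact: (@base_compact _ _ _ S).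
- by exists point.
- by move=> s t z s0 t0 _; exact: (@frozen_flowD R n m S x s t z s0 t0).
- by move=> t t0; exact: (@frozen_flow_continuous R n m S x t t0).
- move=> r; have [T T0 HT] := Hc r; exists T => // t z Tt _ zr.
  by apply: HT.
- exact: hfield_continuous.
- by move=> w w' e e0 /hull_ballE/ltW; rewrite mul1r.
Qed.

Lemma attractor_at_closed (x : X) :
  closed [set z : P * Y | attractor_at g d x (hfield z.1, z.2)].
Proof.
have [_ _ Ac _ _] := attractor_atP x.
have Acl : closed (attractor_at g d x).
  apply: compact_closed Ac; apply: hausdorff_pair; [exact: vfield_hausdorff|exact: norm_hausdorff].
apply: (@closed_comp _ _ (fun z : P * Y => (hfield z.1, z.2))) => // z _.
have c1 := @comp_continuous_at _ _ _ _ (@fst P Y) z (@hfield_continuous _ _ _ _ _ d_metric (hull_g g_adm))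
  (@fst_continuous_at _ _ z).
exact: (@pair_continuous_at _ _ _ _ _ z c1 (@snd_continuous_at _ _ z)).
Qed.

(** Translates attraction in semidistance into attraction by open sets: the pullback of the
    attractor is compact, so [V] contains a uniform neighbourhood of it. *)
Lemma attractor_at_attracts (x : X) (rho : R) (V : set (P * Y)) : open V ->
  [set z : P * Y | attractor_at g d x (hfield z.1, z.2)] `<=` V ->
  exists s : R, 0 <= s /\ forall z, `|z.2| <= rho -> V (@frozen_flow _ _ _ S x s z).
Proof.
move=> oV AV; have [AH A0 Ac _ Aatt] := attractor_atP x.
pose A' := [set z : P * Y | attractor_at g d x (hfield z.1, z.2)].
have A'c : compact A'.
  have [r Hr] : exists r : R, forall q, attractor_at g d x q -> `|q.2| <= r.
    have := @continuous_compact _ _ (@snd VF Y) _ _ Ac.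
    move=> /(_ _)/wrap[]; first by apply: continuous_subspaceT => q; exact: cvg_snd.
    move=> /compact_norm_bounded[r Hr]; exists r => q Aq; apply: Hr; by exists q.
  have Kc : compact ([set: P] `*` [set y : Y | `|y| <= r]).
    by apply: compact_setX; [exact: (@base_compact _ _ _ S)|exact: compact_closed_ball0].
  have sub : A' `<=` [set: P] `*` [set y : Y | `|y| <= r] by move=> z Az; split => //; exact: (Hr _ Az).
  exact: (@subclosed_compact _ A' _ (@attractor_at_closed x) Kc sub).
have [e e0 He] := compact_ball_sub A'c oV AV.
(* Taking [Num.max rho 0] keeps the attracted ball nonempty. *)
have [||T T0] := cvgy_lt0 0 e0 (Aatt [set y | `|y| <= Num.max rho 0] _ _).
- by exists 0; rewrite /= normr0 le_max lexx orbT.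
- exact: bounded_closed_ball.
move=> /semidist_lt H; exists T; split; first exact: ltW.
move=> [p y] /= yr.
have [|[h y'] Ahy] := H (semiflow_at x T (hfield p, y)).
  exists (hfield p, y) => //; split; first exact: hfieldP.
  by rewrite /= le_max yr.
rewrite gt_max => /andP[/= dh dy].
have [/= Hh _] := AH _ Ahy.
apply: (He (exist _ h Hh, y')) => //; split; apply: ball_sym.
  by apply/hull_ballE.
by rewrite -ball_normE /=; apply: le_lt_trans dy; exact: norm_le_eucl.
Qed.

Section Layered.
Variable K0 : set X.
Hypothesis K0c : compact K0.
Hypothesis K00 : K0 !=set0.

(** The parameter [x] is a constant component of the base; boundedness of [K0] makes the absorbing
    radius the same on all layers. *)
Lemma layered_attractorP : is_global_attractor (hull g `*` K0) (dist_par d)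
  layered_semiflow (layered_attractor g d K0).
Proof.
apply: getPex.
pose i (w : P * X) : VF * X := (hfield w.1, w.2).
have -> : hull g `*` K0 = i @` ([set: P] `*` K0).
  apply/seteqP; split => [[h x] [/= Hh Kx]|_ [[p x] [_ /= Kx] <-]].
    by exists (exist _ h Hh, x).
  by split => //; exact: hfieldP.
have [r Hr] := compact_norm_bounded K0c.
have [c c0 Hc] := sol_ub S r.
pose phi (t : R) (z : P * X * Y) : P * X * Y := ((hflow t z.1.1, z.1.2), sol (f := S) z.1.1 z.1.2 z.2 t).
apply: (@attractor_transport R m _ _ ([set: P] `*` K0) phi _ _ _ _ _ _ _ c _ i (dist_par d) n.+1%:R) => //.
- by apply: hausdorff_pair; [exact: (@base_hausdorff _ _ _ S)|exact: norm_hausdorff].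
- by apply: compact_setX => //; exact: (@base_compact _ _ _ S).
- rewrite (_ : _ `*` _ = snd @^-1` K0); last by apply/seteqP; split => -[p x] //= [].
  apply: closed_comp; first by move=> z _; exact: cvg_snd.
  by apply: compact_closed => //; exact: norm_hausdorff.
- by have [x Kx] := K00; exists (point, x).
- move=> s t [[p x] y] s0 t0 _.
  exact: (f_equal (fun q : P * Y => (q.1, x, q.2)) (@frozen_flowD _ _ _ S x s t (p, y) s0 t0)).
- move=> t t0 z.
  have c1 := @comp_continuous_at _ _ _ fst (@fst (P * X)%type Y) z (fun q => @fst_continuous_at _ _ q) (@fst_continuous_at _ _ z).
  have c2 := @comp_continuous_at _ _ _ snd (@fst (P * X)%type Y) z (fun q => @snd_continuous_at _ _ q) (@fst_continuous_at _ _ z).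
  have c3 := @comp2_continuous_at _ _ _ _ (fun q : R * P => flow (f := S) q.1 q.2) (fun=> t)
    (fun q : P * X * Y => q.1.1) z (@flow_cont _ _ _ S) (@cst_continuous_at _ _ t z) c1.
  have c4 : {for z, continuous (fun q : P * X * Y => sol (f := S) q.1.1 q.1.2 q.2 t)}.
    exact: (@sol_continuous _ _ _ S t t0).
  have c5 := @pair_continuous_at _ _ _ _ _ z c3 c2.
  exact: (@pair_continuous_at _ _ _ _ _ z c5 c4).
- move=> r'; have [T T0 HT] := Hc r'; exists T => // t [[p x] y] Tt [_ /= Kx] yr.
  by apply: HT => //; exact: Hr.
- move=> w; have c1 := @comp_continuous_at _ _ _ _ (@fst P X) w
    (@hfield_continuous _ _ _ _ _ d_metric (hull_g g_adm)) (@fst_continuous_at _ _ w).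
  exact: (@pair_continuous_at _ _ _ _ _ w c1 (@snd_continuous_at _ _ w)).
- move=> [p x] [q x'] e e0 [/= /hull_ballE pq xx']; rewrite /dist_par ge_max /=; apply/andP; split.
    by rewrite (le_trans (ltW pq))// ler_peMl ?ler1n// ltW.
  apply: le_trans (eucl_le_norm _) _; rewrite ler_pM2l//.
  by move: xx'; rewrite -ball_normE => /ltW.
Qed.

Lemma layered_attracts (M e T0 : R) : 0 < e -> exists2 T : R, T0 < T &
  forall (p : P) x y, K0 x -> `|y| <= M ->
  exists2 q, layered_attractor g d K0 q &
    dist_par d (translate (hfield p) T, x) q.1 < e /\
    eucl_dist (sol (f := S) p x y T) q.2 < e.
Proof.
move=> e0; have [_ _ _ _ Aatt] := layered_attractorP.
have [||T T0T] := cvgy_lt0 T0 e0 (Aatt [set y | `|y| <= Num.max M 0] _ _).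
- by exists 0; rewrite /= normr0 le_max lexx orbT.
- exact: bounded_closed_ball.
move=> /semidist_lt H; exists T => // p x y Kx yM.
have [|q Aq] := H (layered_semiflow T (hfield p, x, y)).
  exists (hfield p, x, y) => //; split; last by rewrite /= le_max yM.
  by split => //; exact: hfieldP.
by rewrite gt_max => /andP[h1 h2]; exists q.
Qed.

(** The semiflow preserves layers, so attraction of a point over [x] brings points of the attractor
    over parameters arbitrarily near [x]; the projection is compact, hence closed. *)
Lemma layered_projection : [set q.1.2 | q in layered_attractor g d K0] = K0.
Proof.
have [AH _ Ac _ _] := layered_attractorP.
apply/seteqP; split => [_ [q /AH[[_ Kq] _] <-] //|x Kx].
have cl : closed [set q.1.2 | q in layered_attractor g d K0].
  apply: compact_closed; first exact: norm_hausdorff.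
  apply: continuous_compact => //; apply: continuous_subspaceT => z.
  exact: (@comp_continuous_at _ _ _ snd (@fst (VF * X)%type Y) z (fun q => @snd_continuous_at _ _ q) (@fst_continuous_at _ _ z)).
apply: cl => V /nbhs_ballP[e /= e0 eV].
have [T _ H] := layered_attracts 0 0 e0.
have [|q Aq [+ _]] := H point x 0 Kx; first by rewrite normr0.
rewrite gt_max => /andP[_ /= xq].
exists q.1.2; split; first by exists q.
by apply: eV; rewrite -ball_normE /=; apply: le_lt_trans xq; exact: norm_le_eucl.
Qed.

End Layered.

End HullAttractors.

Lemma uniform_cvg_normP {R : realType} {n : nat} (A : set R) (u : nat -> R -> 'rV[R]_n) (z : R -> 'rV[R]_n) :
  {uniform A, u @ \oo --> z} <->
  forall e : R, 0 < e -> \forall k \near \oo, forall t, A t -> `|u k t - z t| <= e.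
Proof.
split => [H e e0|H B /uniform_nbhs[E [entE EB]]].
  have N : nbhs (z : {uniform` A -> 'rV[R]_n}) [set h | forall t, A t -> `|h t - z t| <= e].
    apply/uniform_nbhs; exists [set vw | ball vw.1 e vw.2]; split; first by rewrite -entourage_ballE; exists e.
    by move=> h Hh t At; rewrite distrC; have := Hh t At; rewrite /= -ball_normE /= => /ltW.
  exact: (H _ N).
have [e /= e0 eE] : exists2 e : R, 0 < e & [set vw | ball vw.1 e vw.2] `<=` E.
  by move: entE; rewrite -entourage_ballE => -[e e0 He]; exists e.
have e20 : 0 < e / 2 by rewrite divr_gt0.
suff : \forall k \near \oo, B (u k) by [].
apply: filterS (H _ e20) => k Hk; apply: EB => t At; apply: eE => /=.
rewrite -ball_normE /= distrC; apply: le_lt_trans (Hk t At) _; lra.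
Qed.

Lemma abs_continuous_near {R : realType} {n : nat} (t0 : R) (z : R -> 'rV[R]_n) :
  abs_continuous 0 t0 z -> forall e, 0 < e -> exists2 eta : R, 0 < eta &
  forall s t, 0 <= s <= t0 -> 0 <= t <= t0 -> `|t - s| < eta -> `|z t - z s| < e.
Proof.
move=> ac e e0; have [eta eta0 H] := ac e e0; exists eta => //.
suff W s t : 0 <= s -> s <= t -> t <= t0 -> t - s < eta -> `|z t - z s| < e.
  move=> s t /andP[s0 s1] /andP[t1 t2]; have [st|ts] := leP s t.
    by rewrite ger0_norm ?subr_ge0// => ?; exact: W.
  by rewrite ltr0_norm ?subr_lt0// opprB distrC => ?; apply: W => //; exact: ltW.
move=> s_ge0 st tt0 ste.
have := H 1%N (fun=> s) (fun=> t); rewrite !big_ord1 => H1.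
apply: le_lt_trans (norm_le_eucl _) _; apply: H1 => //.
by move=> i j; rewrite !ord1 eqxx.
Qed.

Lemma tube_compact {R : realType} {n : nat} (t0 r : R) (z : R -> 'rV[R]_n) :
  abs_continuous 0 t0 z -> compact (tube z t0 r).
Proof.
move=> ac.
have zc : {within `[0, t0], continuous z}.
  apply/subspace_continuousP => t; rewrite /= in_itv /= => tt0; apply/cvgrPdist_lt => e e0.
  have [eta eta0 H] := abs_continuous_near ac e0.
  exists eta => //= s ts; rewrite in_itv /= => st0.
  by rewrite distrC; apply: H => //; rewrite distrC.
have Bc : compact [set x : 'rV[R]_n | eucl_norm x <= r].
  have cl : closed [set x : 'rV[R]_n | eucl_norm x <= r].
    have cs : continuous (fun x : 'rV[R]_n => \sum_i x ord0 i ^+ 2).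
      apply: (@continuous_big _ _ +%R 0 xpredT) => [|i _ x]; first exact: add_continuous.
      have c2 := @coord_continuous R 1 n ord0 i x.
      exact: (@comp_continuous_at _ _ _ (fun y : R => y ^+ 2) _ x (@exprn_continuous R 2) c2).
    have c1 : continuous (@eucl_norm R n).
      by move=> x; exact: (@comp_continuous_at _ _ _ (@Num.sqrt R) _ x (@sqrt_continuous R) (cs x)).
    rewrite (_ : [set x | _] = @eucl_norm R n @^-1` [set y | y <= r])//.
    by apply: closed_comp => [x _|]; [exact: c1|exact: closed_le].
  apply: subclosed_compact cl (@compact_closed_ball0 R n r) _ => x /= xr.
  exact: le_trans (norm_le_eucl x) xr.
have -> : tube z t0 r = (fun q : 'rV[R]_n * 'rV[R]_n => q.1 + q.2) @`
    ((z @` `[0, t0]) `*` [set x | eucl_norm x <= r]).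
  apply/seteqP; split => [_ [t tt0 [x xr <-]]|_ [[_ x] [/= [t tt0 <-] xr] <-]].
    by exists (z t, x) => //; split => //; exists t.
  by exists t => //; exists x.
apply: continuous_compact.
  by apply: continuous_subspaceT => q; apply: cvgD; [exact: cvg_fst|exact: cvg_snd].
apply: compact_setX => //; apply: continuous_compact zc _; exact: segment_compact.
Qed.

(** * Attraction of slowly driven fast solutions *)

Section SlowTracking.
Context {R : realType} {n m : nat} (g : vfield R n m)
  (d : vfield R n m -> vfield R n m -> R).
Hypothesis d_metric : metrizes (hull g) d.
Hypothesis g_adm : admissible g.
Hypothesis g_lip : uniformly_lipschitz g.
Hypothesis fwd_sol : forall h x y0, hull g h -> exists u, fast_sol h x 0 y0 u.
Hypothesis g_uub : forall K0 : set 'rV[R]_n, compact K0 -> unif_ult_bounded g K0.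
Notation X := 'rV[R]_n.
Notation Y := 'rV[R]_m.
Notation VF := (vfield R n m).
Notation P := (hull_space d_metric (hull_g g_adm)).
Notation S := (hull_system d_metric g_adm g_lip fwd_sol g_uub).

(** What is asked of an attraction time [T], for arbitrary slowly varying curves near [K0] and with
    no reference to [f] or to the small parameter, so that [T] can be fixed before the solutions are
    known. *)
Definition tracks (delta : R) (y0 : Y) (A : set (VF * X * Y)) (K0 : set X) (T : R) : Prop :=
  exists2 e1 : R, 0 < e1 & forall (p : P) (s : R) (Xf : R -> X) (v : R -> Y), T <= s ->
    `|v 0| <= `|y0| ->
    (forall t, 0 <= t <= s -> dw `[0, s] v t (hvec (hflow t p) (Xf t) (v t))) ->
    (forall t, 0 <= t <= s -> exists2 xb, K0 xb & `|xb - Xf t| <= e1) ->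
    (forall t t', 0 <= t <= s -> 0 <= t' <= s -> `|Xf t - Xf t'| <= e1 * `|t - t'|) ->
    forall xb, K0 xb -> `|xb - Xf s| <= e1 ->
    exists2 q, A q & dist_par d (translate (hfield p) s, xb) q.1 <= delta /\
      eucl_dist (v s) q.2 <= delta.

(* On the last stretch of length [T] the slow variable is frozen; by then the
   fast one is bounded, so [T] is an attraction time of the layered attractor. *)
Lemma tracks_exists (delta : R) (y0 : Y) (K0 : set X) : 0 < delta -> compact K0 -> K0 !=set0 ->
  exists2 T : R, 0 < T & tracks delta y0 (layered_attractor g d K0) K0 T.
Proof.
move=> delta0 K0c K00; have [r Hr] := compact_norm_bounded K0c.
(* The driving curve stays within 1 of [K0], hence in the ball of radius [r + 1]. *)
have [M [ec [ec0 Hc]]] := coupled_bounded S (r + 1) `|y0|.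
(* Two errors, freezing and attraction, each passing from the sup norm to the Euclidean one. *)
pose c := 2 * m.+1%:R : R; have c0 : 0 < c by rewrite mulr_gt0.
pose delta' := delta / c; have delta'0 : 0 < delta' by rewrite divr_gt0.
have cd : m.+1%:R * delta' + m.+1%:R * delta' = delta.
  rewrite -mulrDl (_ : _ + _ = c); last by rewrite /c mulr_natl mulr2n.
  by rewrite mulrC divfK// gt_eqF.
have dd : delta' <= delta.
  by rewrite ler_pdivrMr// ler_peMr ?(ltW delta0)// /c -natrM ler1n.
have [T T0 HT] := layered_attracts d_metric g_adm g_lip fwd_sol g_uub K0c K00 M 0 delta'0.
have [et et0 Ht] := tracking S r M (ltW T0) delta'0.
have T10 : 0 < 1 + T by rewrite addr_gt0.
(* The offset at time [s] and the drift over the last stretch add up to at most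
   [et / (1 + T) * (1 + T) = et]. *)
exists T => //; exists (Num.min 1 (Num.min ec (et / (1 + T)))).
  by rewrite !lt_min ltr01 ec0 divr_gt0.
move=> p s Xf v Ts v0 dv Xn Xl xb Kxb xbs.
have s0 : 0 <= s by rewrite (le_trans (ltW T0)).
have sin : 0 <= s <= s by rewrite s0 lexx.
have vM : forall t, 0 <= t <= s -> `|v t| <= M.
  apply: (Hc p s Xf v v0 dv).
    move=> t ts; have [xt Kxt] := Xn t ts; rewrite le_min => /andP[h1 _].
    rewrite -(subKr xt (Xf t)) (le_trans (ler_normB _ _))//; apply: lerD => //; exact: Hr.
  move=> t t' ts t's; apply: le_trans (Xl t t' ts t's) _.
  by rewrite ler_wpM2r// !ge_min lexx orbT.
pose sg := s - T; have sg0 : 0 <= sg by rewrite subr_ge0.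
have sgT : sg + T = s by rewrite subrK.
have sub t : 0 <= t <= T -> 0 <= sg + t <= s.
  by move=> /andP[t0 tT]; rewrite addr_ge0//= -sgT lerD2l.
have TT : 0 <= T <= T by rewrite (ltW T0) lexx.
have := Ht (flow (f := S) sg p) xb (fun t => Xf (sg + t)) (fun t => v (sg + t)) (Hr _ Kxb) _ _ _ T TT.
rewrite addr0 sgT => H.
have {}H : `|v s - sol (f := S) (flow (f := S) sg p) xb (v sg) T| <= delta'.
  apply: H.
  - by apply: vM; have := sub 0; rewrite addr0 lexx (ltW T0) => ->.
  - move=> t tT; rewrite -flowD [t + sg]addrC.
    apply: dwS (dw_shift (dv _ (sub t tT))) => q /=; rewrite !in_itv /=; exact: sub.
  - move=> t tT; rewrite -(subrKA (Xf s)) (le_trans (ler_normD _ _))//.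
    have e1 : Num.min 1 (Num.min ec (et / (1 + T))) <= et / (1 + T) by rewrite !ge_min lexx !orbT.
    have h1 := le_trans xbs e1.
    have h2 : `|Xf s - Xf (sg + t)| <= et / (1 + T) * T.
      apply: le_trans (Xl _ _ sin (sub t tT)) _; apply: ler_pM => //.
        by rewrite !le_min ler01 (ltW ec0) divr_ge0// ltW.
      have /andP[t0 tT'] := tT.
      by rewrite -sgT opprD addrACA subrr add0r ger0_norm ?subr_ge0// gerBl.
    apply: le_trans (lerD h1 h2) _.
    by rewrite -[X in X + _]mulr1 -mulrDr divfK// gt_eqF.
have [q Aq [h1 h2]] := HT (flow (f := S) sg p) xb (v sg) Kxb
  (vM sg ltac:(by have := sub 0; rewrite addr0 lexx (ltW T0) => ->)).
exists q => //; split.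
  apply: (@le_trans _ _ delta') => //; move: (ltW h1).
  have -> // : translate (hfield (flow (f := S) sg p)) T = translate (hfield p) s.
  by rewrite -sgT addrC; exact: (f_equal (@hfield _ _ _ _ _ _ _) (esym (@flowD _ _ _ S T sg p))).
apply: le_trans (eucl_le_norm _) _; rewrite -cd -mulrDr ler_pM2l//.
rewrite -(subrKA (sol (f := S) (flow (f := S) sg p) xb (v sg) T)) (le_trans (ler_normD _ _))//.
by apply: lerD => //; apply: le_trans (norm_le_eucl _) (ltW h2).
Qed.

End SlowTracking.

(** * The limit inclusion *)

Section PushforwardProbability.
Context d1 d2 (T1 : measurableType d1) (T2 : measurableType d2) {R : realType}.

Lemma pushforward_probability (p : probability T1 R) (h : T1 -> T2) : measurable_fun setT h ->
  exists q : probability T2 R, (forall A, q A = p (h @^-1` A)) /\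
    forall (phi : T2 -> R) (B : R), measurable_fun setT phi -> (forall y, `|phi y| <= B) ->
      (\int[q]_y phi y = \int[p]_x phi (h x))%R.
Proof.
move=> mh.
exists (distribution p (mfun_Sub (mem_set mh : h \in mfun))); split => // phi B mphi phiB.
rewrite /Rintegral; congr fine; rewrite integral_pushforward//.
  exact/measurable_EFinP.
rewrite preimage_setT; apply: measurable_bounded_integrable => //.
- by have := @probability_setT _ _ _ p => /= ->; exact: ltry.
- exact: measurableT_comp.
- exists B; split; first exact: num_real.
  by move=> x Bx y _ /=; rewrite (le_trans (phiB _))// ltW.
Qed.

End PushforwardProbability.

Section Marginal.
Context {R : realType} {n m : nat} (g : vfield R n m)
  (d : vfield R n m -> vfield R n m -> R).
Hypothesis d_metric : metrizes (hull g) d.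
Hypothesis g_adm : admissible g.
Hypothesis g_lip : uniformly_lipschitz g.
Hypothesis fwd_sol : forall h x y0, hull g h -> exists u, fast_sol h x 0 y0 u.
Hypothesis g_uub : forall K0 : set 'rV[R]_n, compact K0 -> unif_ult_bounded g K0.
Notation X := 'rV[R]_n.
Notation Y := 'rV[R]_m.
Notation VF := (vfield R n m).
Notation S := (hull_system d_metric g_adm g_lip fwd_sol g_uub).
Notation P := (base S).
Notation Zs := [the pseudoPMetricType R of (P * Y)%type].
Let fld : P -> VF := @hfield _ _ _ _ _ d_metric (hull_g g_adm).

(** [omega_limit] is defined by sequences and [orbit_limit] by neighbourhoods; balls of radius
    [1 / (k + 1)] for the metric of the hull provide the sequence. *)
Lemma orbit_limit_omega : @orbit_limit _ _ _ S = [set p | omega_limit g (fld p)].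
Proof.
apply/seteqP; split => [p Lp|p [_ [tau tauoo Htau]] T V pV].
  split; first exact: hfieldP.
  have /choice[tau Htau] : forall k : nat, exists t : R, k%:R <= t /\
      ball p k.+1%:R^-1 (flow t (base0 S)).
    move=> k; have k0 : 0 < k.+1%:R^-1 :> R by rewrite invr_gt0.
    by have [t kt pt] := Lp k%:R _ (nbhsx_ballx p _ k0); exists t.
  exists tau.
    apply/cvgryPge => A; apply: filterS (nbhs_infty_ger A) => k /le_trans; apply.
    by have [] := Htau k.
  have cv : (fun k => flow (tau k) (base0 S)) @ \oo --> p.
    move=> A /nbhs_ballP[e /= e0 eA].
    suff : \forall k \near \oo, A (flow (tau k) (base0 S)) by [].
    have := @cvg_harmonic R; move/cvgrPdist_lt => /(_ e e0); apply: filterS => k.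
    rewrite sub0r normrN gtr0_norm ?invr_gt0// => ke; apply: eA.
    by apply: le_ball (Htau k).2; exact: ltW.
  apply: cvg_trans (cvg_app fld cv) _; exact: hfield_continuous.
have cv : (fun k => flow (tau k) (base0 S)) @ \oo --> p by apply: hfield_cvg.
have N1 : \forall k \near \oo, V (flow (tau k) (base0 S)) := cv _ pV.
have N2 : \forall k \near \oo, T <= tau k by move/cvgryPge : tauoo => /(_ T).
by have [k [Vk Tk]] := filterI_ex N1 N2; exists (tau k).
Qed.

(** [marginals] asks for a measure on [VF * Y], whereas [p] lives over the metric hull. Its image
    under the inclusion [j] is used, and support and invariance are checked on preimages under
    [j]. *)
Lemma averaged_field_window (f : X * Y -> X) (x : X) (v : X) (B rho : R) (p : probability (borel Zs) R) :
  continuous f -> (forall y, `|f (x, y)| <= B) ->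
  (forall (s : R) (A : set (borel Zs)), 0 <= s -> measurable A ->
    p (@frozen_flow _ _ _ S x s @^-1` A) = p A) ->
  (forall A0 : set Zs, closed A0 ->
    (forall V, open V -> A0 `<=` V -> exists s : R, 0 <= s /\
      forall q, `|q.2| <= rho -> V (@frozen_flow _ _ _ S x s q)) -> p (~` A0) = 0%E) ->
  p (~` (@orbit_limit _ _ _ S `*` setT)) = 0%E ->
  (forall i, v 0 i = (\int[p]_q f (x, q.2) 0 i)%R) ->
  averaged_field f g d x v.
Proof.
move=> fc fB pinv patt porb vE.
pose j (q : Zs) : VF * Y := (fld q.1, q.2).
have jc : continuous j.
  move=> z; have c1 := @comp_continuous_at _ _ _ fld (@fst P Y) z
    (@hfield_continuous _ _ _ _ _ d_metric (hull_g g_adm)) (@fst_continuous_at _ _ z).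
  exact: (@pair_continuous_at _ _ _ _ _ z c1 (@snd_continuous_at _ _ z)).
have mj : measurable_fun setT (j : borel Zs -> borel (VF * Y)%type) by apply: borel_continuous.
have [nu [nuE nuI]] := pushforward_probability p mj.
have ms : measurable_fun setT (snd : borel (VF * Y)%type -> borel Y).
  by apply: borel_continuous => z; exact: cvg_snd.
have [mu [muE muI]] := pushforward_probability nu ms.
exists mu.
  exists nu => [|A mA]; last by rewrite muE.
  split.
    rewrite nuE.
    pose A0 : set Zs := [set z | attractor_at g d x (fld z.1, z.2)].
    pose B0 : set Zs := @orbit_limit _ _ _ S `*` setT.
    (* The complement of the support is the union of two sets already known to be null. *)
    have -> : j @^-1` (~` (attractor_at g d x `&` (omega_limit g `*` setT))) = ~` A0 `|` ~` B0.
      rewrite -setCI -preimage_setC; congr (~` _); apply/seteqP; split => z.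
        by move=> [h1 [h2 _]]; split => //; split => //; rewrite orbit_limit_omega.
      by move=> [h1 [+ _]]; rewrite orbit_limit_omega => h2; split.
    have cA0 : closed A0 by exact: (@attractor_at_closed _ _ _ g d d_metric g_adm g_lip fwd_sol g_uub x).
    have cB0 : closed B0.
      rewrite (_ : B0 = fst @^-1` (@orbit_limit _ _ _ S)).
        apply: closed_comp; first by move=> z _; exact: cvg_fst.
        exact: orbit_limit_closed.
      by apply/seteqP; split => -[h y] //= [].
    rewrite null_set_setU//.
    - by apply: measurableC; exact: borel_closed.
    - by apply: measurableC; exact: borel_closed.
    - apply: patt => // V oV AV.
      exact: (@attractor_at_attracts _ _ _ g d d_metric g_adm g_lip fwd_sol g_uub x rho V oV AV).
  move=> tau A tau0 mA; rewrite !nuE.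
  have -> : j @^-1` ((hull g `*` setT) `&` semiflow_at x tau @^-1` A) =
      @frozen_flow _ _ _ S x tau @^-1` (j @^-1` A).
    apply/seteqP; split => [z [_ Az]|z Az]; first exact: Az.
    by split; [split => //; exact: hfieldP|exact: Az].
  by apply: pinv => //; have := mj measurableT A mA; rewrite setTI.
apply/rowP => i; rewrite mxE vE.
have fi : continuous (fun y => f (x, y) 0 i).
  move=> y; have c1 := @comp2_continuous_at _ _ _ _ f (fun=> x) id y fc (@cst_continuous_at _ _ x y) (@cvg_id _ (nbhs y)).
  exact: (@comp_continuous_at _ _ _ (fun v : X => v 0 i) _ y (@coord_continuous _ _ _ 0 i) c1).
have fiB y : `|f (x, y) 0 i| <= B by apply: le_trans (fB y); exact: rV_norm_coord.
rewrite (muI _ B)//; last exact: borel_continuousR.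
rewrite (nuI (fun z => f (x, z.2) 0 i) B)//.
apply: (measurableT_comp (f := fun y : borel Y => f (x, y) 0 i)) => //; exact: borel_continuousR.
Qed.

End Marginal.

(** Arzela-Ascoli along an ultrafilter: pointwise limits exist by compactness, and the common
    Lipschitz constant makes the convergence uniform on the compact interval. *)
Lemma ultra_uniform_limit {R : realType} {n : nat} (U : set_system nat) (t0 C R0 : R)
    (x : nat -> R -> 'rV[R]_n) : UltraFilter U -> 0 <= C ->
  U [set j | forall t, 0 <= t <= t0 -> `|x j t| <= R0 /\
    forall t', 0 <= t' <= t0 -> `|x j t - x j t'| <= C * `|t - t'|] ->
  exists z : R -> 'rV[R]_n,
    (forall s t, 0 <= s <= t0 -> 0 <= t <= t0 -> `|z s - z t| <= C * `|s - t|) /\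
    forall e, 0 < e -> U [set j | forall t, 0 <= t <= t0 -> `|x j t - z t| <= e].
Proof.
move=> UU C0 H.
have /choice[z Hz] : forall t : R, exists v : 'rV[R]_n, 0 <= t <= t0 -> (fun j => x j t) @ U --> v.
  move=> t; have [tt0|tt0] := pselect (0 <= t <= t0); last by exists 0.
  have := @compact_closed_ball0 R n R0.
  rewrite compact_ultra => /(_ _ (ultra_fmap (fun j => x j t) UU))[|v [_ Hv]]; last by exists v.
  suff : U [set j | `|x j t| <= R0] by [].
  by apply: filterS H => j Hj; have [] := Hj t tt0.
have zlip s t : 0 <= s <= t0 -> 0 <= t <= t0 -> `|z s - z t| <= C * `|s - t|.
  move=> st tt; apply/ler_addgt0Pr => e e0; have e20 : 0 < e / 2 by rewrite divr_gt0.
  have N1 : U [set j | `|z s - x j s| <= e / 2] by move/cvgrPdist_le : (Hz s st); exact.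
  have N2 : U [set j | `|z t - x j t| <= e / 2] by move/cvgrPdist_le : (Hz t tt); exact.
  have N12 : U ([set j | `|z s - x j s| <= e / 2] `&` [set j | `|z t - x j t| <= e / 2]) by exact: filterI.
  have [j [[/= h1 h2] Hj]] := filterI_ex N12 H.
  have [_ h3] := Hj s st; have {}h3 := h3 t tt.
  rewrite -(subrKA (x j s)) (le_trans (ler_normD _ _))//.
  have h4 : `|x j s - z t| <= C * `|s - t| + e / 2.
    by rewrite -(subrKA (x j t)) (le_trans (ler_normD _ _))// lerD// distrC.
  by rewrite distrC in h1; rewrite distrC; lra.
exists z; split => // e e0.
(* Moving from [s] to a nearby [t] costs [C e'] for [x j] and for [z], and the error at [t] is
   [e']. *)
pose e' := e / (2 * C + 1); have C1 : 0 < 2 * C + 1 by rewrite ltr_wpDl// mulr_ge0.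
have e'0 : 0 < e' by rewrite divr_gt0.
have FU : Filter U by exact: _.
have := (compact_near_coveringP _).1 (@segment_compact R 0 t0) nat U
  (fun j t => 0 <= t <= t0 -> `|x j t - z t| <= e) FU.
move=> /(_ _)/wrap[]; last first.
  move=> Hj; suff : U [set j | forall t, 0 <= t <= t0 -> `|x j t - z t| <= e] by [].
  by apply: filterS Hj => j Hj t tt0; apply: Hj => //; rewrite /= in_itv.
move=> t; rewrite /= in_itv /= => tt0.
have N1 : U [set j | `|z t - x j t| <= e'] by move/cvgrPdist_le : (Hz t tt0); exact.
exists (ball t e', [set j | `|z t - x j t| <= e'] `&` [set j | forall t, 0 <= t <= t0 -> `|x j t| <= R0 /\
  forall t', 0 <= t' <= t0 -> `|x j t - x j t'| <= C * `|t - t'|]).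
  by split; [exact: nbhsx_ballx|exact: filterI].
move=> [s j] [/= ts [zx Hj]].
move=> /= st0; move: ts; rewrite -ball_normE /= => /ltW ts.
have h1 : `|x j s - x j t| <= C * e'.
  by have [_ Hl] := Hj s st0; apply: le_trans (Hl t tt0) _; rewrite distrC ler_wpM2l.
have h2 : `|z t - z s| <= C * e' by apply: le_trans (zlip t s tt0 st0) _; rewrite ler_wpM2l.
rewrite -(subrKA (x j t)) (le_trans (ler_normD _ _))//.
have h3 : `|x j t - z s| <= e' + C * e'.
  by rewrite -(subrKA (z t)) (le_trans (ler_normD _ _))// lerD// distrC.
have E : e = (2 * C + 1) * e' by rewrite mulrC divfK// gt_eqF.
by rewrite [leRHS]E; lra.
Qed.

(** Sets of [U] meet every tail, so at each step an index can be found that is larger than the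
    previous one, has a smaller [eps], and satisfies the next requirement [Q k]. *)
Lemma diagonal_subsequence {R : realType} (U : set_system nat) (eps : nat -> R) (e0 : R)
    (Q : nat -> nat -> Prop) : UltraFilter U -> \oo `<=` U -> (forall j, 0 < eps j) ->
  eps @ \oo --> 0 -> 0 < e0 -> (forall k, U (Q k)) ->
  exists phi : nat -> nat, [/\ {homo phi : i j / (i < j)%N}, forall k, eps (phi k) < e0,
    nonincreasing_seq (eps \o phi), eps \o phi @ \oo --> 0 & forall k, Q k (phi k)].
Proof.
move=> UU Uoo epos eps0 e00 UQ.
have small e : 0 < e -> U [set j | eps j < e].
  move=> e_gt0; apply: Uoo; move/cvgrPdist_lt : eps0 => /(_ _ e_gt0); apply: filterS => j.
  by rewrite sub0r normrN gtr0_norm.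
have /choice[nx Hnx] : forall kj : nat * nat, exists j',
    [/\ (kj.2 < j')%N, eps j' < e0, eps j' < eps kj.2 & Q kj.1 j'].
  move=> [k j] /=.
  have U1 : U [set j' | (j < j')%N] by apply: Uoo; exact: nbhs_infty_gt.
  have U2 : U ([set j' | (j < j')%N] `&` [set j' | eps j' < e0]) by exact: filterI U1 (small _ e00).
  have U3 : U ([set j' | eps j' < eps j] `&` Q k) by exact: filterI (small _ (epos j)) (UQ k).
  by have [j' [[h1 h2] [h3 h4]]] := filterI_ex U2 U3; exists j'.
pose phi := fix phi k := if k is k'.+1 then nx (k, phi k') else nx (0%N, 0%N).
have phiS k : (phi k < phi k.+1)%N by have [] := Hnx (k.+1, phi k).
have homo : {homo phi : i j / (i < j)%N} by exact: (homo_ltn ltn_trans phiS).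
have phi_ge k : (k <= phi k)%N by elim: k => // k IH; exact: leq_ltn_trans IH (phiS k).
exists phi; split => //.
- by case=> [|k]; [have [] := Hnx (0%N, 0%N)|have [] := Hnx (k.+1, phi k)].
- apply/nonincreasing_seqP => k; have [_ _ h _] := Hnx (k.+1, phi k); exact: ltW.
- apply/cvgrPdist_lt => e e_gt0; move/cvgrPdist_lt : eps0 => /(_ e e_gt0)[N _ HN].
  by exists N => // k /= Nk; apply: HN; exact: leq_trans Nk (phi_ge k).
- by case=> [|k]; [have [] := Hnx (0%N, 0%N)|have [] := Hnx (k.+1, phi k)].
Qed.

Lemma lipschitz_abs_continuous {R : realType} {n : nat} (z : R -> 'rV[R]_n) (t0 C : R) : 0 <= C ->
  (forall s t, 0 <= s <= t0 -> 0 <= t <= t0 -> `|z s - z t| <= C * `|s - t|) ->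
  abs_continuous 0 t0 z.
Proof.
move=> C0 zlip e e0; pose C' := n.+1%:R * C + 1.
have C'0 : 0 < C' by rewrite ltr_wpDl// mulr_ge0.
exists (e / C'); first by rewrite divr_gt0.
move=> k s t Hst _; rewrite ltr_pdivlMr// => He.
apply: le_lt_trans He; rewrite mulr_suml; apply: ler_sum => i _.
have [s0 st tt0] := Hst i.
apply: le_trans (eucl_le_norm _) _; rewrite mulrC.
have h : `|z (t i) - z (s i)| <= C * (t i - s i).
  rewrite -[X in _ <= C * X]ger0_norm ?subr_ge0//; apply: zlip; first by rewrite (le_trans s0 st).
  by rewrite s0 (le_trans st tt0).
have := ler_wpM2r (ler0n R n.+1) h; move=> /le_trans; apply.
rewrite -mulrA mulrC -mulrA ler_wpM2l ?subr_ge0// /C'; lra.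
Qed.

(** The two endpoints, where the inclusion is not checked, are added to the null set of points
    without derivative. *)
Lemma lipschitz_inclusion_sol {R : realType} {n : nat} (F : 'rV[R]_n -> set 'rV[R]_n)
    (z : R -> 'rV[R]_n) (t0 C : R) : 0 < t0 -> 0 <= C ->
  (forall s t, 0 <= s <= t0 -> 0 <= t <= t0 -> `|z s - z t| <= C * `|s - t|) ->
  (forall t v, 0 < t < t0 -> dw `[0, t0] z t v -> F (z t) v) ->
  inclusion_sol F (z 0) t0 z.
Proof.
move=> t00 C0 zlip HF; split => //; first exact: lipschitz_abs_continuous C0 zlip.
have H1 := lipschitz_rV_derivable_ae t00 C0 zlip.
have Hne (c : R) : {ae @lebesgue_measure R, forall t, t != c}.
  exists [set c]; split; [exact: measurable_set1|exact: lebesgue_measure_set1|].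
  by move=> t /= /negP; rewrite negbK => /eqP.
apply: (@filterS3 _ _ (ae_filter_ringOfSetsType _) _ _ _ _ _ H1 (Hne 0) (Hne t0)) => t Ht tn0 tnt0; rewrite /= in_itv /= => /andP[h0 h1].
have t_in : 0 < t < t0 by rewrite !lt_neqAle eq_sym tn0 h0 tnt0 h1.
have [v dv] := Ht t_in; exists v; first exact: HF.
exact/deriv_withinP.
Qed.

(** * Subsequences and tracking for the slow-fast system *)

Section Assembly.
Context {R : realType} {n m : nat} (g : vfield R n m)
  (d : vfield R n m -> vfield R n m -> R).
Hypothesis d_metric : metrizes (hull g) d.
Hypothesis g_adm : admissible g.
Hypothesis g_lip : uniformly_lipschitz g.
Hypothesis fwd_sol : forall h x y0, hull g h -> exists u, fast_sol h x 0 y0 u.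
Hypothesis g_uub : forall K0 : set 'rV[R]_n, compact K0 -> unif_ult_bounded g K0.
Notation X := 'rV[R]_n.
Notation Y := 'rV[R]_m.
Notation VF := (vfield R n m).
Notation S := (hull_system d_metric g_adm g_lip fwd_sol g_uub).
Variables (f : X * Y -> X) (a b : R).
Hypothesis fc : continuous f.
Hypothesis f_growth : forall x y, `|f (x, y)| <= a + b * `|x|.

Lemma sf_solutionE (x0 : X) (y0 : Y) (e : R) (I : set R) (x : R -> X) (y : R -> Y) : 0 < e ->
  slow_fast_sol f g x0 y0 e I x y <-> [/\ x 0 = x0, y 0 = y0 & sf_solution S f e I x y].
Proof.
move=> e0; have vE t : vf (f := S) (flow (t / e) (base0 S)) (x t) (y t) = g (x t, y t, t / e).
  exact: hvec_flow.
split => -[x00 y00 H]; split => // t It; have [hx hy] := H t It.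
  split; first exact/deriv_withinP.
  have [v /deriv_withinP dv ev] := hy.
  by rewrite vE -ev scalerA mulVf ?gt_eqF// scale1r.
split; first exact/deriv_withinP.
exists (e^-1 *: g (x t, y t, t / e)); last by rewrite scalerA mulfV ?gt_eqF// scale1r.
by apply/deriv_withinP; rewrite -vE.
Qed.

Variables (x0 : X) (t0 e0 R0 C M : R) (xe : R -> R -> X) (ye : R -> R -> Y).
Hypothesis t0_gt0 : 0 < t0.
Hypothesis e0_gt0 : 0 < e0.
Hypothesis C_ge0 : 0 <= C.
Hypothesis xe_0 : forall e, 0 < e < e0 -> xe e 0 = x0.
Hypothesis xye_sol : forall e, 0 < e < e0 -> sf_solution S f e `[0, t0] (xe e) (ye e).
Hypothesis xe_bound : forall e t, 0 < e < e0 -> 0 <= t <= t0 -> `|xe e t| <= R0.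
Hypothesis ye_bound : forall e t, 0 < e < e0 -> 0 <= t <= t0 -> `|ye e t| <= M.
Hypothesis xe_lip : forall e t t', 0 < e < e0 -> 0 <= t <= t0 -> 0 <= t' <= t0 ->
  `|xe e t - xe e t'| <= C * `|t - t'|.

Lemma averaging_subsequence (eps : nat -> R) : (forall j, 0 < eps j) -> eps @ \oo --> 0 ->
  exists (phi : nat -> nat) (z : R -> X), {homo phi : i j / (i < j)%N} /\
    converges_to_inclusion (averaged_field f g d) x0 t0 xe (eps \o phi) z.
Proof.
move=> eps_gt0 eps0.
have [U [UU Uoo]] := @ultraFilterLemma _ \oo _.
have small : U [set j | eps j < e0].
  apply: Uoo; move/cvgrPdist_lt : eps0 => /(_ _ e0_gt0); apply: filterS => j.
  by rewrite sub0r normrN gtr0_norm.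
have [|z [zlip zU]] := @ultra_uniform_limit R n U t0 C R0 (fun j => xe (eps j)) UU C_ge0.
  apply: filterS small => j je t tt0; have je' : 0 < eps j < e0 by rewrite eps_gt0.
  by split => [|t' t't0]; [exact: xe_bound|exact: xe_lip].
(* The rates [harmonic k] turn closeness along [U] into ordinary uniform convergence of the diagonal
   subsequence. *)
have UQ k : U [set j | forall t, 0 <= t <= t0 -> `|xe (eps j) t - z t| <= harmonic k].
  by apply: zU; rewrite invr_gt0.
have [phi [homo phi_small phi_dec phi0 phiQ]] :=
  diagonal_subsequence UU Uoo eps_gt0 eps0 e0_gt0 UQ.
have phi_e k : 0 < eps (phi k) < e0 by rewrite eps_gt0 phi_small.
have unif e : 0 < e -> \forall k \near \oo, forall t, 0 <= t <= t0 ->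
    `|xe (eps (phi k)) t - z t| <= e.
  move=> e_gt0; have := @cvg_harmonic R; move/cvgrPdist_lt => /(_ e e_gt0); apply: filterS => k.
  rewrite sub0r normrN gtr0_norm ?invr_gt0// => ke t tt0.
  by apply: le_trans (phiQ k t tt0) _; exact: ltW.
have z0 : z 0 = x0.
  apply/esym/eqP; rewrite -subr_eq0 -normr_le0; apply/ler_addgt0Pr => e e_gt0; rewrite add0r.
  have /filter_ex[k Hk] := unif e e_gt0.
  by have := Hk 0; rewrite xe_0// lexx (ltW t0_gt0); exact.
exists phi, z; split => //; split => //.
- by move=> k; exact: eps_gt0.
- apply/uniform_cvg_normP => e e_gt0; apply: filterS (unif e e_gt0) => k Hk t.
  by rewrite /= in_itv /=; exact: Hk.
- rewrite -z0; apply: (lipschitz_inclusion_sol t0_gt0 C_ge0 zlip) => t v tt0 dz.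
  have [p [pinv patt porb pv]] := @averaged_derivative R n m S f a b fc f_growth t0 C M
    (eps \o phi) (fun j => xe (eps (phi j))) (fun j => ye (eps (phi j))) z
    (fun j => eps_gt0 (phi j)) phi0 (fun j => xye_sol (phi_e j)) C_ge0
    (fun j t t' => @xe_lip _ t t' (phi_e j)) (fun j t => @ye_bound _ t (phi_e j)) unif t v tt0 dz.
  apply: (averaged_field_window (d_metric := d_metric) (g_adm := g_adm) (g_lip := g_lip)
    (fwd_sol := fwd_sol) (g_uub := g_uub) fc _ pinv patt porb pv).
  by move=> y; exact: f_growth.
Qed.

Lemma inflated_tracking (eps : nat -> R) (z : R -> X) (r delta T : R) (y0 : Y) :
  converges_to_inclusion (averaged_field f g d) x0 t0 xe eps z -> 0 < r -> 0 < delta -> 0 < T ->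
  (forall e, 0 < e < e0 -> ye e 0 = y0) ->
  let K0 := tube z t0 r in let A := layered_attractor g d K0 in
  tracks d_metric g_adm delta y0 A K0 T ->
  exists k0 : nat, [/\ (0 < k0)%N, 2 * T < t0 / eps k0 &
    forall k, (k0 <= k)%N -> forall tau : R, T <= tau <= t0 / eps k ->
      (semidist (@eucl_dist R m) [set ye (eps k) (eps k * tau)%R]
         (inflated g d K0 A delta (translate g tau) (z (eps k * tau)%R)) <= delta%:E)%E].
Proof.
move=> [eps_gt0 _ eps0 /uniform_cvg_normP zunif [_ zac _]] r0 delta0 T0 ye0 K0 A [e1 e10 HT].
have K0c : compact K0 by exact: tube_compact.
have Kz t : 0 <= t <= t0 -> K0 (z t).
  move=> tt0; exists t; first by rewrite /= in_itv.
  exists 0; last by rewrite addr0.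
  by have := eucl_distxx (0 : X); rewrite /eucl_dist subrr /= => ->; exact: ltW.
have K00 : K0 !=set0 by exists (z 0); apply: Kz; rewrite lexx ltW.
have [AH _ _ _ _] := layered_attractorP d_metric g_adm g_lip fwd_sol g_uub K0c K00.
(* In order: validity of the a priori bounds, the inequality [2 T < t0 / eps], and a Lipschitz
   constant at most [e1] for the slow component in fast time. *)
pose eb := Num.min e0 (Num.min (t0 / (2 * T)) (e1 / (C + 1))).
have C10 : 0 < C + 1 by rewrite ltr_wpDl.
have eb0 : 0 < eb by rewrite !lt_min e0_gt0 !divr_gt0// mulr_gt0.
have N1 : \forall k \near \oo, eps k < eb.
  move/cvgrPdist_lt : eps0 => /(_ _ eb0); apply: filterS => k.
  by rewrite sub0r normrN gtr0_norm.
have [N _ HN] := filterI N1 (zunif e1 e10).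
(* The successor makes [k0] positive. *)
exists N.+1; split => //.
  have [/= + _] := HN N.+1 (leqnSn N); rewrite !lt_min => /and3P[_ h _].
  by rewrite ltr_pdivlMr// mulrC -ltr_pdivlMr ?mulr_gt0.
move=> k Nk tau /andP[Ttau tauk].
have [/= + Hz] := HN k (ltnW Nk); rewrite !lt_min => /and3P[ke0 _ kC].
have ek : 0 < eps k < e0 by rewrite eps_gt0.
have e_gt0 := eps_gt0 k.
have sc t : 0 <= t <= tau -> 0 <= eps k * t <= t0.
  move=> /andP[h1 h2]; rewrite mulr_ge0 ?(ltW e_gt0)//= mulrC -ler_pdivlMr//.
  exact: le_trans tauk.
have zx t : 0 <= t <= tau -> `|z (eps k * t) - xe (eps k) (eps k * t)| <= e1.
  by move=> ttau; rewrite distrC; apply: Hz; rewrite /= in_itv /=; exact: sc.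
have tauin : 0 <= tau <= tau by rewrite (le_trans (ltW T0) Ttau) lexx.
have [||||q Aq [h1 h2]] := HT (base0 S) tau (fun t => xe (eps k) (eps k * t))
  (fun t => ye (eps k) (eps k * t)) Ttau _ _ _ _ (z (eps k * tau)) (Kz _ (sc _ tauin)) (zx _ tauin).
- by rewrite mulr0 ye0.
- move=> t /andP[t1 t2].
  have := sf_rescale e_gt0 (xye_sol ek) (tau := t); rewrite t1 (le_trans t2 tauk) => /(_ isT).
  by apply: dwS => s /=; rewrite !in_itv /= => /andP[-> /le_trans]; apply.
- by move=> t ttau; exists (z (eps k * t)); [exact: Kz (sc t ttau)|exact: zx].
- move=> t t' tt t't; apply: le_trans (xe_lip ek (sc t tt) (sc t' t't)) _.
  rewrite -mulrBr normrM gtr0_norm// mulrA ler_wpM2r//.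
  apply: (@le_trans _ _ ((C + 1) * eps k)); first by rewrite ler_pM2r// lerDl.
  by rewrite mulrC -ler_pdivlMr// ltW.
(* The parameters of [q] are within [delta] of the current ones, so [q.2] belongs to the inflated
   section. *)
apply: semidist_le => _ ->; exists q.2 => //; exists q.1.
  by split => //; have [] := AH q Aq.
by case: q Aq h1 h2 => -[h x] y.
Qed.

End Assembly.
Theorem theorem4p2 (R : realType) (n m : nat)
  (f : 'rV[R]_n * 'rV[R]_m -> 'rV[R]_n) (g : vfield R n m) (a b : R)
  (d : vfield R n m -> vfield R n m -> R)
  (f_cont : continuous f)
  (a_gt0 : 0 < a) (b_gt0 : 0 < b)
  (f_growth : forall x y, eucl_norm (f (x, y)) <= a + b * eucl_norm x)
  (g_adm : admissible g)
  (g_lip : uniformly_lipschitz g)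
  (d_metric : metrizes (hull g) d)
  (fwd_sol : forall h x y0, hull g h -> exists u, fast_sol h x 0 y0 u)
  (g_uub : forall K0 : set 'rV[R]_n, compact K0 -> unif_ult_bounded g K0) :
  (* T = T(delta, y0, A) in (ii) *)
  exists T : R -> 'rV[R]_m -> set (vfield R n m * 'rV[R]_n * 'rV[R]_m) -> R,
  (forall delta y0 A, 0 < delta -> 0 < T delta y0 A) /\
  forall (x0 : 'rV[R]_n) (y0 : 'rV[R]_m) (J : R -> set R)
    (x : R -> R -> 'rV[R]_n) (y : R -> R -> 'rV[R]_m),
  (forall e, 0 < e -> forward_interval (J e) /\
     slow_fast_sol f g x0 y0 e (J e) (x e) (y e)) ->
  forall t0 : R, 0 < t0 ->
  exists2 e0 : R, 0 < e0 &
  let extension e (u : R -> 'rV[R]_n) (v : R -> 'rV[R]_m) :=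
    slow_fast_sol f g x0 y0 e `[0, t0] u v /\
    (forall t, J e t -> t <= t0 -> u t = x e t /\ v t = y e t) in
  (forall e, 0 < e < e0 -> exists u v, extension e u v) /\
  forall (xe : R -> R -> 'rV[R]_n) (ye : R -> R -> 'rV[R]_m),
  (forall e, 0 < e < e0 -> extension e (xe e) (ye e)) ->
  (* (i) *)
  (forall eps : nat -> R, (forall j, 0 < eps j) -> eps @ \oo --> 0 ->
   exists (phi : nat -> nat) (z : R -> 'rV[R]_n),
     {homo phi : i j / (i < j)%N} /\
     converges_to_inclusion (averaged_field f g d) x0 t0 xe (eps \o phi) z) /\
  (* (ii) *)
  (forall (eps : nat -> R) (z : R -> 'rV[R]_n),
   converges_to_inclusion (averaged_field f g d) x0 t0 xe eps z ->
   forall r : R, 0 < r ->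
   let K0 := tube z t0 r in
   let A := layered_attractor g d K0 in
   forall delta : R, 0 < delta ->
   let Td := T delta y0 A in
   exists k0 : nat, [/\ (0 < k0)%N, 2 * Td < t0 / eps k0 &
     forall k, (k0 <= k)%N -> forall tau : R, Td <= tau <= t0 / eps k ->
       (semidist (@eucl_dist R m) [set ye (eps k) (eps k * tau)%R]
          (inflated g d K0 A delta (translate g tau) (z (eps k * tau)%R))
        <= delta%:E)%E]).
Proof.
(* Growth constant after passing from the Euclidean norm to the sup norm. *)
pose b' := b * n.+1%:R.
have b'_gt0 : 0 < b' by rewrite mulr_gt0.
have f_growth' x y : `|f (x, y)| <= a + b' * `|x|.
  apply: le_trans (norm_le_eucl _) _; apply: le_trans (f_growth x y) _.
  by rewrite lerD2l -mulrA ler_pM2l// eucl_le_norm.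
pose good delta y0 A (T : R) := 0 < T /\ forall K0, compact K0 -> K0 !=set0 ->
  A = layered_attractor g d K0 -> tracks d_metric g_adm delta y0 A K0 T.
(* [T] must be a function of [A] before any [K0] is given. The default 1 keeps it positive for sets
   [A] without a good time. *)
pose T delta y0 A := if pselect (exists T, good delta y0 A T) is left e then sval (cid e) else 1.
have T_gt0 delta y0 A : 0 < T delta y0 A.
  by rewrite /T; case: pselect => // e; have [] := svalP (cid e).
have TP delta y0 K0 : 0 < delta -> compact K0 -> K0 !=set0 ->
    let A := layered_attractor g d K0 in
    tracks d_metric g_adm delta y0 A K0 (T delta y0 A).
  move=> delta0 K0c K00 A; rewrite /T; case: pselect => [e|]; first by have [_] := svalP (cid e); exact.
  case; have [T1 T10 HT1] := tracks_exists d_metric g_adm g_lip fwd_sol g_uub y0 delta0 K0c K00.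
  (* A second compact set with the same attractor has the same projection, hence equals [K0], and
     [T1] serves it too. *)
  exists T1; split => // K1 K1c K10 AE.
  rewrite -(layered_projection d_metric g_adm g_lip fwd_sol g_uub K1c K10) -AE.
  by rewrite (layered_projection d_metric g_adm g_lip fwd_sol g_uub K0c K00).
pose S := hull_system d_metric g_adm g_lip fwd_sol g_uub.
exists T; split => [delta y0 A _|x0 y0 J x y Hsol t0 t0_gt0]; first exact: T_gt0.
have [e1 e10 Hext] := @sf_extend R n m S f a b' f_cont a_gt0 b'_gt0 f_growth' x0 y0 t0 t0_gt0.
have [M [e2 [M0 e20 Hap]]] := @sf_apriori R n m S f a b' a_gt0 b'_gt0 f_growth' x0 y0 t0 t0_gt0.
(* [e1] ensures the extension, [e2] the bounds for every solution on [[0, t0]], in particular for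
   whichever extension is given. *)
exists (Num.min e1 e2); first by rewrite lt_min e10.
move=> extension; split.
  move=> e /andP[e_gt0]; rewrite lt_min => /andP[ee1 ee2].
  have [[Ji J0 Jpos _] /(sf_solutionE d_metric g_adm g_lip fwd_sol g_uub)] := Hsol e e_gt0.
  move=> /(_ e_gt0)[xe0 ye0 sol].
  have ee : 0 < e < e1 by rewrite e_gt0.
  have [u [v [uv u0 v0 uvE]]] := Hext e (J e) (x e) (y e) ee Ji J0 Jpos xe0 ye0 sol.
  by exists u, v; split => //; apply/(sf_solutionE d_metric g_adm g_lip fwd_sol g_uub).
move=> xe ye Hxy.
pose e0 := Num.min e1 e2; have e0_gt0 : 0 < e0 by rewrite lt_min e10.
have sol e : 0 < e < e0 -> [/\ xe e 0 = x0, ye e 0 = y0 & sf_solution S f e `[0, t0] (xe e) (ye e)].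
  move=> ee; have /andP[e_gt0 _] := ee; have [+ _] := Hxy e ee.
  by move=> /(sf_solutionE d_metric g_adm g_lip fwd_sol g_uub); exact.
have ap e : 0 < e < e0 -> forall t, 0 <= t <= t0 ->
    [/\ `|xe e t| <= slow_radius a b' x0 t0, `|ye e t| <= M & forall t', 0 <= t' <= t0 ->
      `|xe e t - xe e t'| <= (a + b' * slow_radius a b' x0 t0) * `|t - t'|].
  move=> ee; have [xe0 ye0 sfs] := sol e ee.
  have ee2 : 0 < e < e2 by move: ee; rewrite lt_min => /and3P[-> _ ->].
  have t00 : 0 <= t0 <= t0 by rewrite lexx (ltW t0_gt0).
  exact: (Hap e t0 (xe e) (ye e) ee2 t00 xe0 ye0 sfs).
have C_ge0 : 0 <= a + b' * slow_radius a b' x0 t0.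
  rewrite addr_ge0 ?(ltW a_gt0)// mulr_ge0 ?(ltW b'_gt0)//.
  exact: (slow_radius_ge0 b' a_gt0 x0 (ltW t0_gt0)).
have xe_0 e : 0 < e < e0 -> xe e 0 = x0 by move=> /sol[].
have ye_0 e : 0 < e < e0 -> ye e 0 = y0 by move=> /sol[].
have xye e : 0 < e < e0 -> sf_solution S f e `[0, t0] (xe e) (ye e) by move=> /sol[].
have xeB e t : 0 < e < e0 -> 0 <= t <= t0 -> `|xe e t| <= slow_radius a b' x0 t0.
  by move=> ee tt0; have [] := ap e ee t tt0.
have yeB e t : 0 < e < e0 -> 0 <= t <= t0 -> `|ye e t| <= M.
  by move=> ee tt0; have [] := ap e ee t tt0.
have xeL e t t' : 0 < e < e0 -> 0 <= t <= t0 -> 0 <= t' <= t0 ->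
    `|xe e t - xe e t'| <= (a + b' * slow_radius a b' x0 t0) * `|t - t'|.
  by move=> ee tt0 tt'; have [_ _] := ap e ee t tt0; exact.
split => [eps eps_gt0 eps0|eps z Hz r r_gt0 K0 A delta delta_gt0 Td].
  exact: (averaging_subsequence f_cont f_growth' t0_gt0 e0_gt0 C_ge0 xe_0 xye xeB yeB xeL).
apply: (inflated_tracking t0_gt0 e0_gt0 C_ge0 xye xeL Hz r_gt0 delta_gt0 (T_gt0 _ _ _) ye_0).
have [_ _ _ _ [_ zac _]] := Hz.
apply: TP => //; first exact: tube_compact.
exists (z 0 + 0); exists 0; first by rewrite /= in_itv /= lexx (ltW t0_gt0).
exists 0 => //; have := eucl_distxx (0 : 'rV[R]_n); rewrite /eucl_dist subrr /= => ->.
exact: ltW.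
Qed.
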